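(* Let $M$ be an analytic manifold modelled on an ultrametric Banach space over a complete ultrametric field $\mathbb{K}$. Let $f\colon M\to M$ be an analytic diffeomorphism and $p\in M$ be a fixed point of $f$. If $a\in (0,1]$ and $T_p(f)\colon T_p(M)\to T_p(M)$ is $a$-hyperbolic, then there exists a unique analytic manifold structure on the $a$-stable set $W:=W_a^{\mathrm{s}}(f,p)$ such that (a)--(c) hold: (a) $W$ is an immersed submanifold of $M$; (b) $W$ is tangent at $p$ to the $a$-stable subspace $T_p(M)_{a,\mathrm{s}}$ with respect to $T_p(f)$, i.e., $T_p(W)=T_p(M)_{a,\mathrm{s}}$; (c) $f$ restricts to an analytic diffeomorphism $W\to W$. Moreover, each neighbourhood of $p$ in $W$ contains an open neighbourhood $\Omega$ of $p$ in $W$ which is a submanifold of $M$, is $f$-invariant (i.e., $f(\Omega)\subseteq \Omega$), and such that $W=\bigcup_{n=0}^\infty f^{-n}(\Omega)$.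
   Context: A complete ultrametric field is a field $\mathbb{K}$ with an absolute value $|.|$ satisfying $|x+y|\le\max\{|x|,|y|\}$, whose associated metric defines a non-discrete topology and is complete. An ultrametric Banach space over $\mathbb{K}$ is a complete normed $\mathbb{K}$-vector space whose norm satisfies $\|x+y\|\le\max\{\|x\|,\|y\|\}$. $B^E_r(x)=\{y\in E:\|y-x\|<r\}$. Analytic maps: for ultrametric Banach spaces $E,F$, a continuous homogeneous polynomial $p_k\colon E\to F$ of degree $k$ is a map $x\mapsto\beta(x,\ldots,x)$ with $\beta\colon E^k\to F$ continuous $k$-linear (constant for $k=0$), and $\|p_k\|$ is the infimum of $\|\beta\|$ over all such $\beta$. A map $f\colon U\to F$ on an open set $U\subseteq E$ is analytic if for each $x\in U$ there are such $p_k$, $k\in\mathbb{N}_0$, with $\rho:=\sup\{r\ge 0: \|p_k\|r^k\to 0\}>0$, and $r\in(0,\rho]$ with $B^E_r(x)\subseteq U$ and $f(x+y)=\sum_k p_k(y)$ for $y\in B^E_r(0)$. Analytic manifolds modelled on $E$, tangent spaces and tangent maps are defined as usual (Hausdorff space with a maximal atlas of charts onto open subsets of $E$ with analytic transition maps). A subset $N\subseteq M$ is a submanifold if there is a complemented vector subspace $F$ of the modelling space such that each point of $N$ lies in the domain $U$ of a chart $\phi\colon U\to V$ of $M$ with $\phi(N\cap U)=F\cap V$. An analytic manifold $N$ is an immersed submanifold of $M$ if $N\subseteq M$ as a set and the inclusion map $N\to M$ is an immersion (tangent maps injective with complemented image); tangent spaces of $N$ are identified with subspaces of those of $M$. $a$-hyperbolicity: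 let $E$ be an ultrametric Banach space, $\alpha\colon E\to E$ continuous linear, $a>0$. Then $\alpha$ is $a$-hyperbolic if there exist $\alpha$-invariant vector subspaces $E_{a,\mathrm{s}}$, $E_{a,\mathrm{u}}$ with $E=E_{a,\mathrm{s}}\oplus E_{a,\mathrm{u}}$ and an ultrametric norm $\|.\|$ on $E$ defining its topology such that (i) $\|x+y\|=\max\{\|x\|,\|y\|\}$ for $x\in E_{a,\mathrm{s}}$, $y\in E_{a,\mathrm{u}}$; (ii) $\alpha_2:=\alpha|_{E_{a,\mathrm{u}}}\colon E_{a,\mathrm{u}}\to E_{a,\mathrm{u}}$ is invertible; (iii) $\|\alpha_1\|<a$ and $\frac{1}{\|\alpha_2^{-1}\|}>a$ for the operator norms with respect to $\|.\|$, where $\alpha_1:=\alpha|_{E_{a,\mathrm{s}}}$ and $\frac10:=\infty$. The subspace $E_{a,\mathrm{s}}$ is uniquely determined and called the $a$-stable subspace. $a$-stable set: for $a\in(0,1]$, $W_a^{\mathrm{s}}(f,p)$ is the set of all $x\in M$ such that $f^n(x)\to p$ as $n\to\infty$ and $a^{-n}\|\kappa(f^n(x))\|\to 0$, for some (equivalently, every) chart $\kappa\colon U\to V\subseteq E$ of $M$ around $p$ with $\kappa(p)=0$ and some (equivalently, every) ultrametric norm $\|.\|$ on the modelling space $E$ defining its topology. *)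

(* Defs.v *)
From HB Require Import structures.
From mathcomp Require Import all_boot all_order all_algebra.
From mathcomp Require Import all_classical all_reals all_analysis.

Set Implicit Arguments.
Unset Strict Implicit.
Unset Printing Implicit Defensive.

Import Order.TTheory GRing.Theory Num.Theory.
Import numFieldNormedType.Exports.

Local Open Scope classical_set_scope.
Local Open Scope ring_scope.

(* The normed modules of the library have norms valued in their own scalar
   field; here the norms on a K-vector space take values in a realType R, and
   K itself carries an R-valued ultrametric absolute value. *)

Definition metric_complete (R : realType) (V : zmodType) (n : V -> R) : Prop :=
  forall u : nat -> V,
    (forall e : R, 0 < e -> exists N, forall i j, (N <= i)%N -> (N <= j)%N ->
      n (u i - u j) < e) ->
    exists l : V, forall e : R, 0 < e -> exists N, forall i, (N <= i)%N ->
      n (u i - l) < e.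

HB.mixin Record isUltraField (R : realType) K & GRing.Field K := {
  absv : K -> R ;
  absv_ge0 : forall x, 0 <= absv x ;
  absv_eq0 : forall x, absv x = 0 <-> x = 0 ;
  absvM : forall x y, absv (x * y) = absv x * absv y ;
  absvD : forall x y, absv (x + y) <= Num.max (absv x) (absv y) ;
  absv_nondiscrete : forall e : R, 0 < e -> exists2 x, x <> 0 & absv x < e ;
  absv_complete : metric_complete absv
}.

#[short(type="ultraFieldType")]
HB.structure Definition UltraField (R : realType) :=
  {K of GRing.Field K & isUltraField R K}.

Record ultrametric_norm (R : realType) (K : ultraFieldType R) (V : lmodType K)
    (n : V -> R) : Prop := UltrametricNorm {
  un_ge0 : forall x, 0 <= n x ;
  un_eq0 : forall x, n x = 0 <-> x = 0 ;
  unZ : forall (c : K) x, n (c *: x) = absv c * n x ;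
  unD : forall x y, n (x + y) <= Num.max (n x) (n y)
}.

HB.mixin Record isUltraBanach (R : realType) (K : ultraFieldType R) E
    & GRing.Lmodule K E := {
  unorm : E -> R ;
  unorm_ultrametric : ultrametric_norm unorm ;
  unorm_complete : metric_complete unorm
}.

#[short(type="ultraBanachType")]
HB.structure Definition UltraBanach (R : realType) (K : ultraFieldType R) :=
  {E of GRing.Lmodule K E & isUltraBanach R K E}.

Section unorm_metric.
Context {R : realType} {K : ultraFieldType R} (E : ultraBanachType K).

Let udist (x y : E) : R := unorm (x - y).

Let udistxx x : udist x x = 0.
Proof. by rewrite /udist subrr; apply/(un_eq0 unorm_ultrametric). Qed.

Let udist_eq0 x y : udist x y = 0 -> x = y.
Proof. by move=> /(un_eq0 unorm_ultrametric)/subr0_eq. Qed.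

Let absvN1 : absv (-1 : K) = 1.
Proof.
have a1 : absv (1 : K) = 1.
  have a0 : absv (1 : K) != 0.
    by apply/eqP => /absv_eq0/eqP; rewrite oner_eq0.
  by apply: (mulfI a0); rewrite -absvM !mulr1.
have : absv (-1 : K) ^+ 2 = 1 by rewrite expr2 -absvM mulrNN mulr1.
by move=> /eqP; rewrite sqrp_eq1 ?absv_ge0// => /eqP.
Qed.

Let udist_sym x y : udist x y = udist y x.
Proof.
by rewrite /udist -opprB -scaleN1r (unZ unorm_ultrametric) absvN1 mul1r.
Qed.

Let udist_triangle y x z : udist x z <= udist x y + udist y z.
Proof.
rewrite /udist -[x - z](subrKA y) (le_trans (unD unorm_ultrametric _ _))//.
by rewrite ge_max lerDl lerDr !(un_ge0 unorm_ultrametric).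
Qed.

HB.instance Definition _ :=
  isMetric.Build R E udistxx udist_eq0 udist_sym udist_triangle.

End unorm_metric.

Section analytic_maps.
Context {R : realType} {K : ultraFieldType R} {E F : ultraBanachType K}.

Definition multilinear (k : nat) (b : ('I_k -> E) -> F) : Prop :=
  forall (i : 'I_k) (x : 'I_k -> E),
    linear (fun y : E => b (fun j => if j == i then y else x j)).

(* The infimum is over a nonempty set when b is continuous. *)
Definition multilinear_norm (k : nat) (b : ('I_k -> E) -> F) : R :=
  inf [set C : R | 0 <= C /\
    forall x, unorm (b x) <= C * \prod_(i < k) unorm (x i)].

(* b is a continuous k-linear map whose restriction to the diagonal is q *)
Definition polarizes (k : nat) (q : E -> F) (b : ('I_k -> E) -> F) : Prop :=
  [/\ multilinear b, continuous (b : {ptws 'I_k -> E} -> F)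
    & forall x, q x = b (fun=> x)].

Definition homogeneous_polynomial (k : nat) (q : E -> F) : Prop :=
  exists b : ('I_k -> E) -> F, polarizes q b.

Definition polynomial_norm (k : nat) (q : E -> F) : R :=
  inf [set multilinear_norm b | b in [set b : ('I_k -> E) -> F | polarizes q b]].

Definition convergence_radius (q : nat -> E -> F) : \bar R :=
  ereal_sup [set r%:E | r in [set r : R | 0 <= r /\
    (fun k => polynomial_norm k (q k) * r ^+ k) @ \oo --> (0 : R)]].

(* Only the values of f on U are relevant. *)
Definition analytic_on (U : set E) (f : E -> F) : Prop :=
  open U /\
  forall x, U x -> exists q : nat -> E -> F,
    [/\ forall k, homogeneous_polynomial k (q k),
        (0 < convergence_radius q)%E
      & exists r : R,
        [/\ 0 < r, (r%:E <= convergence_radius q)%E, ball x r `<=` U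
          & forall y, ball (0 : E) r y ->
              series (fun k => q k y) @ \oo --> f (x + y)]].

Definition is_differential (f : E -> F) (x : E) (L : E -> F) : Prop :=
  [/\ linear L, continuous L
    & forall e : R, 0 < e -> \forall y \near (0 : E),
        unorm (f (x + y) - f x - L y) <= e * unorm y].

(* The differential of f at x, or 0 if f is not differentiable at x. *)
Definition differential (f : E -> F) (x : E) : E -> F :=
  xget (fun=> 0) [set L | is_differential f x L].

Lemma linear_differential (f : E -> F) (x : E) : linear (differential f x).
Proof.
rewrite /differential; case: xgetP => [L _ []//|_] c y z.
by rewrite scaler0 addr0.
Qed.

End analytic_maps.

(* A topology on X as a first-class value, so that one set may carry several. *)
Record topology_on (X : Type) : Type := TopologyOn {
  opens : set (set X) ;
  opens_setT : opens setT ;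
  opens_setI : setI_closed opens ;
  opens_bigcup : forall C : set (set X), C `<=` opens ->
    opens (\bigcup_(A in C) A)
}.

Definition tspace (X : Type) (t : topology_on X) : Type := X.

Section tspace_topology.
Variables (X : Type) (t : topology_on X).

HB.instance Definition _ := gen_eqMixin (tspace t).
HB.instance Definition _ := gen_choiceMixin (tspace t).

Let opens_bigU (I : Type) (f : I -> set (tspace t)) :
  (forall i, opens t (f i)) -> opens t (\bigcup_i f i).
Proof.
move=> fo; suff -> : \bigcup_i f i = \bigcup_(A in range f) A.
  by apply: opens_bigcup => _ [i _ <-].
by rewrite bigcup_image.
Qed.

HB.instance Definition _ :=
  isOpenTopological.Build (tspace t) (opens_setT t) (@opens_setI _ t) opens_bigU.

End tspace_topology.

Section topology_of.
Variable T : topologicalType.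

Let open_bigcup (C : set (set T)) :
  C `<=` open -> open (\bigcup_(A in C) A).
Proof. by move=> Co; apply: bigcup_open => A /Co. Qed.

Definition topology_of : topology_on T :=
  TopologyOn openT (@openI T) open_bigcup.

End topology_of.

Section hyperbolicity.
Context {R : realType} {K : ultraFieldType R} {V : lmodType K}.
Implicit Types (t : topology_on V) (A B D Es Eu : set V).

Definition norm_defines_topology t (n : V -> R) : Prop :=
  forall A, opens t A <->
    forall x, A x -> exists2 e : R, 0 < e & [set y | n (y - x) < e] `<=` A.

Definition linear_subspace A : Prop :=
  A 0 /\ forall (c : K) x y, A x -> A y -> A (c *: x + y).

Definition direct_sum A B : Prop :=
  [/\ linear_subspace A, linear_subspace B, A `&` B = [set 0]
    & forall x, exists2 y, A y & B (x - y)].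

(* A has a topological complement: A (+) B = V as topological vector spaces,
   i.e. the projection P onto A along B is continuous. *)
Definition complemented t A : Prop :=
  exists B, direct_sum A B /\
  exists2 P : V -> V, continuous (P : tspace t -> tspace t) &
    forall x, A (P x) /\ B (x - P x).

(* Operator norm of g restricted to D; it is +oo if g is unbounded on D. *)
Definition operator_norm (n : V -> R) D (g : V -> V) : \bar R :=
  ereal_inf [set C%:E | C in [set C : R | 0 <= C /\
    forall x, D x -> n (g x) <= C * n x]].

(* The extended-real inverse satisfies 0^-1 = +oo and +oo^-1 = 0. *)
Definition hyperbolic_splitting t (a : R) (alpha : V -> V) Es Eu : Prop :=
  [/\ direct_sum Es Eu,
      (forall x, Es x -> Es (alpha x)),
      (forall x, Eu x -> Eu (alpha x))
    & exists n : V -> R,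
      [/\ ultrametric_norm n, norm_defines_topology t n,
          forall x y, Es x -> Eu y -> n (x + y) = Num.max (n x) (n y),
          (operator_norm n Es alpha < a%:E)%E
        & exists beta : V -> V,
          [/\ forall x, Eu x -> Eu (beta x),
              forall x, Eu x -> beta (alpha x) = x,
              forall x, Eu x -> alpha (beta x) = x
            & (a%:E < (operator_norm n Eu beta)^-1)%E]]].

Definition hyperbolic t (a : R) (alpha : V -> V) : Prop :=
  [/\ linear alpha, continuous (alpha : tspace t -> tspace t)
    & exists Es Eu, hyperbolic_splitting t a alpha Es Eu].

(* Es is uniquely determined by t, a and alpha. *)
Definition stable_subspace t (a : R) (alpha : V -> V) : set V :=
  xget set0 [set Es | exists Eu, hyperbolic_splitting t a alpha Es Eu].

End hyperbolicity.

(* dom is the domain; fwd and bwd are mutually inverse between dom and its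
   image, and their values elsewhere are irrelevant. *)
Record chart (X E : Type) : Type := Chart {
  dom : set X ;
  fwd : X -> E ;
  bwd : E -> X
}.

Definition cod (X E : Type) (c : chart X E) : set E := fwd c @` dom c.

Definition is_homeo_chart (X E : topologicalType) (c : chart X E) : Prop :=
  [/\ open (dom c), open (cod c),
      forall x, dom c x -> bwd c (fwd c x) = x,
      {within dom c, continuous (fwd c)}
    & {within cod c, continuous (bwd c)}].

Definition transition_analytic (R : realType) (K : ultraFieldType R)
    (E : ultraBanachType K) (X : Type) (c d : chart X E) : Prop :=
  analytic_on (fwd c @` (dom c `&` dom d)) (fwd d \o bwd c).

Definition compatible (R : realType) (K : ultraFieldType R)
    (E : ultraBanachType K) (X : Type) (c d : chart X E) : Prop :=
  transition_analytic c d /\ transition_analytic d c.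

(* Analytic manifold structures modelled on E on the set X. *)
Record manifold (R : realType) (K : ultraFieldType R) (E : ultraBanachType K)
    (X : Type) : Type := Manifold {
  mtopology : topology_on X ;
  atlas : set (chart X E) ;
  manifold_hausdorff : hausdorff_space (tspace mtopology) ;
  atlas_homeo : forall c, atlas c ->
    is_homeo_chart (c : chart (tspace mtopology) E) ;
  atlas_cover : forall x, exists2 c, atlas c & dom c x ;
  atlas_compatible : forall c d, atlas c -> atlas d -> compatible c d ;
  atlas_maximal : forall c, is_homeo_chart (c : chart (tspace mtopology) E) ->
    (forall d, atlas d -> compatible c d) -> atlas c
}.

Definition mspace (R : realType) (K : ultraFieldType R) (E : ultraBanachType K)
    (X : Type) (M : manifold E X) : topologicalType := tspace (mtopology M).
Coercion mspace : manifold >-> topologicalType.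

Section tangent_space.
Context {R : realType} {K : ultraFieldType R} {E : ultraBanachType K}.
Context {X : Type} (M : manifold E X) (p : M).

Definition chart_at : Type := {c : chart X E | atlas M c /\ dom c p}.

(* A tangent vector at p is given by its representatives in all charts around p,
   related by the differentials of the transition maps. *)
Definition coherent : {pred chart_at -> E} := fun v =>
  `[< forall c d : chart_at,
        v d = differential (fwd (sval d) \o bwd (sval c)) (fwd (sval c) p)
                (v c) >].

Record tangent : Type := Tangent {
  tangent_val : chart_at -> E ;
  tangent_valP : tangent_val \in coherent
}.

HB.instance Definition _ := [isSub for tangent_val].
HB.instance Definition _ := [Choice of tangent by <:].

Lemma coherent_submod_closed : GRing.submod_closed coherent.
Proof.
split=> [|c v w].
  rewrite unfold_in; apply/asboolP => i j; rewrite !fctE.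
  have := linear_differential (fwd (sval j) \o bwd (sval i)) (fwd (sval i) p).
  by move=> /(_ (-1) 0 0); rewrite !scaler0 addr0 scaleN1r addNr.
rewrite !unfold_in => /asboolP vc /asboolP wc; apply/asboolP => i j.
by rewrite !fctE linear_differential -vc -wc.
Qed.

HB.instance Definition _ :=
  GRing.isSubmodClosed.Build K (chart_at -> E) coherent coherent_submod_closed.
HB.instance Definition _ := [SubChoice_isSubLmodule of tangent by <:].

(* The topology is that of E transported by any chart around p. *)
HB.instance Definition _ := Topological.copy tangent
  (initial_topology (tangent_val : tangent -> {ptws chart_at -> E})).

End tangent_space.

Section manifold_maps.
Context {R : realType} {K : ultraFieldType R} {E F : ultraBanachType K}.
Context {X Y : Type} (M : manifold E X) (N : manifold F Y).

Definition analytic_map (f : M -> N) : Prop :=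
  continuous f /\
  forall c d, atlas M c -> atlas N d ->
    analytic_on (fwd c @` (dom c `&` f @^-1` dom d)) (fwd d \o f \o bwd c).

(* T_p(f), for f analytic and q = f p (xget then picks the unique such w); having q as an argument makes T_p(f) an endomorphism
   of T_p(M) when p is a fixed point. *)
Definition tangent_map (f : M -> N) (p : M) (q : N) (v : tangent p) : tangent q :=
  xget 0 [set w : tangent q | forall (c : chart_at p) (d : chart_at q),
    tangent_val w d =
      differential (fwd (sval d) \o f \o bwd (sval c)) (fwd (sval c) p)
        (tangent_val v c)].

End manifold_maps.

Arguments tangent_map {R K E F X Y M N} f p q v.

Definition immersion (R : realType) (K : ultraFieldType R)
    (E F : ultraBanachType K) (X Y : Type) (M : manifold E X) (N : manifold F Y)
    (f : M -> N) : Prop :=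
  analytic_map f /\ forall x : M,
    injective (tangent_map f x (f x)) /\
    complemented (topology_of (tangent (f x))) (range (tangent_map f x (f x))).

Definition analytic_diffeo (R : realType) (K : ultraFieldType R)
    (E F : ultraBanachType K) (X Y : Type) (M : manifold E X) (N : manifold F Y)
    (f : M -> N) : Prop :=
  analytic_map f /\
  exists g : N -> M, [/\ analytic_map g, cancel f g & cancel g f].

Definition is_submanifold (R : realType) (K : ultraFieldType R)
    (E : ultraBanachType K) (X : Type) (M : manifold E X) (S : set M) : Prop :=
  exists2 F : set E, complemented (topology_of E) F &
    forall x, S x -> exists c,
      [/\ atlas M c, dom c x & fwd c @` (S `&` dom c) = F `&` cod c].

Section subset_manifolds.
Context {R : realType} {K : ultraFieldType R} {E F : ultraBanachType K}.
Context {X : Type} (M : manifold E X) (W : set X) (N : manifold F W).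

Definition inclusion : N -> M := fun x : W => val x.

Definition immersed_submanifold : Prop := immersion inclusion.

(* T_p(N), identified with a subspace of T_p(M). *)
Definition tangent_subspace (p : M) : set (tangent p) :=
  [set v | exists2 x : N, inclusion x = p &
    exists w : tangent x, tangent_map inclusion x p w = v].

Definition restricts_to_diffeo (f : M -> M) : Prop :=
  exists2 g : N -> N, analytic_diffeo g &
    forall x, inclusion (g x) = f (inclusion x).

End subset_manifolds.

Arguments inclusion {R K E F X M W N} x.
Arguments immersed_submanifold {R K E F X} M {W} N.
Arguments tangent_subspace {R K E F X M W} N p.
Arguments restricts_to_diffeo {R K E F X M W} N f.

Definition stable_set (R : realType) (K : ultraFieldType R)
    (E : ultraBanachType K) (X : Type) (M : manifold E X) (a : R)
    (f : M -> M) (p : M) : set X :=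
  [set x : X | (fun k => iter k f x : M) @ \oo --> p /\
    exists c : chart X E, exists n : E -> R,
      [/\ atlas M c, dom c p /\ fwd c p = 0,
          ultrametric_norm n, norm_defines_topology (topology_of E) n
        & (fun k => a ^- k * n (fwd c (iter k f x))) @ \oo --> (0 : R)]].

(* N is a manifold structure on W satisfying the three defining conditions of an
   a-stable manifold of f at p. *)
Definition is_stable_manifold (R : realType) (K : ultraFieldType R)
    (E F : ultraBanachType K) (X : Type) (M : manifold E X) (a : R)
    (f : M -> M) (p : M) (W : set X) (N : manifold F W) : Prop :=
  [/\ immersed_submanifold M N,
      tangent_subspace N p =
        stable_subspace (topology_of (tangent p)) a (tangent_map f p p)
    & restricts_to_diffeo N f].

(* Two structures on the same set coincide, whatever their modelling spaces:
   the identity is an analytic diffeomorphism. *)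
Definition same_structure (R : realType) (K : ultraFieldType R)
    (E F : ultraBanachType K) (X : Type) (M : manifold E X) (N : manifold F X)
    : Prop :=
  analytic_diffeo ((fun x : X => x) : M -> N).

(* Main.v *)
(* Near p, f is an analytic perturbation of its linear part A = T_p(f). Its local
   a-stable manifold is the graph of the fixed point phi of the graph transform,
   a contraction of a closed ball of the Banach space of strictly convergent
   power series, so phi is analytic. A chart kappa in which the graph is flat
   turns the local stable manifold into a ball of the stable subspace; there
   f contracts the stable component by a1 < a, and the unstable component grows
   at least by the factor 1/b > a along orbits. Hence an orbit with
   a^-n |f^n(x)| -> 0 is eventually in the local stable manifold, and W is the
   increasing union of its preimages under f^n. These carry the charts
   kappa o f^n, which glue to the manifold structure on W.

   For uniqueness, let N' be another structure. Since T_p(N') is the stable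
   subspace, points of N' near p (in N') have unstable components dominated by
   their stable ones, so their orbits are contracted by a1 and they lie in the
   local stable manifold. The projection to the stable subspace is then a chart
   of both structures at p by the inverse function theorem, and the restrictions
   of f spread the local diffeomorphism over all of W. *)

Require Import Defs.
From HB Require Import structures.
From mathcomp Require Import all_boot all_order all_algebra.
From mathcomp Require Import all_classical all_reals all_analysis.
From mathcomp Require Import ring lra.

Set Implicit Arguments.
Unset Strict Implicit.
Unset Printing Implicit Defensive.

Import Order.TTheory GRing.Theory Num.Theory.
Import numFieldNormedType.Exports.

Local Open Scope classical_set_scope.
Local Open Scope ring_scope.

(** Power series are never made into a Banach space: [ps r C g] carries an explicit bound [C], so
    completeness and contraction become statements about bounds, and infima of norms occur only at
    the border with [analytic_on]. The ultrametric inequality makes bounds lossless: sums keep the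
    maximum, the bound of an inner map may equal the radius of the outer one, and re-expansion about
    another point of the ball keeps the radius. A map vanishing at 0 gains a factor s/r when its
    ball shrinks from r to s, a remainder of order two gains (s/r)^2; radii are chosen so that such
    a factor beats a given constant. Since a1 < a and b < 1/a, the product a1 b < 1 is the
    contraction rate of the graph transform, and a <= 1 keeps local stable orbits in their ball. The
    norm of [E] need not be adapted to the splitting, so estimates are made in a copy [V] of T_p(M)
    with the adapted norm, linked to [E] by mutually inverse bounded maps [Th] and [Th']. For
    uniqueness only a bounded linear bijection between modelling spaces is at hand; Baire's theorem
    makes its inverse bounded. *)

Section abelian_group_identities.

Inductive gexpr := GVar of nat | GZero | GAdd of gexpr & gexpr | GOpp of gexpr.

Fixpoint gcoef (e : gexpr) (n : nat) : int :=
  match e with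
  | GVar m => if m == n then 1 else 0
  | GZero => 0
  | GAdd a b => gcoef a n + gcoef b n
  | GOpp a => - gcoef a n
  end.

Fixpoint gval (V : zmodType) (env : seq V) (e : gexpr) : V :=
  match e with
  | GVar m => nth 0 env m
  | GZero => 0
  | GAdd a b => gval env a + gval env b
  | GOpp a => - gval env a
  end.

Lemma gvalE (V : zmodType) (env : seq V) e :
  gval env e = \sum_(i < size env) nth 0 env i *~ gcoef e i.
Proof.
elim: e => [m||a IHa b IHb|a IHa] /=.
- have [ms|ms] := ltnP m (size env).
    rewrite (bigD1 (Ordinal ms))//= eqxx mulr1z big1 ?addr0// => i im.
    rewrite ifN ?mulr0z//; apply: contra im => /eqP mi.
    by apply/eqP/val_inj.
  rewrite nth_default// big1// => i _.
  by rewrite gtn_eqF ?mulr0z// (leq_trans (ltn_ord i)).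
- by rewrite big1// => i _; rewrite mulr0z.
- by rewrite IHa IHb -big_split/=; apply: eq_bigr => i _; rewrite mulrzDr.
- by rewrite IHa -sumrN; apply: eq_bigr => i _; rewrite mulrNz.
Qed.

(** Reflection principle behind [abel]: on closed expressions the hypothesis computes to [true], so
    an identity in an abelian group costs one conversion check. *)
Lemma gval_eq (V : zmodType) (env : seq V) e1 e2 :
  all (fun i => gcoef e1 i == gcoef e2 i) (iota 0 (size env)) ->
  gval env e1 = gval env e2.
Proof.
move=> /allP h; rewrite !gvalE; apply: eq_bigr => i _.
have /h/eqP -> : (i : nat) \in iota 0 (size env) by rewrite mem_iota/= add0n ltn_ord.
by [].
Qed.

End abelian_group_identities.

Ltac abel_insert l x :=
  lazymatch l with
  | nil => constr:(cons x nil)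
  | cons x _ => l
  | cons ?y ?l' => let l'' := abel_insert l' x in constr:(cons y l'')
  end.

Ltac abel_env l e :=
  lazymatch e with
  | (?a + ?b)%R => let l1 := abel_env l a in abel_env l1 b
  | (- ?a)%R => abel_env l a
  | 0%R => l
  | _ => abel_insert l e
  end.

Ltac abel_index l x :=
  lazymatch l with
  | cons x _ => constr:(0%N)
  | cons _ ?l' => let n := abel_index l' x in constr:(S n)
  end.

Ltac abel_quote l e :=
  lazymatch e with
  | (?a + ?b)%R => let a' := abel_quote l a in
                   let b' := abel_quote l b in constr:(GAdd a' b')
  | (- ?a)%R => let a' := abel_quote l a in constr:(GOpp a')
  | 0%R => constr:(GZero)
  | _ => let n := abel_index l e in constr:(GVar n)
  end.

(* Unlike [ring], applies to vectors; compares integer coefficients of atoms. *)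
Ltac abel :=
  lazymatch goal with
  | |- @eq ?V ?x ?y =>
    let l0 := abel_env (@nil V) x in let l := abel_env l0 y in
    let e1 := abel_quote l x in let e2 := abel_quote l y in
    exact: (@gval_eq _ l e1 e2 isT)
  end.

(** * Null sequences, ultrametric norms and sums *)

Section null_sequences.
Context {R : realType}.
Implicit Types (c d : nat -> R).

(** One-sided, since it is meant for nonnegative norms and bounds: comparison then needs only an
    upper estimate. *)
Definition null c : Prop :=
  forall e, 0 < e -> exists N, forall k, (N <= k)%N -> c k < e.

Lemma null_le c d : (forall k, d k <= c k) -> null c -> null d.
Proof.
by move=> dc nc e /nc[N hN]; exists N => k /hN; apply: le_lt_trans (dc k).
Qed.

Lemma nullM M c : (forall k, 0 <= c k) -> null c -> null (fun k => M * c k).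
Proof.
move=> c0 nc e e0.
have M1 : 0 < `|M| + 1 by rewrite ltr_wpDl.
have [N hN] := nc _ (divr_gt0 e0 M1); exists N => k /hN.
rewrite ltr_pdivlMr// mulrC; apply: le_lt_trans.
by rewrite ler_wpM2r// (le_trans (ler_norm M))// lerDl.
Qed.

Lemma null_cvg c : (forall k, 0 <= c k) -> null c <-> c @ \oo --> (0 : R).
Proof.
move=> c0; split=> [nc|].
  apply/cvgrPdist_lt => e /nc[N hN]; exists N => // k /= /hN.
  by rewrite sub0r normrN ger0_norm.
move=> /cvgrPdist_lt h e /h[N _ hN]; exists N => k /hN.
by rewrite sub0r normrN ger0_norm.
Qed.

Lemma null_geometric M t : 0 <= t < 1 -> null (fun k => M * t ^+ k).
Proof.
move=> /andP[t0 t1]; apply: nullM => [k|]; first exact: exprn_ge0.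
apply/null_cvg => [k|]; first exact: exprn_ge0.
by apply: cvg_expr; rewrite ger0_norm.
Qed.

Lemma nullD c d : null c -> null d -> null (fun k => c k + d k).
Proof.
move=> nc nd e e0; have e2 : 0 < e / 2 by rewrite divr_gt0.
have [N hN] := nc _ e2; have [N' hN'] := nd _ e2.
exists (maxn N N') => k; rewrite geq_max => /andP[/hN A /hN' B].
by rewrite [e]splitr ltrD.
Qed.

Lemma null_bounded c : null c -> exists C, forall k, c k <= C.
Proof.
move=> /(_ 1 ltr01)[N hN].
exists (\big[Num.max/1]_(i < N) c i) => k.
have [kN|/hN/ltW] := ltnP k N.
  exact: (le_bigmax_cond _ (fun i : 'I_N => c i) (isT : xpredT (Ordinal kN))).
by move=> /le_trans; apply; apply: bigmax_ge_id.
Qed.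

End null_sequences.

Section absolute_value.
Context {R : realType} {K : ultraFieldType R}.
Implicit Types (x y : K).

Lemma absv1 : absv (1 : K) = 1.
Proof.
have a0 : absv (1 : K) != 0 by apply/eqP => /absv_eq0/eqP; rewrite oner_eq0.
by apply: (mulfI a0); rewrite -absvM !mulr1.
Qed.

Lemma absvN1 : absv (-1 : K) = 1.
Proof.
have : absv (-1 : K) ^+ 2 = 1 by rewrite expr2 -absvM mulrNN mulr1 absv1.
by move=> /eqP; rewrite sqrp_eq1 ?absv_ge0// => /eqP.
Qed.

Lemma absv_gt0 x : x != 0 -> 0 < absv x.
Proof.
move=> x0; rewrite lt0r absv_ge0 andbT; apply: contra x0 => /eqP.
by move/absv_eq0 => ->.
Qed.

Lemma absvV x : x != 0 -> absv x^-1 = (absv x)^-1.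
Proof.
move=> x0; have a0 := lt0r_neq0 (absv_gt0 x0).
by apply: (mulfI a0); rewrite -absvM divff ?absv1 ?divff.
Qed.

Lemma absvX x k : absv (x ^+ k) = absv x ^+ k.
Proof. by elim: k => [|k IH]; rewrite ?expr0 ?absv1// !exprS absvM IH. Qed.

(* Dividing by powers of a fixed element of absolute value in (0,1) brings any
   positive real into [e rho, e). *)
Lemma absv_scale : exists2 rho : R, 0 < rho < 1 &
  forall e t : R, 0 < e -> 0 < t ->
    exists c : K, [/\ c != 0, e * rho <= absv c * t & absv c * t < e].
Proof.
have [w /eqP w0 w1] := @absv_nondiscrete R K 1 ltr01.
have aw0 := absv_gt0 w0.
exists (absv w); first by rewrite aw0.
move=> e t e0 t0.
have small (s : R) : 0 < s -> exists m, absv w ^+ m * s < e.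
  move=> s0; have := @null_geometric R s (absv w).
  rewrite ltW// w1 => /(_ isT e e0)[N hN]; exists N.
  by rewrite mulrC; exact: hN.
(* The bound says [absv w ^- M * t > e]: after this enlargement the minimal exponent below is
   positive, and its predecessor still gives at least [e], whence the lower bound with
   [rho = absv w]. *)
have [M hM] : exists M, absv w ^+ M * (e * e / t) < e.
  by apply: small; rewrite divr_gt0// mulr_gt0.
have ww0 k : 0 < absv w ^+ k by rewrite exprn_gt0.
pose t' := absv w ^- M * t.
have et' : e < t'.
  rewrite /t' mulrC ltr_pdivlMr//; move: hM.
  by rewrite mulrA ltr_pdivrMr// mulrCA ltr_pM2l// mulrC.
have t'0 : 0 < t' by rewrite (lt_trans e0).
have [m hm mmin] := ex_minnP (small _ t'0).
case: m hm mmin => [|m] hm mmin.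
  by move: hm; rewrite expr0 mul1r ltNge (ltW et').
exists (w ^+ m.+1 / w ^+ M).
have wM0 : w ^+ M != 0 by rewrite expf_neq0.
have hc : absv (w ^+ m.+1 / w ^+ M) * t = absv w ^+ m.+1 * t'.
  by rewrite absvM absvV// !absvX /t' mulrA.
rewrite hc; split => //.
- by rewrite mulf_neq0 ?invr_eq0// expf_neq0.
- rewrite exprS -mulrA mulrC ler_pM2l// leNgt; apply/negP => /mmin.
  by rewrite ltnn.
Qed.

End absolute_value.

Section ultrametric_norms.
Context {R : realType} {K : ultraFieldType R} {V : lmodType K}.
Context {n : V -> R} (hn : ultrametric_norm n).

Lemma un0 : n 0 = 0. Proof. exact/(un_eq0 hn). Qed.

Lemma unN x : n (- x) = n x.
Proof. by rewrite -scaleN1r (unZ hn) absvN1 mul1r. Qed.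

Lemma unBC x y : n (x - y) = n (y - x).
Proof. by rewrite -unN opprB. Qed.

Lemma un_gt0 x : x != 0 -> 0 < n x.
Proof.
move=> x0; rewrite lt0r (un_ge0 hn) andbT; apply: contra x0 => /eqP.
by move/(un_eq0 hn) => ->.
Qed.

Lemma unD_le x y C : n x <= C -> n y <= C -> n (x + y) <= C.
Proof. by move=> ? ?; rewrite (le_trans (unD hn _ _))// ge_max; apply/andP. Qed.

Lemma unB_le x y C : n x <= C -> n y <= C -> n (x - y) <= C.
Proof. by move=> ? ?; apply: unD_le => //; rewrite unN. Qed.

Lemma unD_lt x y C : n x < C -> n y < C -> n (x + y) < C.
Proof. by move=> ? ?; rewrite (le_lt_trans (unD hn _ _))// gt_max; apply/andP. Qed.

Lemma unB_lt x y C : n x < C -> n y < C -> n (x - y) < C.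
Proof. by move=> ? ?; apply: unD_lt => //; rewrite unN. Qed.

Lemma un_sum_le (I : Type) (s : seq I) (P : pred I) (u : I -> V) (C : R) :
  0 <= C -> (forall i, P i -> n (u i) <= C) -> n (\sum_(i <- s | P i) u i) <= C.
Proof.
move=> C0 h; elim/big_ind: _ => //; first by rewrite un0.
by move=> x y; apply: unD_le.
Qed.

(** The isosceles principle. It later turns an estimate for a perturbation into an equality of
    norms. *)
Lemma un_near x y : n (x - y) < n y -> n x = n y.
Proof.
move=> h; apply/le_anti/andP; split.
  by rewrite -[x](subrK y); apply: unD_le => //; apply: ltW.
rewrite leNgt; apply/negP => xy.
suff : n (x - (x - y)) < n y by rewrite subKr ltxx.
exact: unB_lt.
Qed.

Lemma un_small0 x : (forall e, 0 < e -> n x <= e) -> x = 0.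
Proof.
move=> h; apply/(un_eq0 hn)/le_anti; rewrite (un_ge0 hn) andbT.
by apply/ler_addgt0Pr => e e0; rewrite add0r; apply: h.
Qed.

End ultrametric_norms.

Section sums.
Context {R : realType} {K : ultraFieldType R} {E : ultraBanachType K}.
Implicit Types (u v : nat -> E) (s t : E).

Local Notation uE := (@unorm_ultrametric R K E).

Definition usum u s : Prop := forall e : R, 0 < e ->
  exists N, forall n, (N <= n)%N -> unorm (\sum_(k < n) u k - s) < e.

Lemma usum_unique u s t : usum u s -> usum u t -> s = t.
Proof.
move=> us ut; apply/subr0_eq/(un_small0 uE) => e e0; apply/ltW.
have [N hN] := us e e0; have [N' hN'] := ut e e0.
pose m := maxn N N'.
rewrite (_ : s - t = (\sum_(k < m) u k - t) - (\sum_(k < m) u k - s)).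
  by apply: (unB_lt uE); [apply: hN'; apply: leq_maxr|apply: hN; apply: leq_maxl].
by rewrite opprB [RHS]addrC addrA subrK.
Qed.

(** The difference of two partial sums is bounded by the largest term between them, so terms tending
    to 0 already make the partial sums Cauchy. *)
Lemma usum_ex u : null (fun k => unorm (u k)) -> exists s, usum u s.
Proof.
move=> nu; suff: exists l : E, forall e : R, 0 < e -> exists N, forall i,
    (N <= i)%N -> unorm (\sum_(k < i) u k - l) < e by [].
apply: (@unorm_complete R K E) => e e0; have [N hN] := nu e e0.
suff H i j : (N <= i)%N -> (i <= j)%N ->
    unorm (\sum_(k < j) u k - \sum_(k < i) u k) < e.
  exists N => i j Ni Nj; have [ij|/ltnW ji] := leqP i j; last exact: H.
  by rewrite (unBC uE); apply: H.
move=> Ni; elim: j => [|j IH]; first by rewrite leqn0 => /eqP ->; rewrite subrr (un0 uE).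
rewrite leq_eqVlt => /predU1P[->|]; first by rewrite subrr (un0 uE).
rewrite ltnS => ij; rewrite big_ord_recr/= addrAC; apply: (unD_lt uE); first exact: IH.
by apply: hN; apply: leq_trans ij.
Qed.

Definition Usum u : E := xget 0 [set s | usum u s].

Lemma UsumP u : null (fun k => unorm (u k)) -> usum u (Usum u).
Proof. by move=> /usum_ex[s us]; rewrite /Usum; apply: (@xgetI _ _ _ s). Qed.

Lemma usum_le u s C : 0 <= C -> (forall k, unorm (u k) <= C) -> usum u s ->
  unorm s <= C.
Proof.
move=> C0 uC us; apply/ler_addgt0Pr => e e0.
have [N /(_ N (leqnn N)) hN] := us e e0.
rewrite -[s](subrK (\sum_(k < N) u k)).
apply: (unD_le uE); first by rewrite (unBC uE) (le_trans (ltW hN))// lerDr.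
apply: (@le_trans _ _ C); last by rewrite lerDl ltW.
exact: (un_sum_le uE).
Qed.

Lemma usumD u v s t : usum u s -> usum v t -> usum (fun k => u k + v k) (s + t).
Proof.
move=> us vt e e0; have [N hN] := us e e0; have [N' hN'] := vt e e0.
exists (maxn N N') => m; rewrite geq_max => /andP[/hN A /hN' B].
by rewrite big_split/= opprD addrACA; apply: (unD_lt uE).
Qed.

(** Outside a finite square all terms are small, so both iterated sums agree up to [e] with the same
    finite double sum, in which the order is irrelevant. *)
Lemma usum_swap (w : nat -> nat -> E) u v s :
  (forall j, usum (w j) (u j)) -> (forall k, usum (w ^~ k) (v k)) ->
  (forall e : R, 0 < e -> exists N, forall j k, (N <= j)%N || (N <= k)%N ->
    unorm (w j k) <= e) ->
  usum u s -> usum v s.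
Proof.
move=> hu hv hw us e e0.
have e20 : 0 < e / 2 by rewrite divr_gt0.
have [N hN] := hw _ e20; have [N' hN'] := us e e0.
have e2e : e / 2 < e by rewrite ltr_pdivrMr// ltr_pMr// ltr1n.
(* A remainder is the sum of the series with its first [m] terms set to 0, so [usum_le] bounds it by
   its terms. That bound is not strict, whence [e / 2]. *)
have tail (x : nat -> E) y m : usum x y ->
    (forall k, (m <= k)%N -> unorm (x k) <= e / 2) ->
    unorm (y - \sum_(k < m) x k) <= e / 2.
  move=> xy xm; apply: (@usum_le (fun k => if (k < m)%N then 0 else x k)).
  - exact: ltW.
  - by move=> k; case: ltnP => [_|/xm//]; rewrite (un0 uE) ltW.
  - move=> d d0; have [L hL] := xy d d0; exists (maxn L m) => i.
    rewrite geq_max => /andP[Li mi].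
    rewrite opprB addrA [X in X - y](_ : _ = \sum_(k < i) x k); last first.
      rewrite -(subnKC mi) !big_split_ord/= addrAC.
      rewrite [X in X + _ + _]big1 => [|k _]; last by rewrite ltn_ord.
      rewrite add0r; congr (_ + _); apply: eq_bigr => k _.
      by rewrite ltnNge leq_addr.
    exact: hL.
exists N => n Nn.
pose m := maxn N N'.
have A : unorm (\sum_(k < n) v k - \sum_(k < n) \sum_(j < m) w j k) < e.
  rewrite -sumrB (le_lt_trans _ e2e)//; apply: (un_sum_le uE) => [|k _].
    exact: ltW.
  apply: (tail (w^~ k)) => // j mj; apply: hN; apply/orP; left.
  by apply: leq_trans mj; apply: leq_maxl.
have B : unorm (\sum_(j < m) u j - \sum_(j < m) \sum_(k < n) w j k) < e.
  rewrite -sumrB (le_lt_trans _ e2e)//; apply: (un_sum_le uE) => [|j _].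
    exact: ltW.
  apply: (tail (w j)) => // k nk; apply: hN; apply/orP; right.
  exact: leq_trans nk.
have C : unorm (\sum_(j < m) u j - s) < e by apply: hN'; apply: leq_maxr.
rewrite exchange_big/= in A.
rewrite -[X in unorm (X - s)](subrK (\sum_(j < m) \sum_(k < n) w j k)) -addrA.
apply: (unD_lt uE) => //.
rewrite -[X in unorm (X - s)](subrK (\sum_(j < m) u j)) -addrA.
by apply: (unD_lt uE) => //; rewrite (unBC uE).
Qed.

Lemma usum_fin u m : (forall k, (m <= k)%N -> u k = 0) ->
  usum u (\sum_(k < m) u k).
Proof.
move=> um e e0; exists m => n mn.
rewrite -(subnKC mn) big_split_ord/= addrAC subrr add0r.
by rewrite big1 ?(un0 uE)// => k _; apply: um; apply: leq_addr.
Qed.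

End sums.

Section linear_sums.
Context {R : realType} {K : ultraFieldType R} {E F : ultraBanachType K}.

Definition bounded_linear (L : E -> F) : Prop :=
  linear L /\ exists2 C : R, 0 <= C & forall x, unorm (L x) <= C * unorm x.

Lemma linear_fun0 (V W : lmodType K) (L : V -> W) : linear L -> L 0 = 0.
Proof.
by move=> h; have := h (-1) 0 0; rewrite !scaler0 addr0 scaleN1r addNr.
Qed.

Lemma linear_funD (V W : lmodType K) (L : V -> W) : linear L ->
  forall x y, L (x + y) = L x + L y.
Proof. by move=> h x y; have := h 1 x y; rewrite !scale1r. Qed.

Lemma linear_funZ (V W : lmodType K) (L : V -> W) : linear L ->
  forall c x, L (c *: x) = c *: L x.
Proof. by move=> h c x; have := h c x 0; rewrite (linear_fun0 h) !addr0. Qed.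

Lemma linear_funB (V W : lmodType K) (L : V -> W) : linear L ->
  forall x y, L (x - y) = L x - L y.
Proof.
by move=> h x y; rewrite (linear_funD h) -scaleN1r (linear_funZ h) scaleN1r.
Qed.

Lemma linear_funN (V W : lmodType K) (L : V -> W) : linear L ->
  forall x, L (- x) = - L x.
Proof. by move=> h x; rewrite -scaleN1r (linear_funZ h) scaleN1r. Qed.

Lemma linear_fun_sum (V W : lmodType K) (L : V -> W) : linear L ->
  forall n (u : nat -> V), L (\sum_(k < n) u k) = \sum_(k < n) L (u k).
Proof.
move=> h n u; elim: n => [|n IH]; first by rewrite !big_ord0 (linear_fun0 h).
by rewrite !big_ord_recr/= (linear_funD h) IH.
Qed.

Lemma usum_linear (L : E -> F) (u : nat -> E) (s : E) :
  bounded_linear L -> usum u s -> usum (fun k => L (u k)) (L s).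
Proof.
move=> [hL [C C0 LC]] us e e0.
have C1 : 0 < C + 1 by rewrite ltr_wpDl.
have [N hN] := us _ (divr_gt0 e0 C1); exists N => n /hN.
rewrite ltr_pdivlMr// mulrC; apply: le_lt_trans.
rewrite -(linear_fun_sum hL) -(linear_funB hL) (le_trans (LC _))//.
by rewrite ler_wpM2r ?(un_ge0 unorm_ultrametric)// lerDl.
Qed.

End linear_sums.

(** * Strictly convergent power series *)

Definition upd (J : eqType) (T : Type) (x : J -> T) (i : J) (y : T) : J -> T :=
  fun j => if j == i then y else x j.

Lemma upd_id (J : eqType) (T : Type) (x : J -> T) i : upd x i (x i) = x.
Proof. by apply/funext => j; rewrite /upd; case: eqP => // ->. Qed.

Lemma prod_upd (R : comNzRingType) (J : finType) (x : J -> R) i y :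
  \prod_j upd x i y j = y * \prod_(j | j != i) x j.
Proof.
rewrite (bigD1 i)//= {1}/upd eqxx; congr (_ * _).
by apply: eq_bigr => j /negPf ji; rewrite /upd ji.
Qed.

Section multilinear_maps.
Context {R : realType} {K : ultraFieldType R}.

Local Notation uE := (@unorm_ultrametric _ _ _).

(** The slots are indexed by any finite type because composition produces disjoint unions of index
    sets; [C] is some bound, not the least one, so that no infimum has to be attained. *)
Definition mlmap (E F : ultraBanachType K) (J : finType) (C : R)
    (b : (J -> E) -> F) : Prop :=
  [/\ forall i x, linear (fun y => b (upd x i y)), 0 <= C
    & forall x, unorm (b x) <= C * \prod_j unorm (x j)].

Lemma unorm_ge0 (E : ultraBanachType K) (x : E) : 0 <= unorm x.
Proof. exact: (un_ge0 uE). Qed.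

Hint Resolve unorm_ge0 : core.

Section one_map.
Context {E F : ultraBanachType K}.

Lemma mlmap_slot (J : finType) C (b : (J -> E) -> F) i x :
  mlmap C b -> bounded_linear (fun y => b (upd x i y)).
Proof.
move=> [lb C0 bC]; split; first exact: lb.
exists (C * \prod_(j | j != i) unorm (x j)).
  by rewrite mulr_ge0// prodr_ge0.
move=> y; apply: le_trans (bC _) _; rewrite -mulrA ler_wpM2l//.
rewrite (bigD1 i)//= {1}/upd eqxx mulrC ler_wpM2r//.
by apply: ler_prod => j /negPf ji; rewrite unorm_ge0 /upd ji/=.
Qed.

Lemma mlmap_bound (J : finType) C (b : (J -> E) -> F) x r :
  mlmap C b -> (forall j, unorm (x j) <= r) -> unorm (b x) <= C * r ^+ #|J|.
Proof.
move=> [_ C0 bC] xr; apply: le_trans (bC _) _; rewrite ler_wpM2l//.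
by rewrite -prodr_const; apply: ler_prod => j _; rewrite unorm_ge0 xr.
Qed.

Lemma mlmap_diag k C (b : ('I_k -> E) -> F) x r :
  mlmap C b -> unorm x <= r -> unorm (b (fun=> x)) <= C * r ^+ k.
Proof. by move=> h xr; have := mlmap_bound h (fun=> xr); rewrite card_ord. Qed.

Lemma mlmap_transport (J : finType) C (b : (J -> E) -> F) : mlmap C b ->
  mlmap C (fun x : 'I_#|J| -> E => b (fun j => x (enum_rank j))).
Proof.
move=> [lb C0 bC]; split => //.
  move=> i x; rewrite (_ : (fun _ => _) = fun y =>
    b (upd (x \o enum_rank) (enum_val i) y)); first exact: lb.
  apply/funext => y; congr b; apply/funext => j; rewrite /upd/=.
  by rewrite -(inj_eq enum_val_inj) enum_rankK.
move=> x; apply: le_trans (bC _) _.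
by rewrite [in leRHS](reindex enum_rank)//=; apply: onW_bij; apply: enum_rank_bij.
Qed.

(* The closed ball of radius C in the Banach space of functions that are sums of
   a strictly convergent power series on the closed ball of radius r. *)
Definition ps (r C : R) (g : E -> F) : Prop :=
  exists (b : forall k, ('I_k -> E) -> F) (c : nat -> R),
  [/\ forall k, mlmap (c k) (b k), forall k, c k * r ^+ k <= C,
      null (fun k => c k * r ^+ k)
    & forall y, unorm y <= r -> usum (fun k => b k (fun=> y)) (g y)].

Lemma ps_ge0 r C g : ps r C g -> 0 <= C.
Proof.
move=> [b [c [bc cC _ _]]]; have := cC 0%N; rewrite expr0 mulr1.
by apply: le_trans; have [] := bc 0%N.
Qed.

Lemma ps_ext r C g g' : (forall y, unorm y <= r -> g y = g' y) ->
  ps r C g -> ps r C g'.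
Proof.
move=> gg' [b [c [bc cC nc bg]]]; exists b, c; split => // y yr.
by rewrite -gg'//; apply: bg.
Qed.

Lemma ps_le r C C' g : C <= C' -> ps r C g -> ps r C' g.
Proof.
move=> CC' [b [c [bc cC nc bg]]]; exists b, c; split => // k.
exact: le_trans (cC k) CC'.
Qed.

Lemma ps_shrink r s C g : 0 <= s -> s <= r -> ps r C g -> ps s C g.
Proof.
move=> s0 sr [b [c [bc cC nc bg]]]; exists b, c.
have csr k : c k * s ^+ k <= c k * r ^+ k.
  by have [_ c0 _] := bc k; rewrite ler_wpM2l// lerXn2r// nnegrE (le_trans s0).
split => //.
- by move=> k; apply: le_trans (csr k) (cC k).
- exact: null_le nc.
- by move=> y ys; apply: bg; apply: le_trans sr.
Qed.

Lemma ps_bound r C g y : ps r C g -> unorm y <= r -> unorm (g y) <= C.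
Proof.
move=> pg yr; have [b [c [bc cC nc bg]]] := pg.
apply: (usum_le (ps_ge0 pg) _ (bg _ yr)) => k.
exact: le_trans (mlmap_diag (bc k) yr) (cC k).
Qed.

Lemma mlmap0 (J : finType) : mlmap 0 (fun _ : J -> E => 0 : F).
Proof.
split => //; first by move=> i x a y z; rewrite scaler0 addr0.
by move=> x; rewrite (un0 uE) mul0r.
Qed.

Lemma ps_mlmap k C (b : ('I_k -> E) -> F) r : 0 <= r -> mlmap C b ->
  ps r (C * r ^+ k) (fun y => b (fun=> y)).
Proof.
move=> r0 bC; have C0 : 0 <= C by have [] := bC.
(* The only nonzero term sits in degree [k]; the type of a term depends on its degree, so it is
   transported along the equality [k = j]. *)
pose b' j : ('I_j -> E) -> F := match @eqP _ k j with
  | ReflectT e => fun x => b (fun i => x (cast_ord e i))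
  | ReflectF _ => fun=> 0 end.
pose c' j : R := if j == k then C else 0.
have H j : mlmap (c' j) (b' j) /\ (j != k -> forall x, b' j x = 0).
  rewrite /b' /c'; case: eqP => [e|/eqP kj]; last first.
    by rewrite eq_sym (negPf kj); split; [exact: mlmap0|].
  subst j; rewrite eqxx; split => //.
  rewrite (_ : (fun _ => _) = b)//; apply/funext => x; congr b.
  by apply/funext => i; congr x; apply/val_inj.
have bk : b' k = b.
  rewrite /b'; case: eqP => // e; apply/funext => x; congr b.
  by apply/funext => i; congr x; apply/val_inj.
exists b', c'; split.
- by move=> j; have [] := H j.
- move=> j; rewrite /c'; case: eqP => [->//|_].
  by rewrite mul0r mulr_ge0// exprn_ge0.
- move=> e e0; exists k.+1 => j kj; rewrite /c' gtn_eqF// mul0r//.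
- move=> y _; have := @usum_fin _ _ _ (fun j => b' j (fun=> y)) k.+1.
  rewrite big_ord_recr/= bk big1 ?add0r.
    apply=> j kj; have [_] := H j; apply; rewrite gtn_eqF//.
  by move=> j _; have [_] := H j; apply; rewrite ltn_eqF.
Qed.

Lemma ps_mlmapJ (J : finType) C (b : (J -> E) -> F) r : 0 <= r -> mlmap C b ->
  ps r (C * r ^+ #|J|) (fun y => b (fun=> y)).
Proof. by move=> r0 /mlmap_transport /(ps_mlmap r0). Qed.

Lemma ps_cst r (v : F) : 0 <= r -> ps r (unorm v) (fun=> v).
Proof.
move=> r0; have := @ps_mlmap 0 (unorm v) (fun=> v) r r0.
rewrite expr0 mulr1; apply; split => //; first by case.
by move=> x; rewrite big_ord0 mulr1.
Qed.

Lemma ps_linear r (C : R) (L : E -> F) : 0 <= r -> 0 <= C -> linear L ->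
  (forall x, unorm (L x) <= C * unorm x) -> ps r (C * r) L.
Proof.
move=> r0 C0 lL LC; have := @ps_mlmap 1 C (fun x => L (x ord0)) r r0.
rewrite expr1; apply; split => //; last by move=> x; rewrite big_ord1.
by move=> i x a y z; rewrite /upd (ord1 i) eqxx lL.
Qed.

Lemma null_maxn (u : nat -> nat -> R) (m : nat) e : 0 < e ->
  (forall j, null (u j)) ->
  exists N, forall j k, (j < m)%N -> (N <= k)%N -> u j k < e.
Proof.
move=> e0 nu; have /boolp.choice[N hN] := fun j => nu j e e0.
exists (\max_(j < m) N j) => j k jm Nk; apply: hN; apply: leq_trans Nk.
exact: (leq_bigmax (Ordinal jm)).
Qed.

(** Coefficients are summed over [j] degree by degree, and exchanging this sum with the one over
    degrees recovers [g]. By the ultrametric inequality the bound in each degree is a supremum over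
    [j], not a sum. *)
Lemma ps_series r C (g_ : nat -> E -> F) (C_ : nat -> R) g : 0 < r ->
  (forall j, ps r (C_ j) (g_ j)) -> (forall j, C_ j <= C) -> null C_ ->
  (forall y, unorm y <= r -> usum (fun j => g_ j y) (g y)) -> ps r C g.
Proof.
move=> r0 /boolp.choice[b /boolp.choice[c H]] CC nC sg.
have rk0 k : 0 < r ^+ k by rewrite exprn_gt0.
have bm j k : mlmap (c j k) (b j k) by have [] := H j.
have c0 j k : 0 <= c j k by have [] := bm j k.
have cC j k : c j k * r ^+ k <= C_ j by have [] := H j.
have nc j : null (fun k => c j k * r ^+ k) by have [] := H j.
have C0 j : 0 <= C_ j by apply: le_trans (cC j 0%N); rewrite expr0 mulr1.
have nb k x : null (fun j => unorm (b j k x)).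
  apply: (null_le _ (nullM (\prod_i unorm (x i) / r ^+ k) C0 nC)) => j.
  have [_ _ /(_ x) h] := bm j k; apply: le_trans h _.
  rewrite mulrC -mulrA ler_wpM2l ?prodr_ge0//.
  by rewrite ler_pdivlMl// mulrC.
pose B k x := Usum (fun j => b j k x).
have BP k x : usum (fun j => b j k x) (B k x) by apply: UsumP.
pose D k := [set c j k | j in setT].
have Dub k : ubound (D k) (C / r ^+ k).
  by move=> _ [j _ <-]; rewrite ler_pdivlMr//; apply: le_trans (cC j k) (CC j).
have D0 k : D k !=set0 by exists (c 0%N k), 0%N.
pose d k := sup (D k).
have cd j k : c j k <= d k by apply: ub_le_sup; [exists (C / r ^+ k)|exists j].
have dle k t : (forall j, c j k * r ^+ k <= t) -> d k * r ^+ k <= t.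
  move=> h; rewrite -ler_pdivlMr//; apply: ge_sup => // _ [j _ <-].
  by rewrite ler_pdivlMr.
have d0 k : 0 <= d k by apply: le_trans (c0 0%N k) (cd 0%N k).
(* For large [j] smallness holds in all degrees through [C_ j]; the finitely many remaining [j]
   share a threshold for the degree. *)
have unif e : 0 < e -> exists N, forall j k, (N <= j)%N || (N <= k)%N ->
    c j k * r ^+ k <= e.
  move=> e0; have [J hJ] := nC e e0.
  have [N hN] := null_maxn J e0 nc.
  exists (maxn J N) => j k; rewrite !geq_max; have [Jj _|jJ /=] := leqP J j.
    exact: le_trans (cC j k) (ltW (hJ _ Jj)).
  by move=> /andP[_ Nk]; apply: ltW; apply: hN.
exists B, d; split.
- move=> k; split=> //.
    move=> i x a y z; apply: usum_unique (BP _ _) _.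
    have l j : b j k (upd x i (a *: y + z)) =
        a *: b j k (upd x i y) + b j k (upd x i z).
      by have [h _ _] := bm j k; apply: h.
    rewrite (funext l); apply: usumD (BP _ _).
    apply: (usum_linear (L := fun v => a *: v)) (BP _ _); split.
      by move=> t u v; rewrite scalerDr !scalerA mulrC.
    exists (absv a); first exact: absv_ge0.
    by move=> v; rewrite (unZ uE).
  move=> x; apply: (usum_le _ _ (BP k x)).
    by rewrite mulr_ge0// prodr_ge0.
  move=> j; have [_ _ /(_ x) h] := bm j k; apply: le_trans h _.
  by rewrite ler_wpM2r// prodr_ge0.
- by move=> k; apply: dle => j; apply: le_trans (cC j k) (CC j).
- move=> e e0; have [N hN] := unif _ (divr_gt0 e0 (ltr0n R 2)).
  exists N => k Nk; apply: (@le_lt_trans _ _ (e / 2)).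
    by apply: dle => j; apply: hN; rewrite Nk orbT.
  by rewrite ltr_pdivrMr// ltr_pMr// ltr1n.
- move=> y yr; apply: (usum_swap (w := fun j k => b j k (fun=> y))) (sg y yr) => //.
    by move=> j; have [_ _ _ h] := H j; apply: h.
  move=> e e0; have [N hN] := unif e e0; exists N => j k jk.
  exact: le_trans (mlmap_diag (bm j k) yr) (hN _ _ jk).
Qed.

Lemma ps_add r C g g' : 0 < r -> ps r C g -> ps r C g' ->
  ps r C (fun y => g y + g' y).
Proof.
move=> r0 pg pg'; have C0 := ps_ge0 pg.
apply: (@ps_series r C (fun j => nth (fun=> 0) [:: g; g'] j)
  (fun j => nth 0 [:: C; C] j)) => //.
- move=> [|[|j]] //=; rewrite nth_nil.
  by have := @ps_cst r 0 (ltW r0); rewrite (un0 uE); rewrite nth_nil.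
- by move=> [|[|j]] //=; rewrite nth_nil.
- by move=> e e0; exists 2%N => -[|[|j]]//= _; rewrite nth_nil.
- move=> y _; have := @usum_fin _ _ _
    (fun j => nth (fun=> 0) [:: g; g'] j y) 2.
  rewrite big_ord_recr big_ord1/=; apply.
  by move=> [|[|j]]//= _; rewrite nth_nil.
Qed.

End one_map.

Section composition.
Context {E G H : ultraBanachType K}.

(** A slot of the composite is a pair of an outer and an inner slot, hence the sigma type; the
    product over pairs is an iterated product, so the bounds multiply. *)
Lemma mlmap_comp (J : finType) (n : J -> nat) D (C : J -> R)
    (c : (J -> G) -> H) (b : forall i, ('I_(n i) -> E) -> G) :
  mlmap D c -> (forall i, mlmap (C i) (b i)) ->
  mlmap (D * \prod_i C i) (fun x : {i : J & 'I_(n i)} -> E =>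
    c (fun i => b i (fun j => x (Tagged (fun i => 'I_(n i)) j)))).
Proof.
move=> [lc D0 bc] bC.
have C0 i : 0 <= C i by have [] := bC i.
split; last 2 first.
- by rewrite mulr_ge0// prodr_ge0.
- move=> x; apply: le_trans (bc _) _; rewrite -mulrA ler_wpM2l//.
  have -> : \prod_(p : {i : J & 'I_(n i)}) unorm (x p) =
      \prod_i \prod_(j < n i) unorm (x (Tagged (fun i => 'I_(n i)) j)).
    rewrite (@sig_big_dep _ _ _ _ _ xpredT (fun=> xpredT) (fun i j =>
      unorm (x (Tagged (fun i => 'I_(n i)) j))))/=.
    by apply: eq_bigr => -[].
  rewrite -big_split/=; apply: ler_prod => i _; rewrite unorm_ge0/=.
  by have [_ _ h] := bC i.
move=> [i j] x a y z.
pose x' (i0 : J) (j0 : 'I_(n i0)) : E := x (Tagged (fun i => 'I_(n i)) j0).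
have eq w : (fun i0 => b i0 (fun j0 => upd x (Tagged (fun i => 'I_(n i)) j) w
      (Tagged (fun i => 'I_(n i)) j0))) =
    upd (fun i0 => b i0 (x' i0)) i (b i (upd (x' i) j w)).
  apply/funext => i'; rewrite /upd; case: eqP => [->|ii'].
    by congr (b i); apply/funext => j'; rewrite eq_Tagged.
  congr (b i'); apply/funext => j'.
  by case: eqP => // -[/ii'].
rewrite !eq; have [lb _ _] := bC i.
by rewrite (lb j) (lc i).
Qed.

(** Slots are expanded one after the other: the list [t] names those still filled with arbitrary
    series, the others hold homogeneous terms. Expanding a slot writes the map as a series over the
    terms of that slot; once all are expanded, [mlmap_comp] applies. *)
Lemma ps_mlmap_comp (J : finType) D (c : (J -> G) -> H) r (s : J -> R)
    (g : J -> E -> G) : 0 < r -> mlmap D c -> (forall i, ps r (s i) (g i)) ->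
  ps r (D * \prod_i s i) (fun y => c (fun i => g i y)).
Proof.
move=> r0 cD.
have [lc D0 bc] := cD.
suff : forall (t : seq J) (s : J -> R) (g : J -> E -> G),
    (forall i, ps r (s i) (g i)) ->
    (forall i, i \notin t -> exists (kb : {k & ('I_k -> E) -> G}) C,
      [/\ mlmap C (tagged kb), C * r ^+ tag kb <= s i
        & forall y, g i y = tagged kb (fun=> y)]) ->
    ps r (D * \prod_i s i) (fun y => c (fun i => g i y)).
  by move=> /(_ (enum J) s g) h pg; apply: h => // i; rewrite mem_enum.
elim=> [|i0 t IH] {}s {}g pg mono; last first.
  have [b [e [be es ne bg]]] := pg i0.
  have s0 i : 0 <= s i := ps_ge0 (pg i).
  have e0 k : 0 <= e k * r ^+ k.
    by have [_ h _] := be k; rewrite mulr_ge0// exprn_ge0// ltW.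
  pose P := D * \prod_(i | i != i0) s i.
  have P0 : 0 <= P by rewrite mulr_ge0// prodr_ge0.
  apply: (@ps_series _ _ _ _
    (fun k y => c (fun i => upd g i0 (fun y => b k (fun=> y)) i y))
    (fun k => P * (e k * r ^+ k))) => //.
  - move=> k; have -> : P * (e k * r ^+ k) = D * \prod_i upd s i0 (e k * r ^+ k) i.
      by rewrite prod_upd /P; ring.
    apply: IH => i; rewrite /upd; case: eqP => [_|/eqP ii0] //.
    + by apply: ps_mlmap => //; apply: ltW.
    + by exists (existT _ k (b k)), (e k); split.
    + by move=> it; apply: mono; rewrite inE negb_or ii0.
  - move=> k; rewrite [in leRHS](bigD1 i0)//= [leRHS]mulrCA [leRHS]mulrC; exact: (ler_wpM2l P0 (es k)).
  - exact: nullM.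
  - move=> y yr.
    have L := mlmap_slot i0 (fun i => g i y) cD.
    have := usum_linear L (bg y yr); rewrite upd_id.
    rewrite (_ : (fun k => c (upd _ _ _)) = (fun k => c (fun i =>
      upd g i0 (fun y => b k (fun=> y)) i y)))//.
    apply/funext => k; congr c; apply/funext => i; rewrite /upd.
    by case: eqP.
have /boolp.choice[kb /boolp.choice[C {}mono]] := fun i => mono i isT.
have mC i : mlmap (C i) (tagged (kb i)) by have [] := mono i.
have C0 i : 0 <= C i by have [] := mC i.
pose T := {i : J & 'I_(tag (kb i))}.
pose B (x : T -> E) :=
  c (fun i => tagged (kb i) (fun j => x (Tagged (fun i => 'I_(tag (kb i))) j))).
have BD : mlmap (D * \prod_i C i) B := mlmap_comp cD mC.
have := ps_mlmapJ (ltW r0) BD.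
have -> : r ^+ #|{: T}| = \prod_i r ^+ tag (kb i).
  rewrite -prodr_const.
  under [RHS]eq_bigr do rewrite -[tag _]card_ord -prodr_const.
  by rewrite (@sig_big_dep _ _ _ _ _ xpredT (fun=> xpredT) (fun=> fun=> r)).
rewrite -mulrA -big_split/= => h.
apply: (@ps_ext _ _ _ _ (fun y => B (fun=> y))).
  by move=> y _; rewrite /B; congr c; apply/funext => i; have [_ _ ->] := mono i.
apply: ps_le h; rewrite ler_wpM2l//; apply: ler_prod => i _.
by rewrite mulr_ge0 ?exprn_ge0 ?(ltW r0)//=; have [] := mono i.
Qed.

(** The bound of [g] may equal the radius of [h]: the term of degree k becomes a series of bound
    [c k * s ^+ k], and these bounds are null because [h] is a strictly convergent series. *)
Lemma ps_comp r s D (h : G -> H) (g : E -> G) : 0 < r ->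
  ps s D h -> ps r s g -> ps r D (h \o g).
Proof.
move=> r0 [b [c [bc cD nc bh]]] pg.
apply: (@ps_series _ _ _ _ (fun k y => b k (fun=> g y))
  (fun k => c k * s ^+ k)) => //.
- move=> k; have := ps_mlmap_comp r0 (bc k) (fun=> pg).
  by rewrite prodr_const card_ord.
- by move=> y yr; apply: bh; apply: ps_bound yr.
Qed.

(** [g] is replaced by [g'] slot by slot; each replacement has one factor [d] and one factor [s] for
    every other slot, which is [s ^+ #|J| * (d / s)], and adding the replacements takes only their
    maximum. *)
Lemma ps_mlmap_diff (J : finType) D (c : (J -> G) -> H) r s d
    (g g' : J -> E -> G) : 0 < r -> 0 < s -> mlmap D c ->
  (forall i, ps r s (g i)) -> (forall i, ps r s (g' i)) ->
  (forall i, ps r d (fun y => g i y - g' i y)) -> 0 <= d ->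
  ps r (D * s ^+ #|J| * (d / s)) (fun y => c (fun i => g i y) - c (fun i => g' i y)).
Proof.
move=> r0 s0 cD pg pg' pd d0; have [lc D0 bc] := cD.
pose z (t : seq J) (i : J) := if i \in t then g' i else g i.
have zp t i : ps r s (z t i) by rewrite /z; case: ifP.
suff h (t : seq J) : ps r (D * s ^+ #|J| * (d / s))
    (fun y => c (fun i => g i y) - c (fun i => z t i y)).
  apply: ps_ext (h (enum J)) => y _; congr (_ - c _).
  by apply/funext => i; rewrite /z mem_enum.
elim: t => [|i t IH].
  apply: (@ps_ext _ _ _ _ (fun=> 0)).
    by move=> y _; rewrite subrr.
  apply: ps_le (@ps_cst _ _ r 0 (ltW r0)); rewrite (un0 uE).
  by rewrite !mulr_ge0 ?exprn_ge0 ?invr_ge0 ?(ltW s0).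
apply: (@ps_ext _ _ _ _ (fun y => (c (fun j => g j y) - c (fun j => z t j y)) +
    (c (fun j => z t j y) - c (fun j => z (i :: t) j y)))).
  by move=> y _; rewrite addrA subrK.
apply: ps_add => //.
(* A slot replaced earlier contributes the difference 0, so repetitions in the list do no harm. *)
have hd : ps r (D * \prod_j upd (fun=> s) i d j)
    (fun y => c (fun j => upd (z t) i (fun y => z t i y - g' i y) j y)).
  apply: ps_mlmap_comp => // j; rewrite /upd; case: eqP => [_|//].
  rewrite /z; case: ifP => // _; apply: (@ps_ext _ _ _ _ (fun=> 0)).
    by move=> y _; rewrite subrr.
  by apply: ps_le (@ps_cst _ _ r 0 (ltW r0)); rewrite (un0 uE).
rewrite prod_upd in hd.
have -> : D * s ^+ #|J| * (d / s) = D * (d * \prod_(j | j != i) s).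
  rewrite -mulrA; congr (_ * _); rewrite -prodr_const (bigD1 i)//=.
  by field; rewrite gt_eqF.
apply: ps_ext hd => y _.
have eq v : (fun j => upd (z t) i (fun y => v) j y) =
    upd (fun j => z t j y) i v.
  by apply/funext => j; rewrite /upd; case: eqP.
have -> : (fun j => upd (z t) i (fun y0 => z t i y0 - g' i y0) j y) =
    upd (fun j => z t j y) i (z t i y - g' i y).
  by apply/funext => j; rewrite /upd; case: eqP.
rewrite (linear_funB (lc i (fun j => z t j y))).
rewrite (upd_id (fun j => z t j y)); congr (_ - c _).
by apply/funext => j; rewrite /upd /z inE; case: eqP => //= ->.
Qed.

(** Composition with [h] is Lipschitz with constant [D / s] on power series of bound [s]; both
    contraction arguments below rest on it. *)
Lemma ps_comp_diff r s D d (h : G -> H) (g g' : E -> G) : 0 < r -> 0 < s ->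
  ps s D h -> ps r s g -> ps r s g' -> ps r d (fun y => g y - g' y) ->
  ps r (D * (d / s)) (fun y => h (g y) - h (g' y)).
Proof.
move=> r0 s0 [b [c [bc cD nc bh]]] pg pg' pd; have d0 := ps_ge0 pd.
have ds0 : 0 <= d / s by rewrite divr_ge0// ltW.
apply: (@ps_series _ _ _ _ (fun k y => b k (fun=> g y) - b k (fun=> g' y))
  (fun k => c k * s ^+ k * (d / s))) => //.
- move=> k; have := ps_mlmap_diff r0 s0 (bc k) (fun=> pg) (fun=> pg') (fun=> pd) d0.
  by rewrite card_ord.
- by move=> k; rewrite ler_wpM2r.
- have c0 k : 0 <= c k * s ^+ k.
    by have [_ h0 _] := bc k; rewrite mulr_ge0// exprn_ge0// ltW.
  by apply: null_le (nullM (d / s) c0 nc) => k; rewrite mulrC.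
- move=> y yr; apply: usumD; first by apply: bh; apply: ps_bound yr.
  have -> : (fun k => - b k (fun=> g' y)) = (fun k => -1 *: b k (fun=> g' y)).
    by apply/funext => k; rewrite scaleN1r.
  rewrite -scaleN1r; apply: (usum_linear (L := fun v => -1 *: v)).
    split; first by move=> t u v; rewrite scalerDr !scalerA mulrC.
    by exists 1 => // v; rewrite scaleN1r (unN uE) mul1r.
  by apply: bh; apply: ps_bound yr.
Qed.

End composition.

End multilinear_maps.

#[export] Hint Extern 0 (is_true (_ <= unorm _)) => solve [exact: unorm_ge0] : core.

(** * Norm topology, bounded linear maps and differentials *)

Lemma ptws_cvg (I : Type) (T : topologicalType) (F : set_system (I -> T))
    (f : I -> T) : Filter F ->
  (forall i, (fun g => g i) @ F --> f i) -> F --> (f : {ptws I -> T}).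
Proof.
move=> FF h; apply/cvg_sup => i U [V [[W oW <-] Wf] WU].
by apply: (filterS WU); apply: h; apply: open_nbhs_nbhs.
Qed.

Lemma ptws_proj (I : Type) (T : topologicalType) (i : I) :
  continuous (fun g : {ptws I -> T} => g i).
Proof.
move=> f; have /cvg_sup/(_ i) h : nbhs (f : {ptws I -> T}) --> (f : {ptws I -> T}).
  exact: cvg_id.
move=> A /= /nbhs_interior; rewrite nbhsE => -[W [oW Wf] WA]; apply: h.
exists ((fun g : I -> T => g i) @^-1` W); split; [by exists W|by []|].
by move=> g /= /WA /interior_subset.
Qed.

Lemma le_mul_add1 (R : realDomainType) (c x : R) : 0 <= x -> c * x <= (c + 1) * x.
Proof. by move=> x0; rewrite mulrDl mul1r lerDl. Qed.

Section metric_topology.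
Context {R : realType} {K : ultraFieldType R}.
Local Notation uE := (@unorm_ultrametric _ _ _).

Lemma unorm_ball (E : ultraBanachType K) (x : E) e y :
  ball x e y = (unorm (y - x) < e) :> Prop.
Proof. by rewrite (unBC uE) ballEmdist. Qed.

Lemma nbhs_unorm (E : ultraBanachType K) (x : E) (A : set E) :
  nbhs x A <-> exists2 e : R, 0 < e & forall y, unorm (y - x) < e -> A y.
Proof.
split=> [/nbhs_ballP[e e0 h]|[e e0 h]].
  by exists e => // y yx; apply: h; rewrite unorm_ball.
by apply/nbhs_ballP; exists e => // y; rewrite unorm_ball; apply: h.
Qed.

Lemma near_unorm (E : ultraBanachType K) (x : E) e : 0 < e ->
  \forall y \near x, unorm (y - x) < e.
Proof. by move=> e0; apply/nbhs_unorm; exists e. Qed.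

Lemma open_unorm (E : ultraBanachType K) (A : set E) :
  open A <-> forall x, A x ->
    exists2 e : R, 0 < e & forall y, unorm (y - x) < e -> A y.
Proof.
rewrite openE; split=> [h x /h/nbhs_unorm//|h x /h ?].
exact/nbhs_unorm.
Qed.

Lemma open_closed_ball (E : ultraBanachType K) (r : R) : 0 < r ->
  open [set x : E | unorm x <= r].
Proof.
move=> r0; apply/open_unorm => x /= xr; exists r => // y yx.
by rewrite -[y](subrK x); apply: (unD_le uE) => //; apply: ltW.
Qed.

Lemma continuous_unorm (E F : ultraBanachType K) (f : E -> F) (x : E) :
  {for x, continuous f} <-> forall e : R, 0 < e ->
    exists2 d : R, 0 < d & forall y, unorm (y - x) < d -> unorm (f y - f x) < e.
Proof.
split=> [fx e /near_unorm/fx/nbhs_unorm//|h A /nbhs_unorm[e /h[d d0 fd] eA]].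
by apply/nbhs_unorm; exists d => // y /fd; apply: eA.
Qed.

(** The norm of a vector need not be the absolute value of a scalar, so vectors cannot be
    normalised; scaling them into the annulus between [e * rho] and [e] serves instead. *)
Lemma unorm_scale (E : ultraBanachType K) : exists2 rho : R, 0 < rho &
  forall (e : R) (x : E), 0 < e -> x != 0 ->
  exists c : K, [/\ c != 0, e * rho <= absv c * unorm x & unorm (c *: x) < e].
Proof.
have [rho /andP[rho0 _] h] := @absv_scale R K.
exists rho => // e x e0 x0; have [c [c0 c1 c2]] := h _ _ e0 (un_gt0 uE x0).
by exists c; rewrite (unZ uE).
Qed.

Lemma bounded_linear_cont (E F : ultraBanachType K) (L : E -> F) :
  bounded_linear L -> continuous L.
Proof.
move=> [lL [C C0 LC]] x; apply/continuous_unorm => e e0.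
have C1 : 0 < C + 1 by rewrite ltr_wpDl.
exists (e / (C + 1)); first exact: divr_gt0.
move=> y; rewrite ltr_pdivlMr// mulrC -(linear_funB lL); apply: le_lt_trans.
by apply: le_trans (LC _) _; apply: le_mul_add1.
Qed.

Lemma continuous_bounded_linear (E F : ultraBanachType K) (L : E -> F) :
  linear L -> {for 0, continuous L} -> bounded_linear L.
Proof.
move=> lL /continuous_unorm/(_ 1 ltr01)[d d0 Ld]; split => //.
have [rho rho0 h] := @unorm_scale E.
exists (d * rho)^-1; first by rewrite invr_ge0 mulr_ge0 ?ltW.
move=> x; have [->|x0] := eqVneq x 0.
  by rewrite (linear_fun0 lL) !(un0 uE) mulr0.
have [c [c0 c1 c2]] := h d x d0 x0.
have := Ld (c *: x); rewrite subr0 => /(_ c2).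
rewrite (linear_fun0 lL) subr0 (linear_funZ lL) (unZ uE) => c3.
rewrite mulrC ler_pdivlMr ?mulr_gt0// -(ler_pM2l (absv_gt0 c0)).
rewrite mulrA; apply: le_trans c1; rewrite -[leRHS]mul1r ler_wpM2r ?ltW//.
by rewrite mulr_gt0.
Qed.

End metric_topology.

Section differentials.
Context {R : realType} {K : ultraFieldType R}.
Local Notation uE := (@unorm_ultrametric _ _ _).

Lemma is_differentialP (E F : ultraBanachType K) (f : E -> F) x L :
  is_differential f x L <-> bounded_linear L /\ forall e : R, 0 < e ->
    exists2 d : R, 0 < d & forall y, unorm y < d ->
      unorm (f (x + y) - f x - L y) <= e * unorm y.
Proof.
split=> [[lL cL h]|[bL h]].
  split=> [|e e0]; first exact: (continuous_bounded_linear lL (cL 0)).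
  have /nbhs_unorm[d d0 hd] := h e e0; exists d => // y yd.
  by apply: hd; rewrite subr0.
split; [by have [] := bL|exact: bounded_linear_cont|].
move=> e e0; have [d d0 hd] := h e e0; apply/nbhs_unorm; exists d => // y.
by rewrite subr0; apply: hd.
Qed.

(** On a small multiple of [z] both linear maps approximate the same increment; homogeneity carries
    the estimate back to [z], where the tolerance [e / unorm z] becomes [e]. *)
Lemma is_differential_unique (E F : ultraBanachType K) (f : E -> F) x L L' :
  is_differential f x L -> is_differential f x L' -> L = L'.
Proof.
move=> /is_differentialP[[lL _] h] /is_differentialP[[lL' _] h'].
apply/funext => z; apply/subr0_eq/(un_small0 uE) => e e0.
have [->|z0] := eqVneq z 0.
  by rewrite (linear_fun0 lL) (linear_fun0 lL') subrr (un0 uE) ltW.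
have nz := un_gt0 uE z0; have ez := divr_gt0 e0 nz.
have [d d0 hd] := h _ ez; have [d' d'0 hd'] := h' _ ez.
have [rho rho0 hs] := @unorm_scale R K E.
have m0 : 0 < Num.min d d' by rewrite lt_min d0.
have [c [c0 _]] := hs _ z m0 z0; rewrite lt_min => /andP[cd cd'].
have := unB_le uE (hd' _ cd') (hd _ cd).
set u := f _ - f _.
have -> : u - L' (c *: z) - (u - L (c *: z)) = c *: (L z - L' z).
  by rewrite opprB addrC addrA subrK (linear_funZ lL) (linear_funZ lL') scalerBr.
rewrite !(unZ uE) mulrCA ler_pM2l ?absv_gt0// divfK//.
by rewrite gt_eqF.
Qed.

Lemma differentialE (E F : ultraBanachType K) (f : E -> F) x L :
  is_differential f x L -> differential f x = L.
Proof.
move=> h; have : is_differential f x (differential f x).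
  exact: (@xgetI _ _ _ L).
by move/is_differential_unique; apply.
Qed.

Lemma is_differential_near (E F : ultraBanachType K) (f g : E -> F) x L :
  (\forall y \near x, f y = g y) -> is_differential f x L ->
  is_differential g x L.
Proof.
move=> /nbhs_unorm[d d0 fg] /is_differentialP[bL h].
apply/is_differentialP; split => // e /h[d' d'0 hd'].
exists (Num.min d d'); first by rewrite lt_min d0.
move=> y; rewrite lt_min => /andP[yd yd'].
rewrite -!fg ?subrr ?(un0 uE)//; first exact: hd'.
by rewrite addrAC subrr add0r.
Qed.

Lemma is_differential_linear (E F : ultraBanachType K) (L : E -> F) x :
  bounded_linear L -> is_differential L x L.
Proof.
move=> bL; apply/is_differentialP; split => // e e0; exists 1 => // y _.
have [lL _] := bL.
by rewrite (linear_funD lL) (addrAC (L x)) subrr add0r subrr (un0 uE) mulr_ge0// ltW.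
Qed.

Lemma bounded_linear_comp (E F G : ultraBanachType K) (L : E -> F) (M : F -> G) :
  bounded_linear L -> bounded_linear M -> bounded_linear (M \o L).
Proof.
move=> [lL [C C0 hC]] [lM [D D0 hD]]; split.
  by move=> a y z; rewrite /= lL lM.
exists (D * C); first exact: mulr_ge0.
by move=> y /=; apply: le_trans (hD _) _; rewrite -mulrA ler_wpM2l.
Qed.

Lemma is_differential_comp (E F G : ultraBanachType K) (f : E -> F) (g : F -> G)
    x L M :
  is_differential f x L -> is_differential g (f x) M ->
  is_differential (g \o f) x (M \o L).
Proof.
move=> /is_differentialP[bL hL] /is_differentialP[bM hM].
have bML := bounded_linear_comp bL bM.
have [lL [C C0 hC]] := bL; have [lM [D D0 hD]] := bM.
apply/is_differentialP; split => // e e0.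
have C1 : 0 < C + 1 by rewrite ltr_wpDl.
have D1 : 0 < D + 1 by rewrite ltr_wpDl.
have [d d0 hd] := hM _ (divr_gt0 e0 C1).
have [d1 d10 hd1] := hL 1 ltr01.
have [d2 d20 hd2] := hL _ (divr_gt0 e0 D1).
(* [d1], obtained with tolerance 1, bounds the increment of [f] by [(C + 1) * unorm y], so
   [d / (C + 1)] brings it within reach of [hd]. The two errors are combined by a maximum, so each
   may use up all of [e]. *)
exists (Num.min (d / (C + 1)) (Num.min d1 d2)).
  by rewrite !lt_min d10 d20 divr_gt0.
move=> y; rewrite !lt_min => /and3P[yd yd1 yd2] /=.
set k := f (x + y) - f x.
have kC : unorm k <= (C + 1) * unorm y.
  rewrite -[k](subrK (L y)); apply: (unD_le uE).
    by apply: le_trans (hd1 _ yd1) _; rewrite ler_wpM2r// lerDr.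
  by apply: le_trans (hC _) _; apply: le_mul_add1.
have kd : unorm k < d.
  by apply: le_lt_trans kC _; rewrite mulrC -ltr_pdivlMr.
have -> : g (f (x + y)) - g (f x) - M (L y) =
    (g (f x + k) - g (f x) - M k) + M (k - L y).
  rewrite (linear_funB lM k (L y)) [RHS]addrA subrK; congr (g _ - _ - _).
  by rewrite /k [RHS]addrC subrK.
apply: (unD_le uE).
  apply: le_trans (hd _ kd) _; rewrite mulrAC ler_pdivrMr// -mulrA ler_wpM2l ?(ltW e0)//.
  by rewrite mulrC.
apply: le_trans (hD _) _; apply: le_trans (ler_wpM2l D0 (hd2 _ yd2)) _.
rewrite mulrA ler_wpM2r// mulrCA ler_piMr ?(ltW e0)// ler_pdivrMr// mul1r.
by rewrite lerDl.
Qed.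

End differentials.

(** * Translation, Lipschitz bounds and Taylor expansion of power series *)

Section power_series.
Context {R : realType} {K : ultraFieldType R}.
Local Notation uE := (@unorm_ultrametric _ _ _).

Lemma ps_id (E : ultraBanachType K) r : 0 <= r -> ps r r (fun y : E => y).
Proof.
move=> r0; rewrite -[X in ps _ X]mul1r; apply: ps_linear => //.
by move=> x; rewrite mul1r.
Qed.

(** Translation by a point of the ball maps the ball to itself, so [ps_comp] re-expands [f] about
    that point without loss of radius or bound. *)
Lemma ps_translate (E F : ultraBanachType K) r C (f : E -> F) x : 0 < r ->
  ps r C f -> unorm x <= r -> ps r C (fun y => f (x + y)).
Proof.
move=> r0 pf xr; apply: (ps_comp r0 pf (g := fun y => x + y)).
apply: ps_add => //; last exact/ps_id/ltW.
by apply: ps_le xr _; apply/ps_cst/ltW.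
Qed.

(** Points are constant power series in an auxiliary variable, so this is [ps_comp_diff] for
    constants, evaluated at 0; the auxiliary radius 1 is arbitrary. *)
Lemma ps_lip (E F : ultraBanachType K) s D (h : E -> F) x y : 0 < s ->
  ps s D h -> unorm x <= s -> unorm y <= s ->
  unorm (h x - h y) <= D / s * unorm (x - y).
Proof.
move=> s0 ph xs ys; have s1 : 0 < 1 :> R := ltr01.
have c z : unorm z <= s -> ps 1 s (fun _ : E => z).
  by move=> zs; apply: ps_le zs _; apply: ps_cst.
have := ps_comp_diff ltr01 s0 ph (c _ x xs) (c _ y ys) (ps_cst (x - y) ler01).
move=> /ps_bound => /(_ 0); rewrite (un0 uE) ler01 => /(_ isT).
by rewrite mulrA mulrAC.
Qed.

Lemma mlmap_zero (E F : ultraBanachType K) k C (b : ('I_k -> E) -> F) :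
  mlmap C b -> (0 < k)%N -> b (fun=> 0) = 0.
Proof.
move=> [_ C0 bC]; case: k b bC => // k b bC _; apply/(un_eq0 uE)/le_anti.
rewrite unorm_ge0 andbT; apply: le_trans (bC _) _.
by rewrite big_ord_recl (un0 uE) mul0r mulr0.
Qed.

(* Removing the terms of degree < m gains a factor (s/r)^m on smaller balls. *)
Lemma ps_tail (E F : ultraBanachType K) r C (f : E -> F) (b : forall k, ('I_k -> E) -> F) c m :
  0 < r -> (forall k, mlmap (c k) (b k)) -> (forall k, c k * r ^+ k <= C) ->
  (forall y, unorm y <= r -> usum (fun k => b k (fun=> y)) (f y)) ->
  forall s, 0 < s -> s < r ->
  ps s (C * (s / r) ^+ m) (fun y => f y - \sum_(k < m) b k (fun=> y)).
Proof.
move=> r0 bc cC bf s s0 sr.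
have c0 k : 0 <= c k by have [] := bc k.
have C0 : 0 <= C by apply: le_trans (cC 0%N); rewrite mulr_ge0.
have sr1 : 0 <= s / r < 1 by rewrite divr_ge0 ?ltW//= ltr_pdivrMr ?mul1r.
have [sr0 sr1'] := andP sr1.
have csr k : c k * s ^+ k <= C * (s / r) ^+ k.
  rewrite -[s in leLHS](divfK (lt0r_neq0 r0)) exprMn mulrCA mulrC.
  by rewrite ler_wpM2r// exprn_ge0.
pose c' k := if (k < m)%N then 0 else c k.
exists (fun k => if (k < m)%N then fun=> 0 else b k), c'.
have c'c k : c' k * s ^+ k <= C * (s / r) ^+ k.
  rewrite /c'; case: ifP => // _.
  by rewrite mul0r mulr_ge0// exprn_ge0.
split.
- by move=> k; rewrite /c'; case: ifP => // _; apply: mlmap0.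
- move=> k; rewrite /c'; case: ltnP => [_|mk].
    by rewrite mul0r mulr_ge0// exprn_ge0.
  apply: le_trans (csr k) _; rewrite ler_wpM2l//.
  by rewrite ler_wiXn2l// ltW.
- exact: null_le (null_geometric C sr1).
- move=> y ys; have yr : unorm y <= r by apply: le_trans (ltW sr).
  have h := @usum_fin _ _ _ (fun k => if (k < m)%N then - b k (fun=> y) else 0) m.
  have := usumD (bf y yr) (h _) => /=.
  rewrite (_ : \sum_(k < m) _ = - \sum_(k < m) b k (fun=> y)); last first.
    by rewrite -sumrN; apply: eq_bigr => k _; rewrite ltn_ord.
  rewrite (_ : (fun k => _ + _) =
      (fun k => (if (k < m)%N then fun=> 0 else b k) (fun=> y))).
    by apply=> k mk; rewrite ltnNge mk.
  by apply/funext => k; case: ifP => _; rewrite ?subrr ?addr0.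
Qed.

(** A Schwarz lemma: without constant term every monomial gains at least one factor s/r. The case s
    = r is treated apart because [ps_tail] asks for s < r. *)
Lemma ps_shrink0 (E F : ultraBanachType K) r C (f : E -> F) s :
  ps r C f -> f 0 = 0 -> 0 < s -> s <= r -> ps s (C * (s / r)) f.
Proof.
move=> pf f0 s0; rewrite le_eqVlt => /predU1P[sr|sr].
  by move: s0; rewrite sr => r0; rewrite divff ?mulr1// gt_eqF.
have r0 := lt_trans s0 sr.
have [b [c [bc cC nc bf]]] := pf.
have := @ps_tail _ _ r C f b c 1 r0 bc cC bf s s0 sr; rewrite expr1.
apply: ps_ext => y ys; rewrite big_ord1.
have b0 : b 0%N (fun=> y) = f 0.
  have r00 : unorm (0 : E) <= r by rewrite (un0 uE) ltW.
  apply: usum_unique (bf 0 r00).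
  have := @usum_fin _ _ _ (fun k => b k (fun=> 0)) 1; rewrite big_ord1.
  rewrite (_ : (fun _ : 'I_0 => 0) = fun=> y); last by apply/funext => -[].
  by apply=> k k0; apply: mlmap_zero (bc k) k0.
by rewrite b0 f0 subr0.
Qed.

(** [A] is the degree-one term. The square makes the Lipschitz constant of the remainder, its bound
    over its radius, as small as desired on small balls. *)
Lemma ps_expand (E F : ultraBanachType K) r C (f : E -> F) : 0 < r -> ps r C f ->
  exists2 A : E -> F, bounded_linear A &
    forall s, 0 < s -> s < r ->
      ps s (C * (s / r) ^+ 2) (fun y => f y - f 0 - A y).
Proof.
move=> r0 pf; have [b [c [bc cC nc bf]]] := pf.
exists (fun y => b 1%N (fun=> y)).
  have [lb b0 bb] := bc 1%N; split.
    move=> a y z; have := lb ord0 (fun=> 0) a y z.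
    have e w : upd (fun _ : 'I_1 => 0) ord0 w = fun=> w :> E.
      by apply/funext => i; rewrite (ord1 i) /upd eqxx.
    by rewrite !e.
  by exists (c 1%N) => // y; have := bb (fun=> y); rewrite big_ord1.
move=> s s0 sr; apply: ps_ext (ps_tail 2 r0 bc cC bf s0 sr) => y ys.
have r00 : unorm (0 : E) <= r by rewrite (un0 uE) ltW.
have -> : f 0 = b 0%N (fun=> y).
  apply: usum_unique (bf 0 r00) _.
  have := @usum_fin _ _ _ (fun k => b k (fun=> 0)) 1; rewrite big_ord1.
  rewrite (_ : (fun _ : 'I_0 => 0) = fun=> y); last by apply/funext => -[].
  by apply=> k k0; apply: mlmap_zero (bc k) k0.
by rewrite big_ord_recr big_ord1/= opprD addrA.
Qed.

Lemma expand_differential (E F : ultraBanachType K) r C (f : E -> F) A :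
  0 < r -> 0 <= C -> bounded_linear A ->
  (forall s, 0 < s -> s < r -> ps s (C * (s / r) ^+ 2) (fun y => f y - f 0 - A y)) ->
  is_differential f 0 A.
Proof.
move=> r0 C0 bA h; apply/is_differentialP; split => // e e0.
have C1 : 0 < C / r ^+ 2 + 1 by rewrite ltr_wpDl// divr_ge0// exprn_ge0// ltW.
exists (Num.min r (e / (C / r ^+ 2 + 1))); first by rewrite lt_min r0 divr_gt0.
move=> y; rewrite lt_min => /andP[yr ye]; rewrite add0r.
have [y0|y0] := eqVneq y 0.
  have [lA _] := bA.
  by rewrite y0 subrr (linear_fun0 lA) subr0 !(un0 uE) mulr0.
have ny := un_gt0 uE y0.
have := ps_bound (h _ ny yr) (lexx _) => /le_trans; apply.
rewrite expr_div_n mulrA mulrAC [unorm y ^+ 2]expr2 mulrA ler_wpM2r//.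
apply: ltW; rewrite ltr_pdivlMr// mulrC in ye; apply: le_lt_trans ye.
by apply: le_mul_add1.
Qed.

End power_series.

(** * Analytic maps *)

Section analytic_at_a_point.
Context {R : realType} {K : ultraFieldType R}.
Local Notation uE := (@unorm_ultrametric _ _ _).

Definition analytic_at (E F : ultraBanachType K) (x : E) (f : E -> F) : Prop :=
  exists r C, 0 < r /\ ps r C (fun y => f (x + y)).

Lemma analytic_at_near (E F : ultraBanachType K) (x : E) (f g : E -> F) :
  (\forall y \near x, f y = g y) -> analytic_at x f -> analytic_at x g.
Proof.
move=> /nbhs_unorm[e e0 fg] [r [C [r0 pf]]].
have m0 : 0 < Num.min r (e / 2) by rewrite lt_min r0 divr_gt0.
exists (Num.min r (e / 2)), C; split => //.
apply: (@ps_ext _ _ _ _ _ _ (fun y => f (x + y))); last first.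
  by apply: ps_shrink pf; [exact: ltW|rewrite ge_min lexx].
move=> y; rewrite le_min => /andP[_ ye]; apply: fg.
rewrite addrAC subrr add0r; apply: le_lt_trans ye _.
by rewrite ltr_pdivrMr// ltr_pMr// ltr1n.
Qed.

Lemma ps_an (E F : ultraBanachType K) (f : E -> F) r C x : 0 < r -> ps r C f ->
  unorm x <= r -> analytic_at x f.
Proof. by move=> r0 pf xr; exists r, C; split => //; apply: ps_translate. Qed.

Lemma analytic_at_near_an (E F : ultraBanachType K) (x : E) (f : E -> F) :
  analytic_at x f -> \forall y \near x, analytic_at y f.
Proof.
move=> [r [C [r0 pf]]]; apply/nbhs_unorm; exists r => // y yx.
exists r, C; split => //; apply: ps_ext (ps_translate r0 pf (ltW yx)) => z _.
by rewrite addrA (addrC x) subrK.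
Qed.

Lemma analytic_at_differentiable (E F : ultraBanachType K) (x : E) (f : E -> F) :
  analytic_at x f -> exists L, is_differential f x L.
Proof.
move=> [r [C [r0 pf]]]; have [A bA hA] := ps_expand r0 pf.
have /is_differentialP[_ h] := expand_differential r0 (ps_ge0 pf) bA hA.
exists A; apply/is_differentialP; split => // e /h[d d0 hd].
by exists d => // y /hd; rewrite add0r addr0.
Qed.

Lemma analytic_at_differential (E F : ultraBanachType K) (x : E) (f : E -> F) :
  analytic_at x f -> is_differential f x (differential f x).
Proof. by move=> /analytic_at_differentiable[L h]; rewrite (differentialE h). Qed.

Lemma analytic_at_continuous (E F : ultraBanachType K) (x : E) (f : E -> F) :
  analytic_at x f -> {for x, continuous f}.
Proof.
move=> [r [C [r0 pf]]]; apply/continuous_unorm => e e0.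
have C0 := ps_ge0 pf; have C1 : 0 < C / r + 1 by rewrite ltr_wpDl// divr_ge0// ltW.
exists (Num.min r (e / (C / r + 1))); first by rewrite lt_min r0 divr_gt0.
move=> y; rewrite lt_min => /andP[yr ye].
have := ps_lip r0 pf (ltW yr); move=> /(_ 0); rewrite (un0 uE) => /(_ (ltW r0)).
rewrite addr0 subr0 (addrC x) subrK => /le_lt_trans; apply.
rewrite ltr_pdivlMr// mulrC in ye; apply: le_lt_trans ye.
by apply: le_mul_add1.
Qed.

Lemma analytic_at_comp (E F G : ultraBanachType K) (x : E) (f : E -> F) (g : F -> G) :
  analytic_at x f -> analytic_at (f x) g -> analytic_at x (g \o f).
Proof.
move=> [r [C [r0 pf]]] [s [D [s0 pg]]].
have C0 := ps_ge0 pf.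
(* t is small enough for f (x + y) - f x to have norm at most s if |y| <= t. *)
pose t := r * s / (C + s).
have Cs : 0 < C + s by rewrite ltr_wpDl.
have t0 : 0 < t by rewrite /t divr_gt0 ?mulr_gt0.
have tr : t <= r by rewrite /t ler_pdivrMr// mulrDr lerDr mulr_ge0// ltW.
have p1 : ps r C (fun y => f (x + y) - f x).
  apply: ps_add => //.
  have := @ps_cst _ _ E _ r (- f x) (ltW r0); apply: ps_le; rewrite (unN uE).
  rewrite -[X in f X]addr0; apply: (ps_bound (g := fun y => f (x + y)) pf).
  by rewrite (un0 uE) ltW.
have p2 := ps_shrink0 p1 _ t0 tr; rewrite addr0 subrr in p2.
have {}p2 := p2 erefl.
exists t, D; split => //.
apply: (@ps_ext _ _ _ _ _ _ ((fun z => g (f x + z)) \o (fun y => f (x + y) - f x))).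
  by move=> y _ /=; rewrite addrC subrK.
apply: ps_comp t0 pg _; apply: ps_le p2.
have -> : C * (t / r) = C * s / (C + s) by rewrite /t; field; rewrite !gt_eqF.
by rewrite ler_pdivrMr// mulrC ler_wpM2l ?lerDl// ltW.
Qed.

Lemma analytic_at_linear (E F : ultraBanachType K) (L : E -> F) x : bounded_linear L -> analytic_at x L.
Proof.
move=> [lL [C C0 LC]].
have m0 : 0 < Num.max 1 (unorm x) by rewrite lt_max ltr01.
apply: (ps_an m0 (ps_linear (ltW m0) C0 lL LC)).
by rewrite le_max lexx orbT.
Qed.

Lemma analytic_at_cst (E F : ultraBanachType K) (v : F) (x : E) : analytic_at x (fun=> v).
Proof. by exists 1, (unorm v); split => //; apply: ps_cst. Qed.

Lemma analytic_at_add (E F : ultraBanachType K) (f g : E -> F) x : analytic_at x f -> analytic_at x g ->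
  analytic_at x (fun y => f y + g y).
Proof.
move=> [r [C [r0 pf]]] [s [D [s0 pg]]].
have m0 : 0 < Num.min r s by rewrite lt_min r0.
exists (Num.min r s), (Num.max C D); split => //.
apply: ps_add => //.
  apply: (@ps_le _ _ _ _ _ C); first by rewrite le_max lexx.
  by apply: (ps_shrink (ltW m0)) pf; rewrite ge_min lexx.
apply: (@ps_le _ _ _ _ _ D); first by rewrite le_max lexx orbT.
by apply: (ps_shrink (ltW m0)) pg; rewrite ge_min lexx orbT.
Qed.

Lemma bounded_linear_id (E : ultraBanachType K) : bounded_linear (fun x : E => x).
Proof. by split => //; exists 1 => // x; rewrite mul1r. Qed.

Lemma analytic_at_id (E : ultraBanachType K) (x : E) : analytic_at x (fun y => y).
Proof. exact/analytic_at_linear/bounded_linear_id. Qed.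

Lemma bounded_linear_opp (E : ultraBanachType K) : bounded_linear (fun x : E => - x).
Proof.
split; first by move=> a x y; rewrite opprD scalerN.
by exists 1 => // x; rewrite mul1r (unN uE).
Qed.

Lemma analytic_at_sub (E F : ultraBanachType K) (f g : E -> F) x : analytic_at x f -> analytic_at x g ->
  analytic_at x (fun y => f y - g y).
Proof.
move=> af ag; apply: analytic_at_add => //.
by apply: (analytic_at_comp (g := fun y => - y) ag); apply/analytic_at_linear/bounded_linear_opp.
Qed.

End analytic_at_a_point.

Section analytic_on_characterization.
Context {R : realType} {K : ultraFieldType R}.
Local Notation uE := (@unorm_ultrametric _ _ _).

Lemma multilinear_scale (E F : ultraBanachType K) k (b : ('I_k -> E) -> F)
    (x : 'I_k -> E) (c : 'I_k -> K) : multilinear b ->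
  b (fun j => c j *: x j) = (\prod_j c j) *: b x.
Proof.
move=> lb.
suff h (s : seq 'I_k) : uniq s ->
    b (fun j => if j \in s then c j *: x j else x j) = (\prod_(j <- s) c j) *: b x.
  have := h (index_enum 'I_k) (index_enum_uniq _) => <-; congr b.
  by apply/funext => j; rewrite mem_index_enum.
elim: s => [|i s IH] /=; first by rewrite big_nil scale1r.
move=> /andP[iNs us]; rewrite big_cons -scalerA -IH//.
pose y j := if j \in s then c j *: x j else x j.
have := linear_funZ (lb i y) (c i) (x i).
have -> : (fun j => if j == i then x i else y j) = y.
  by apply/funext => j; rewrite /y; case: eqP => // ->; rewrite (negPf iNs).
move=> <-; congr b; apply/funext => j; rewrite /y inE.
by case: eqP => //= ->.
Qed.

(** Continuity at 0 in the product topology bounds [b] by 1 once all slots are below some [d];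
    scaling each slot separately into the annulus between [d * rho] and [d] gives the constant.
    Degree 0 is separate, as [b] need not vanish at 0 then. *)
Lemma continuous_multilinear_bounded (E F : ultraBanachType K) k
    (b : ('I_k -> E) -> F) :
  multilinear b -> continuous (b : {ptws 'I_k -> E} -> F) ->
  exists2 C : R, 0 <= C & forall x, unorm (b x) <= C * \prod_i unorm (x i).
Proof.
move=> lb cb; case: k b lb cb => [|k] b lb cb.
  exists (unorm (b (fun=> 0))) => // x; rewrite big_ord0 mulr1.
  by rewrite (_ : x = fun=> 0)//; apply/funext => -[].
have b0 : b (fun=> 0) = 0.
  have := linear_fun0 (lb ord0 (fun=> 0)).
  by rewrite (_ : (fun j => _) = fun=> 0)//; apply/funext => j; rewrite if_same.
pose F0 := filter_from [set d : R | 0 < d]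
  (fun d => [set x : 'I_k.+1 -> E | forall j, unorm (x j) < d]).
have FF : Filter F0.
  apply: filter_from_filter; first by exists 1 => /=.
  move=> i j i0 j0; exists (Num.min i j); first by rewrite /= lt_min i0.
  by move=> x xm; split => l; have := xm l; rewrite lt_min => /andP[].
have F00 : F0 --> ((fun=> 0) : {ptws 'I_k.+1 -> E}).
  apply: ptws_cvg => j A /nbhs_unorm[e e0 eA]; exists e => // x /= xe.
  by apply: eA; rewrite subr0.
have [d d0 hd] : exists2 d : R, 0 < d &
    forall x, (forall j, unorm (x j) < d) -> unorm (b x) < 1.
  have : nbhs (b (fun=> 0)) [set y | unorm y < 1].
    by apply/nbhs_unorm; exists 1 => // y; rewrite b0 subr0.
  by move=> /cb /F00 [d /= d0 hd]; exists d.
have [rho rho0 hs] := @unorm_scale _ _ E.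
have C0 : 0 < d * rho by rewrite mulr_gt0.
exists ((d * rho) ^- k.+1); first by rewrite invr_ge0 exprn_ge0// ltW.
(* A zero slot cannot be scaled, but then [b x] vanishes by linearity in that slot. *)
move=> x; have [[i xi]|nx] := pselect (exists i, x i = 0).
  rewrite (_ : b x = 0).
    by rewrite (un0 uE) mulr_ge0// ?invr_ge0 ?exprn_ge0 ?(ltW C0)// prodr_ge0.
  have := linear_fun0 (lb i x); congr (_ = _); congr b.
  by apply/funext => j; case: eqP => // ->.
have x0 i : x i != 0 by apply/eqP => xi; apply: nx; exists i.
have /boolp.choice[c hc] := fun i => hs d (x i) d0 (x0 i).
have := hd (fun j => c j *: x j) (fun j => let: And3 _ _ h := hc j in h).
rewrite multilinear_scale// (unZ uE) => h.
have cp : absv (\prod_j c j) = \prod_j absv (c j).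
  by elim/big_rec2: _ => [|i u v _ <-]; rewrite ?absv1 ?absvM.
have pp : 0 < \prod_j absv (c j).
  by apply: prodr_gt0 => i _; apply: absv_gt0; have [] := hc i.
rewrite cp in h; rewrite mulrC ler_pdivlMr ?exprn_gt0// -(ler_pM2l pp) mulrA.
apply: (@le_trans _ _ ((d * rho) ^+ k.+1)).
  by rewrite ler_piMl ?exprn_ge0 ?ltW.
rewrite -big_split/= -[X in _ ^+ X]card_ord -prodr_const.
apply: ler_prod => i _; have [_ h1 _] := hc i.
by rewrite h1 ltW.
Qed.

(** For constants, [ps_mlmap_diff] is a local Lipschitz estimate; [D] is its constant on the ball of
    radius [M] containing all [x j]. The summand 1 keeps [M] positive. *)
Lemma mlmap_continuous (E F : ultraBanachType K) k C (b : ('I_k -> E) -> F) :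
  mlmap C b -> continuous (b : {ptws 'I_k -> E} -> F).
Proof.
move=> bC x A /nbhs_unorm[e e0 eA]; have [_ C0 _] := bC.
have M0 : 0 < 1 + \sum_j unorm (x j) by rewrite ltr_wpDr// sumr_ge0.
set M := 1 + _ in M0.
have xM j : unorm (x j) <= M.
  by rewrite /M (bigD1 j)//= addrCA lerDl addr_ge0// sumr_ge0.
pose D := C * M ^+ k / M.
have D0 : 0 <= D by rewrite /D !mulr_ge0 ?exprn_ge0 ?invr_ge0 ?(ltW M0).
have D1 : 0 < D + 1 by rewrite ltr_wpDl.
have m0 : 0 < Num.min M (e / (D + 1)) by rewrite lt_min M0 divr_gt0.
have : \forall y \near (x : {ptws 'I_k -> E}),
    forall j, unorm (y j - x j) < Num.min M (e / (D + 1)).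
  apply: (@filter_forall _ _ (fun j (y : 'I_k -> E) =>
    unorm (y j - x j) < Num.min M (e / (D + 1))) _
    (nbhs_filter (x : {ptws 'I_k -> E}))) => j.
  exact: (ptws_proj (i := j) (near_unorm (x j) m0)).
apply: (@filterS _ _ (nbhs_filter (x : {ptws 'I_k -> E}))) => y yx; apply: eA.
have yxm j : unorm (y j - x j) < M.
  by have := yx j; rewrite lt_min => /andP[].
have yM j : unorm (y j) <= M.
  by rewrite -[y j](subrK (x j)); apply: (unD_le uE) => //; apply: ltW.
have d0 : 0 <= e / (D + 1) by rewrite divr_ge0 ?ltW.
have yxd j : unorm (y j - x j) <= e / (D + 1).
  by have := yx j; rewrite lt_min => /andP[_ /ltW].
have c (z : E) t : unorm z <= t -> ps 1 t (fun _ : E => z).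
  by move=> zs; apply: ps_le zs _; apply: ps_cst.
have := ps_mlmap_diff ltr01 M0 bC (fun j => c _ _ (yM j)) (fun j => c _ _ (xM j))
  (fun j => c _ _ (yxd j)) d0.
have h0 : unorm (0 : E) <= 1 by rewrite (un0 uE) ler01.
move=> /ps_bound /(_ h0) /le_lt_trans; apply; rewrite card_ord (_ : _ * _ = D * e / (D + 1)); last first.
  have gen (u v w z : R) : u * (v * w * z) = u * z * v * w by ring.
  exact: gen.
by rewrite ltr_pdivrMr// mulrC ltr_pM2l// ltrDl.
Qed.

Lemma multilinear_norm_ge0 (E F : ultraBanachType K) k (b : ('I_k -> E) -> F) :
  0 <= multilinear_norm b.
Proof.
rewrite /multilinear_norm; set B := (X in inf X).
have [Bn|/nonemptyPn ->] := pselect (nonempty B); last by rewrite inf0.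
by apply: (lb_le_inf Bn) => ? [].
Qed.

Lemma mlmap_homogeneous (E F : ultraBanachType K) k C (b : ('I_k -> E) -> F) :
  mlmap C b -> homogeneous_polynomial k (fun x => b (fun=> x)) /\
    polynomial_norm k (fun x => b (fun=> x)) <= C.
Proof.
move=> bC; have pb : polarizes (fun x => b (fun=> x)) b.
  by split => //; [case: bC|exact: mlmap_continuous bC].
split; first by exists b.
have [_ C0 hC] := bC.
apply: (@le_trans _ _ (multilinear_norm b)).
  apply: ge_inf; last by exists b.
  by exists 0 => _ [b' _ <-]; apply: multilinear_norm_ge0.
apply: ge_inf; last by split.
by exists 0 => ? [].
Qed.

Lemma polynomial_norm_ge0 (E F : ultraBanachType K) k (q : E -> F) :
  0 <= polynomial_norm k q.
Proof.
rewrite /polynomial_norm; set A := (X in inf X).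
have nb x : A x -> 0 <= x.
  by move=> [b _ <-]; apply: multilinear_norm_ge0.
have [An|/nonemptyPn ->] := pselect (nonempty A); last by rewrite inf0.
exact: lb_le_inf.
Qed.

(** Both norms are infima that need not be attained, hence the strict inequality: a first
    approximation selects [b], a second one a bound of [b] below [c]. *)
Lemma homogeneous_mlmap (E F : ultraBanachType K) k (q : E -> F) c :
  homogeneous_polynomial k q -> polynomial_norm k q < c ->
  exists2 b : ('I_k -> E) -> F, mlmap c b & forall x, q x = b (fun=> x).
Proof.
move=> [b0 hb0] qc.
have [_ [b [lb cb qb] <-] bc] : exists2 y, [set multilinear_norm b | b in
    [set b : ('I_k -> E) -> F | polarizes q b]] y & y < c.
  have := @inf_adherent R [set multilinear_norm b | b in
    [set b : ('I_k -> E) -> F | polarizes q b]] (c - polynomial_norm k q).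
  rewrite subr_gt0 => /(_ qc); case.
    split; first by exists (multilinear_norm b0), b0.
    by exists 0 => _ [b _ <-]; apply: multilinear_norm_ge0.
  by move=> y Ay; rewrite addrC subrK; exists y.
have [C1 C10 hC1] := continuous_multilinear_bounded lb cb.
have [y [y0 hy] yc] : exists2 y, [set C : R | 0 <= C /\
    forall x, unorm (b x) <= C * \prod_(i < k) unorm (x i)] y & y < c.
  have := @inf_adherent R [set C : R | 0 <= C /\
    forall x, unorm (b x) <= C * \prod_(i < k) unorm (x i)] (c - multilinear_norm b).
  rewrite subr_gt0 => /(_ bc); case.
    by split; [exists C1|exists 0 => ? []].
  by move=> y Ay; rewrite addrC subrK; exists y.
exists b => //; split => //; first exact: le_trans (ltW yc).
by move=> x; apply: le_trans (hy x) _; rewrite ler_wpM2r ?prodr_ge0// ltW.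
Qed.

Lemma usum_cvg (E : ultraBanachType K) (u : nat -> E) (s : E) :
  usum u s <-> series u @ \oo --> s.
Proof.
rewrite seriesEord; split.
  move=> us A /nbhs_unorm[e /us[N hN] eA]; exists N => // n /= /hN.
  exact: eA.
move=> h e e0; have /h [N _ hN] := near_unorm s e0.
by exists N => n /hN.
Qed.

(** The bridge to the definitions of the statement: infima of norms and the supremum defining the
    radius of convergence are exchanged for explicit coefficient bounds. *)
Lemma analytic_onP (E F : ultraBanachType K) (U : set E) (f : E -> F) :
  analytic_on U f <-> open U /\ forall x, U x -> analytic_at x f.
Proof.
split=> -[oU h]; split => // x Ux; have := h x Ux; last first.
  move=> [r [C [r0 [b [c [bc cC nc bf]]]]]].
  have [e e0 eU] := (open_unorm U).1 oU x Ux.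
  have m0 : 0 < Num.min r e by rewrite lt_min r0.
  exists (fun k x => b k (fun=> x)).
  have hb k := mlmap_homogeneous (bc k).
  have rad : (r%:E <= convergence_radius (fun k x => b k (fun=> x)))%E.
    apply: ereal_sup_ubound; exists r => //; split; first exact: ltW.
    have p0 k := polynomial_norm_ge0 k (fun x => b k (fun=> x)).
    apply/null_cvg => [k|]; first by rewrite mulr_ge0// exprn_ge0// ltW.
    apply: null_le nc => k; rewrite ler_wpM2r ?exprn_ge0 ?(ltW r0)//.
    by have [] := hb k.
  split.
  - by move=> k; have [] := hb k.
  - by apply: lt_le_trans rad; rewrite lte_fin.
  - exists (Num.min r e); split => //.
    + by apply: le_trans rad; rewrite lee_fin ge_min lexx.
    + by move=> y; rewrite unorm_ball lt_min => /andP[_]; apply: eU.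
    + move=> y; rewrite unorm_ball subr0 lt_min => /andP[yr _].
      by apply/usum_cvg/bf/ltW.
move=> [q [hq rad [r [r0 rrad bU hf]]]].
have [_ [r1 [r10 r1q] <-]] := ereal_sup_gt rad; rewrite lte_fin => {}r10.
have p0 k := polynomial_norm_ge0 k (q k).
have m0 : 0 < Num.min r r1 by rewrite lt_min r0.
pose s := Num.min r r1 / 2.
have s0 : 0 < s by rewrite divr_gt0.
have sm : s < Num.min r r1 by rewrite ltr_pdivrMr// ltr_pMr// ltr1n.
have [sr sr1] : s < r /\ s < r1 by move: sm; rewrite lt_min => /andP[].
have /null_cvg nq := r1q; have {}nq := nq (fun k => mulr_ge0 (p0 k) (exprn_ge0 k (ltW r10))).
(* The summand [r1 ^- k] provides the strict upper bound asked by [homogeneous_mlmap]; as [s < r1],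
   it adds only the geometric sequence [(s / r1) ^+ k] to the bounds. *)
pose c k := polynomial_norm k (q k) + r1 ^- k.
have H k : exists b : ('I_k -> E) -> F, mlmap (c k) b /\ forall x, q k x = b (fun=> x).
  have [] := @homogeneous_mlmap _ _ k (q k) (c k) (hq k).
    by rewrite /c ltrDl invr_gt0 exprn_gt0.
  by move=> b; exists b.
pose b k := sval (cid (H k)).
have bc k : mlmap (c k) (b k) by have [] := svalP (cid (H k)).
have bq k y : q k y = b k (fun=> y) by have [_] := svalP (cid (H k)).
have srt : 0 <= s / r1 < 1 by rewrite divr_ge0 ?ltW//= ltr_pdivrMr// mul1r.
have nc : null (fun k => c k * s ^+ k).
  apply: null_le (nullD nq (null_geometric 1 srt)) => k.
  rewrite /c mulrDl mul1r lerD//.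
    by rewrite ler_wpM2l// lerXn2r ?nnegrE ?ltW.
  by rewrite [leRHS]expr_div_n [leRHS]mulrC.
have [C hC] := null_bounded nc.
exists s, C; split => //; exists b, c; split => // y ys.
apply/usum_cvg; rewrite (_ : (fun k => b k (fun=> y)) = (fun k => q k y)).
  by apply/hf; rewrite unorm_ball subr0; apply: le_lt_trans sr.
by apply/funext => k; rewrite bq.
Qed.

End analytic_on_characterization.

(** * Inverse functions and invariant graphs *)

Section contraction_of_power_series.
Context {R : realType} {K : ultraFieldType R}.
Local Notation uE := (@unorm_ultrametric _ _ _).

Lemma ps_lin_comp (E F G : ultraBanachType K) r C c (g : E -> F) (L : F -> G) :
  0 < r -> 0 <= c -> linear L -> (forall x, unorm (L x) <= c * unorm x) ->
  ps r C g -> ps r (c * C) (fun y => L (g y)).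
Proof.
move=> r0 c0 lL Lc pg.
exact: (ps_comp r0 (ps_linear (ps_ge0 pg) c0 lL Lc) pg).
Qed.

Lemma ps_opp (E F : ultraBanachType K) r C (g : E -> F) :
  0 < r -> ps r C g -> ps r C (fun y => - g y).
Proof.
move=> r0 pg; rewrite -[C]mul1r; apply: (ps_lin_comp r0 _ _ _ pg) => //.
  by move=> a x y; rewrite opprD scalerN.
by move=> x; rewrite mul1r (unN uE).
Qed.

Lemma ps_sub (E F : ultraBanachType K) r C (g g' : E -> F) :
  0 < r -> ps r C g -> ps r C g' -> ps r C (fun y => g y - g' y).
Proof. by move=> r0 pg pg'; apply: ps_add => //; apply: ps_opp. Qed.

Lemma ps_zero (E F : ultraBanachType K) r C : 0 < r -> 0 <= C ->
  ps r C (fun _ : E => 0 : F).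
Proof.
by move=> r0 C0; apply: ps_le (ps_cst 0 (ltW r0)); rewrite (un0 uE).
Qed.

Lemma telescope_from (V : zmodType) (u : nat -> V) n m :
  \sum_(k < m) (u (n + k).+1 - u (n + k)%N) = u (n + m)%N - u n.
Proof.
elim: m => [|m IH]; first by rewrite big_ord0 addn0 subrr.
by rewrite big_ord_recr/= IH addnS addrC subrKA.
Qed.

(** Banach's fixed point theorem in terms of bounds: successive iterates of 0 differ by
    [C * theta ^+ n], and their limit is a telescoping series covered by [ps_series]. The equation
    is obtained on the ball only, since [ps] says nothing about values elsewhere. *)
Lemma ps_fix (E F : ultraBanachType K) r C theta (T : (E -> F) -> E -> F) :
  0 < r -> 0 <= C -> 0 <= theta < 1 ->
  (forall g, ps r C g -> g 0 = 0 -> ps r C (T g) /\ T g 0 = 0) ->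
  (forall g g' d, ps r C g -> g 0 = 0 -> ps r C g' -> g' 0 = 0 ->
    ps r d (fun y => g y - g' y) ->
    ps r (theta * d) (fun y => T g y - T g' y)) ->
  exists g, [/\ ps r C g, g 0 = 0 & forall y, unorm y <= r -> T g y = g y].
Proof.
move=> r0 C0 theta01 TC Td; have [theta0 theta1] := andP theta01.
pose g_ n := iter n T (fun=> 0).
have gC n : ps r C (g_ n) /\ g_ n 0 = 0.
  elim: n => [|n [h1 h2]]; last exact: TC.
  by split => //; apply: ps_zero.
have gd n : ps r (C * theta ^+ n) (fun y => g_ n.+1 y - g_ n y).
  elim: n => [|n IH].
    by rewrite expr0 mulr1; exact: (ps_sub r0 (proj1 (gC 1%N)) (proj1 (gC 0%N))).
  rewrite exprS mulrCA; exact: (Td _ _ _ (proj1 (gC n.+1)) (proj2 (gC n.+1))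
    (proj1 (gC n)) (proj2 (gC n)) IH).
have nC := null_geometric C theta01.
have usg y : unorm y <= r -> exists s, usum (fun n => g_ n.+1 y - g_ n y) s.
  by move=> yr; apply: usum_ex; apply: null_le nC => n; exact: (ps_bound (gd n) yr).
pose g y := Usum (fun n => g_ n.+1 y - g_ n y).
have gP y : unorm y <= r -> usum (fun n => g_ n.+1 y - g_ n y) (g y).
  by move=> /usg[s hs]; rewrite /g/Usum; apply: (@xgetI _ _ _ s).
have g_cvg y : unorm y <= r -> forall e : R, 0 < e ->
    exists N, forall n, (N <= n)%N -> unorm (g_ n y - g y) < e.
  move=> yr e e0; have [N hN] := gP y yr e e0; exists N => n /hN.
  have := telescope_from (g_^~ y) 0 n; rewrite subr0.
  by under eq_bigr do rewrite add0n; rewrite add0n => ->.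
have tail n : ps r (C * theta ^+ n) (fun y => g y - g_ n y).
  apply: (@ps_series _ _ _ _ _ _ (fun k y => g_ (n + k).+1 y - g_ (n + k)%N y)
    (fun k => C * theta ^+ (n + k))) => //.
  - move=> k; rewrite ler_wpM2l// exprD ler_piMr ?exprn_ge0//.
    by rewrite exprn_ile1// ltW.
  - apply: null_le (null_geometric (C * theta ^+ n) theta01) => k.
    by rewrite exprD mulrA.
  - move=> y yr e e0; have [N hN] := g_cvg y yr e e0; exists N => m Nm.
    rewrite (telescope_from (g_^~ y)) opprB addrA subrK.
    by apply: hN; apply: leq_trans Nm _; apply: leq_addl.
have pg : ps r C g.
  have := tail 0%N; rewrite expr0 mulr1; apply: ps_ext => y _.
  by rewrite subr0.
have g0 : g 0 = 0.
  apply: (un_small0 uE) => e e0.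
  have r00 : unorm (0 : E) <= r by rewrite (un0 uE) ltW.
  have [N /(_ N (leqnn N))] := g_cvg 0 r00 e e0.
  by have [_ ->] := gC N; rewrite sub0r (unN uE) => /ltW.
exists g; split => // y yr; apply/subr0_eq/(un_small0 uE) => e e0.
have [N hN] := nC e e0; have [N' hN'] := g_cvg y yr e e0.
pose n := maxn N N'.
rewrite -[T g y](subrK (g_ n.+1 y)) -addrA; apply: (unD_le uE).
  have [h1 h2] := gC n; have := Td _ _ _ pg g0 h1 h2 (tail n).
  move=> /ps_bound /(_ yr) /le_trans; apply.
  apply: le_trans (ltW (hN n (leq_maxl _ _))).
  by rewrite ler_piMl ?(ltW theta1)// mulr_ge0// exprn_ge0.
by apply/ltW/hN'; apply: leq_trans (leq_maxr N N') _.
Qed.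

(** With [h = f - A], solving f x = y amounts to the fixed point equation x = B (y - h x); the
    quadratic bound on [h] makes it a contraction of rate at most 1/2. *)
Lemma inverse_ps (E F : ultraBanachType K) r C (f : E -> F) (A : E -> F)
    (B : F -> E) : 0 < r -> ps r C f -> f 0 = 0 -> is_differential f 0 A ->
  bounded_linear B -> cancel A B -> cancel B A ->
  exists s t g, [/\ 0 < s, 0 < t, s <= r & ps t s g] /\
    [/\ g 0 = 0, forall y, unorm y <= t -> f (g y) = y
      & forall x, unorm x <= s -> unorm (f x) <= t -> g (f x) = x].
Proof.
move=> r0 pf f0 dA [lB [beta' beta'0 hB']] AB BA.
pose beta := beta' + 1; have beta0 : 0 < beta by rewrite ltr_wpDl.
have hB x : unorm (B x) <= beta * unorm x.
  by apply: le_trans (hB' x) _; apply: le_mul_add1.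
have C0 := ps_ge0 pf.
have [A' bA hA] := ps_expand r0 pf.
have eA : A' = A.
  exact: is_differential_unique (expand_differential r0 C0 bA hA) dA.
subst A'; have [lA _] := bA.
(* The second entry is the condition [beta * C * (s / r) ^+ 2 <= s / 2] solved for [s], with [C + 1]
   in place of [C] to avoid dividing by 0. *)
pose s := Num.min (r / 2) (r ^+ 2 / (2 * beta * (C + 1))).
have C1 : 0 < C + 1 by rewrite ltr_wpDl.
have q0 : 0 < 2 * beta * (C + 1) by rewrite !mulr_gt0.
have s0 : 0 < s by rewrite /s lt_min !divr_gt0// exprn_gt0.
have sr : s < r.
  rewrite /s gt_min ltr_pdivrMr// ltr_pMr// ltr1n//.
pose h y := f y - A y.
pose D := C * (s / r) ^+ 2.
have ph : ps s D h.
  by apply: ps_ext (hA s s0 sr) => y _; rewrite f0 subr0.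
have bD : beta * D <= s / 2.
  have : s <= r ^+ 2 / (2 * beta * (C + 1)) by rewrite /s ge_min lexx orbT.
  rewrite ler_pdivlMr// => h1.
  rewrite /D expr_div_n mulrA mulrA ler_pdivrMr ?exprn_gt0//.
  rewrite [leRHS]mulrAC ler_pdivlMr// expr2.
  have -> : beta * C * (s * s) * 2 = s * (s * (2 * beta * C)) by ring.
  rewrite ler_wpM2l ?(ltW s0)//; apply: le_trans h1.
  by rewrite ler_wpM2l ?(ltW s0)// ler_wpM2l ?lerDl// mulr_ge0 ?(ltW beta0).
(* With this radius [B] maps the ball of radius [t] into that of radius [s]. *)
pose t := s / beta; have t0 : 0 < t by rewrite divr_gt0.
have D0 := ps_ge0 ph.
have h0 : h 0 = 0 by rewrite /h f0 (linear_fun0 lA) subrr.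
have s2 : s / 2 <= s by rewrite ler_pdivrMr// ler_peMr ?(ltW s0)// ler1n.
pose theta := beta * D / s.
have th : theta <= 2^-1 by rewrite /theta ler_pdivrMr// [leRHS]mulrC.
have th0 : 0 <= theta by rewrite /theta divr_ge0 ?(ltW s0)// mulr_ge0// ltW.
have th1 : theta < 1 by apply: le_lt_trans th _; rewrite invf_lt1 ?ltr1n.
have [] := @ps_fix F E t s theta (fun g y => B (y - h (g y))) t0 (ltW s0).
- by rewrite th0.
- move=> g pg g0; split; last by rewrite g0 h0 subrr (linear_fun0 lB).
  have pBh : ps t s (fun y => B (h (g y))).
    apply: ps_le (ps_lin_comp t0 (ltW beta0) lB hB (ps_comp t0 ph pg)).
    exact: le_trans bD s2.
  have pB : ps t s B.
    have := ps_linear (ltW t0) (ltW beta0) lB hB.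
    by rewrite /t [beta * _]mulrC divfK// gt_eqF.
  apply: ps_ext (ps_sub t0 pB pBh) => y _.
  by rewrite (linear_funB lB y).
- move=> g g' d pg _ pg' _ pd.
  have := ps_lin_comp t0 (ltW beta0) lB hB (ps_comp_diff t0 s0 ph pg pg' pd).
  move=> /(ps_opp t0).
  have -> : beta * (D * (d / s)) = theta * d by rewrite /theta; ring.
  apply: ps_ext => y _; rewrite -(linear_funB lB) -[LHS]scaleN1r -(linear_funZ lB).
  by congr B; rewrite scaleN1r; abel.
move=> g [pg g0 hg]; exists s, t, g; split; split => //.
- exact: ltW.
- move=> y yt; have := hg y yt => /(congr1 A); rewrite BA => hy.
  by rewrite -[f _](subrK (A (g y))) -/(h _) -hy addrC subrK.
(* Both [x] and [g (f x)] solve the fixed point equation for [f x], so their distance is at most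
   [theta] times itself. *)
- move=> x xs xt.
  have gs : unorm (g (f x)) <= s := ps_bound pg xt.
  have := hg _ xt; set x' := g (f x) in gs * => hx'.
  have hx : B (f x - h x) = x by rewrite /h opprB addrC subrK AB.
  have e : x' - x = B (h x - h x').
    rewrite -[X in X - x]hx' -[X in _ - X]hx -(linear_funB lB); congr B.
    abel.
  have : unorm (x' - x) <= theta * unorm (x' - x).
    rewrite {1}e; apply: le_trans (hB _) _.
    apply: le_trans (ler_wpM2l (ltW beta0) (ps_lip s0 ph xs gs)) _.
    by rewrite (unBC uE x x') mulrA /theta mulrA.
  rewrite -subr_ge0 -[X in _ - X]mul1r -mulrBl => hle.
  apply/subr0_eq/(un_eq0 uE)/le_anti; rewrite unorm_ge0 andbT.
  by move: hle; rewrite nmulr_rge0// subr_lt0.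
Qed.

End contraction_of_power_series.

Section invariant_graph.
Context {R : realType} {K : ultraFieldType R} {E F : ultraBanachType K}.
Local Notation uE := (@unorm_ultrametric _ _ _).
Variables (J : F -> E) (P : E -> F) (A G : E -> E) (A1 : F -> F).
Variables (f : E -> E) (r C a1 b : R).
Hypotheses (lJ : linear J) (lP : linear P) (lA : linear A) (lG : linear G).
Hypothesis lA1 : linear A1.
Hypotheses (PJ : forall u, P (J u) = u) (nJ : forall u, unorm (J u) = unorm u).
Hypothesis nP : forall x, unorm (P x) <= unorm x.
Hypotheses (AJ : forall u, A (J u) = J (A1 u)) (PA : forall x, P (A x) = A1 (P x)).
Hypotheses (a10 : 0 < a1) (a11 : a1 <= 1) (b0 : 0 < b) (ab : a1 * b < 1).
Hypothesis nA1 : forall u, unorm (A1 u) <= a1 * unorm u.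
Hypothesis nG : forall x, unorm (G x) <= b * unorm x.
Hypotheses (PG : forall x, P (G x) = 0) (AG : forall x, A (G x) = x - J (P x)).
Hypothesis expA : forall w, P w = 0 -> unorm w <= b * unorm (A w).
Hypotheses (r0 : 0 < r) (pf : ps r C f) (f0 : f 0 = 0).
Hypothesis dfA : is_differential f 0 A.

(* [phi] is the fixed point of the graph transform, and [sigma z] measures the
   distance from [z] to its graph along the unstable direction. *)
Lemma invariant_graph : exists s (phi : F -> E),
  let sigma z := z - J (P z) - phi (P z) in
  [/\ 0 < s, ps s s phi, phi 0 = 0 & is_differential phi 0 (fun=> 0)] /\
  [/\ s <= r,
      forall u, unorm u <= s -> P (phi u) = 0 /\ unorm (phi u) <= unorm u,
      forall u, unorm u <= s -> sigma (f (J u + phi u)) = 0,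
      forall z, unorm z <= s -> unorm (P (f z)) <= a1 * unorm z
    & forall z, unorm z <= s -> unorm (sigma z) <= b * unorm (sigma (f z))].
Proof.
have C0 := ps_ge0 pf.
have [A' bA hA] := ps_expand r0 pf.
have eA : A' = A.
  exact: is_differential_unique (expand_differential r0 C0 bA hA) dfA.
subst A'.
pose h y := f y - A y.
have h0 : h 0 = 0 by rewrite /h f0 (linear_fun0 lA) subrr.
have phs t : 0 < t -> t < r -> ps t (C * (t / r) ^+ 2) h.
  by move=> t0 tr; apply: ps_ext (hA t t0 tr) => y _; rewrite f0 subr0.
(* The second entry makes the bound [C * (s / r) ^+ 2] of [h] at most [a1 * s], so that [h] has
   Lipschitz constant [a1] on the ball of radius [s]. *)
pose s := Num.min (r / 2) (a1 * r ^+ 2 / (C + 1)).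
have C1 : 0 < C + 1 by rewrite ltr_wpDl.
have s0 : 0 < s by rewrite /s lt_min !divr_gt0// mulr_gt0// exprn_gt0.
have sr : s < r by rewrite /s gt_min ltr_pdivrMr// ltr_pMr// ltr1n.
have ph : ps s (a1 * s) h.
  apply: ps_le (phs s s0 sr); rewrite expr_div_n mulrA ler_pdivrMr ?exprn_gt0//.
  have : s <= a1 * r ^+ 2 / (C + 1) by rewrite /s ge_min lexx orbT.
  rewrite ler_pdivlMr// => h1.
  have -> : a1 * s * r ^+ 2 = s * (a1 * r ^+ 2) by ring.
  rewrite expr2 mulrC -mulrA ler_wpM2l ?(ltW s0)//; apply: le_trans h1.
  by rewrite ler_wpM2l ?(ltW s0)// lerDl.
have as0 : 0 < a1 * s by rewrite mulr_gt0.
have ass : a1 * s <= s by rewrite ler_piMl ?(ltW s0).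
have ps_P t D (g : F -> E) : 0 < t -> ps t D g -> ps t D (fun y => P (g y)).
  move=> t0 pg; rewrite -[D]mul1r; apply: (ps_lin_comp t0 _ lP _ pg) => // x.
  by rewrite mul1r.
have pF1 : ps s (a1 * s) (fun x => P (f x)).
  apply: (@ps_ext _ _ _ _ _ _ (fun x => A1 (P x) + P (h x))).
    by move=> y _; rewrite /h (linear_funB lP) PA addrC subrK.
  apply: ps_add => //.
    apply: ps_linear; rewrite ?(ltW s0) ?(ltW a10)//.
      by move=> a x y; rewrite lP lA1.
    by move=> x; apply: le_trans (nA1 _) _; rewrite ler_wpM2l// ltW.
  rewrite -[a1 * s]mul1r; apply: (ps_lin_comp s0 _ lP _ ph) => // x.
  by rewrite mul1r.
have pJ : ps s s J.
  rewrite -[X in ps _ X]mul1r; apply: ps_linear; rewrite ?(ltW s0)// => x.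
  by rewrite mul1r nJ.
pose z (g : F -> E) u := J u + g u.
have zP g : ps s s g -> ps s s (z g) by move=> pg; apply: ps_add.
pose k (g : F -> E) u := P (f (z g u)).
have z0 g : g 0 = 0 -> z g 0 = 0.
  by move=> g0; rewrite /z (linear_fun0 lJ) g0 addr0.
have k0 g : g 0 = 0 -> k g 0 = 0.
  by move=> /z0; rewrite /k => ->; rewrite f0 (linear_fun0 lP).
have kP g : ps s s g -> ps s (a1 * s) (k g).
  by move=> /zP pz; apply: (ps_comp s0 pF1 pz).
(* [k g] maps into the ball of radius [a1 * s]; there a series vanishing at 0 gains the factor
   [a1]. *)
have pshr (g : F -> E) d : ps s d g -> g 0 = 0 -> ps (a1 * s) (a1 * d) g.
  move=> pg g0; have := ps_shrink0 pg g0 as0 ass.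
  by rewrite mulfK ?gt_eqF// [d * a1]mulrC.
(* Invariance of the graph of [g] says that the unstable part of [f (z g u)], namely [A (g u)] plus
   that of [h (z g u)], is [g (k g u)]. Solving for [g u] with [G], which kills stable parts and
   inverts [A] on unstable ones, gives [T]. *)
pose T g u := G (g (k g u) - h (z g u)).
pose theta := a1 * b.
have theta01 : 0 <= theta < 1 by rewrite /theta ab mulr_ge0 ?ltW.
have [] := @ps_fix _ _ F E s s theta T s0 (ltW s0) theta01.
- move=> g pg g0; split; last by rewrite /T k0// g0 z0// h0 subrr (linear_fun0 lG).
  have p1 : ps s (a1 * s) (fun u => g (k g u)).
    exact: (ps_comp s0 (pshr _ _ pg g0) (kP _ pg)).
  have p2 : ps s (a1 * s) (fun u => h (z g u)) := ps_comp s0 ph (zP _ pg).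
  apply: ps_le (ps_lin_comp s0 (ltW b0) lG nG (ps_sub s0 p1 p2)).
  by rewrite mulrA ler_piMl ?(ltW s0)// mulrC ltW.
(* Three differences, each of bound [a1 * d]: [g] against [g'] at the same point, [g'] at two
   points, and [h] at two points. The factor [b] of [G] turns this into [theta * d]. *)
- move=> g g' d pg g0 pg' g'0 pd.
  have pz : ps s d (fun u => z g u - z g' u).
    by apply: ps_ext pd => u _; rewrite /z opprD addrACA subrr add0r.
  have a1d : a1 * s * (d / s) = a1 * d by rewrite mulrA mulrAC mulfK// gt_eqF.
  have pk : ps s (a1 * d) (fun u => k g u - k g' u).
    by rewrite -a1d; apply: ps_comp_diff pF1 _ _ pz => //; apply: zP.
  have X1 : ps s (a1 * d) (fun u => g (k g u) - g' (k g u)).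
    have gg0 : g 0 - g' 0 = 0 by rewrite g0 g'0 subrr.
    exact: (ps_comp s0 (pshr _ _ pd gg0) (kP _ pg)).
  have X2 : ps s (a1 * d) (fun u => g' (k g u) - g' (k g' u)).
    have := ps_comp_diff s0 as0 (pshr _ _ pg' g'0) (kP _ pg) (kP _ pg') pk.
    by rewrite mulrCA mulfV ?mulr1// gt_eqF.
  have X3 : ps s (a1 * d) (fun u => h (z g u) - h (z g' u)).
    by rewrite -a1d; apply: ps_comp_diff ph _ _ pz => //; apply: zP.
  have := ps_lin_comp s0 (ltW b0) lG nG (ps_sub s0 (ps_add s0 X1 X2) X3).
  rewrite mulrA [b * a1]mulrC; apply: ps_ext => u _.
  rewrite -(linear_funB lG); congr G; rewrite subrKA.
  by rewrite !opprB addrACA [RHS]addrACA; congr (_ + _); rewrite addrC.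
move=> phi [pphi phi0 hphi]; exists s, phi => sigma.
have nphi u : unorm u <= s -> unorm (phi u) <= unorm u.
  move=> us; have := ps_lip s0 pphi us (y := 0).
  by rewrite (un0 uE) phi0 !subr0 divff ?gt_eqF// mul1r; apply; exact: ltW.
have nz u : unorm u <= s -> unorm (z phi u) <= unorm u.
  by move=> us; apply: (unD_le uE); [rewrite nJ|exact: nphi].
have con x : unorm x <= s -> unorm (P (f x)) <= a1 * unorm x.
  move=> xs; have := ps_lip s0 pF1 xs (y := 0).
  rewrite (un0 uE) f0 (linear_fun0 lP) !subr0 mulfK ?gt_eqF//.
  by apply; exact: ltW.
have Pphi u : unorm u <= s -> P (phi u) = 0 by move=> us; rewrite -hphi// PG.
have Pz u : unorm u <= s -> P (z phi u) = u.
  by move=> us; rewrite /z (linear_funD lP) PJ Pphi// addr0.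
have inv u : unorm u <= s -> sigma (f (z phi u)) = 0.
  move=> us; have := hphi u us => /(congr1 A); rewrite AG.
  set k' := k phi u; set z' := z phi u => e.
  have Pz' : P z' = u by rewrite Pz.
  have Pk' : P (phi k') = 0.
    apply: Pphi; apply: le_trans (con _ _) _; first exact: le_trans (nz _ us) us.
    by apply: le_trans ass; rewrite ler_wpM2l ?(ltW a10)//; exact: le_trans (nz _ us) us.
  have fz : f z' = J (A1 u) + A (phi u) + h z'.
    by rewrite /h -AJ -(linear_funD lA) -/(z phi u) addrC subrK.
  have Pfz : P (f z') = A1 u + P (h z').
    by rewrite fz !(linear_funD lP) PJ PA Pphi// (linear_fun0 lA1) addr0.
  have Pe : P (phi k' - h z') = - P (h z') by rewrite (linear_funB lP) Pk' sub0r.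
  rewrite -/k' -/z' Pe (linear_funN lJ) opprK in e.
  have kE : P (f z') = k' by [].
  have Jk : J k' = J (A1 u) + J (P (h z')) by rewrite -kE Pfz (linear_funD lJ).
  rewrite /sigma kE fz -e Jk.
  abel.
have h_lip x y : unorm x <= s -> unorm y <= s -> unorm (h x - h y) <= a1 * unorm (x - y).
  by move=> xs ys; have := ps_lip s0 ph xs ys; rewrite mulfK ?gt_eqF.
have phi_lip x y : unorm x <= s -> unorm y <= s -> unorm (phi x - phi y) <= unorm (x - y).
  by move=> xs ys; have := ps_lip s0 pphi xs ys; rewrite divff ?gt_eqF// mul1r.
split; split => //.
- apply/is_differentialP; split.
    split; first by move=> a x y; rewrite scaler0 addr0.
    by exists 0 => // x; rewrite (un0 uE) mul0r.
  (* Each use of the fixed point equation improves the bound by the factor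
     theta, until the bound on the nonlinear part h takes over. *)
  have claim t et : 0 < t -> t <= s -> 0 <= et ->
      (forall x, unorm x <= t -> unorm (h x) <= et * unorm x) ->
      forall n u, unorm u <= t -> unorm (phi u) <= Num.max (theta ^+ n) (b * et) * unorm u.
    move=> t0 ts et0 het; elim=> [|n IH] u ut.
      have us := le_trans ut ts.
      apply: le_trans (nphi u us) _; rewrite -[leLHS]mul1r ler_wpM2r//.
      by rewrite le_max expr0 lexx.
    have us := le_trans ut ts.
    have zt : unorm (z phi u) <= t := le_trans (nz u us) ut.
    rewrite -hphi//; apply: le_trans (nG _) _.
    have [th0 th1] := andP theta01.
    apply: (@le_trans _ _ (b * (Num.max (a1 * Num.max (theta ^+ n) (b * et)) et * unorm u))).
      rewrite ler_wpM2l ?(ltW b0)//; apply: (unB_le uE); last first.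
        apply: le_trans (het _ zt) _; apply: ler_pM => //; last exact: nz.
        by rewrite le_max lexx orbT.
      have kt : unorm (k phi u) <= a1 * unorm u.
        apply: le_trans (con _ _) _; first exact: le_trans (nz _ us) us.
        by rewrite ler_wpM2l ?(ltW a10)//; exact: nz.
      have kt' : unorm (k phi u) <= t.
        by apply: le_trans kt _; apply: le_trans ut; rewrite ler_piMl.
      apply: le_trans (IH _ kt') _.
      have m0 : 0 <= Num.max (theta ^+ n) (b * et) by rewrite le_max exprn_ge0.
      apply: le_trans (ler_wpM2l m0 kt) _; rewrite mulrA ler_wpM2r//.
      by rewrite [X in X <= _]mulrC le_max lexx.
    rewrite mulrA ler_wpM2r// maxr_pMr ?(ltW b0)// ge_max; apply/andP; split.
      rewrite mulrA [b * a1]mulrC -/theta maxr_pMr// -exprS ge_max le_max lexx/=.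
      by rewrite le_max [X in _ || X]ler_piMl ?orbT ?mulr_ge0 ?(ltW b0)// ltW.
    by rewrite le_max lexx orbT.
  move=> e e0.
  (* [h] has Lipschitz constant [et] on the ball of radius [unorm u], and [b * et] is at most
     [M * unorm u]; so [claim], with n tending to infinity, leaves at most [e]. *)
  pose M := b * C / r ^+ 2 + 1; have M0 : 0 < M.
    by rewrite ltr_wpDl// !mulr_ge0 ?invr_ge0 ?exprn_ge0 ?(ltW b0) ?(ltW r0).
  exists (Num.min s (e / M)); first by rewrite lt_min s0 divr_gt0.
  move=> u; rewrite lt_min => /andP[us ue].
  rewrite add0r phi0 !subr0.
  have [->|u0] := eqVneq u 0; first by rewrite phi0 !(un0 uE) mulr0.
  have nu := un_gt0 uE u0.
  pose et := C * unorm u / r ^+ 2.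
  have et0 : 0 <= et by rewrite /et !mulr_ge0 ?invr_ge0 ?exprn_ge0 ?(ltW r0).
  have het x : unorm x <= unorm u -> unorm (h x) <= et * unorm x.
    move=> xu; have := ps_lip nu (phs _ nu (lt_trans us sr)) xu (y := 0).
    rewrite (un0 uE) h0 !subr0 => /(_ (ltW nu)).
    have -> : C * (unorm u / r) ^+ 2 / unorm u = et.
      by rewrite /et; field; rewrite !gt_eqF.
    by [].
  have bet : b * et <= e.
    apply: ltW; rewrite ltr_pdivlMr// in ue; apply: le_lt_trans ue.
    have -> : b * et = unorm u * (b * C / r ^+ 2) by rewrite /et; ring.
    by rewrite ler_wpM2l// lerDl.
  have : unorm (phi u) <= Num.max 0 (b * et) * unorm u.
    apply/ler_addgt0Pr => d d0.
    have [N /(_ N (leqnn N)) hN] := null_geometric (unorm u) theta01 d0.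
    apply: le_trans (claim _ _ nu (ltW us) et0 het N u (lexx _)) _.
    rewrite maxr_pMl// ge_max; apply/andP; split.
      by rewrite mulrC; apply: le_trans (ltW hN) _; rewrite lerDr mulr_ge0// le_max lexx.
    by rewrite -[leLHS]addr0; apply: lerD (ltW d0); rewrite ler_wpM2r// le_max lexx orbT.
  move=> /le_trans; apply; rewrite ler_wpM2r// ge_max bet ltW//.
- exact: ltW.
- move=> u us; split; [exact: Pphi|exact: nphi].
(* [x] is the graph point over [P x] plus an unstable vector [w]. In [sigma (f x)] all corrections
   to [A w] are at most [a1 * unorm w], hence at most [a1 * b] times the norm of [A w] and strictly
   smaller than it; [un_near] gives equal norms and [expA] concludes. *)
- move=> x xs; have us : unorm (P x) <= s := le_trans (nP x) xs.
  set u := P x in us *; set w := sigma x.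
  have xw : x = z phi u + w by rewrite /w /sigma /z -/u; abel.
  have Pw : P w = 0.
    by rewrite /w /sigma !(linear_funB lP) PJ Pphi// subrr subr0.
  have zs : unorm (z phi u) <= s := le_trans (nz _ us) us.
  have xzw : x - z phi u = w by rewrite [X in X - _]xw; abel.
  set z0' := z phi u in zs xzw *; set d := h x - h z0'.
  have fd : f x - f z0' = A w + d.
    by rewrite /d /h -[in A w]xzw (linear_funB lA); abel.
  have PAw : P (A w) = 0 by rewrite PA Pw (linear_fun0 lA1).
  have Pd : P (f x) - P (f z0') = P d.
    by rewrite -(linear_funB lP) fd (linear_funD lP) PAw add0r.
  have nd : unorm d <= a1 * unorm w by rewrite -xzw; apply: h_lip.
  have nPd : unorm (P d) <= a1 * unorm w := le_trans (nP _) nd.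
  have key : sigma (f x) - A w = d - J (P d) - (phi (P (f x)) - phi (P (f z0'))).
    rewrite -[sigma (f x)]subr0 -[X in _ - X - _](inv u us) /sigma -/z0'.
    rewrite -Pd (linear_funB lJ).
    have -> : d = f x - f z0' - A w by rewrite fd addrC addKr.
    abel.
  have key_le : unorm (sigma (f x) - A w) <= a1 * unorm w.
    rewrite key; apply: (unB_le uE); first by apply: (unB_le uE); rewrite ?nJ.
    apply: le_trans nPd; rewrite -Pd; apply: phi_lip.
      by apply: le_trans (con _ xs) _; apply: le_trans xs; rewrite ler_piMl.
    by apply: le_trans (con _ zs) _; apply: le_trans zs; rewrite ler_piMl.
  have [->|w0] := eqVneq w 0; first by rewrite (un0 uE) mulr_ge0// ltW.
  have nw := un_gt0 uE w0; have wA := expA Pw.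
  have -> // : unorm (sigma (f x)) = unorm (A w).
  apply: (un_near uE); apply: le_lt_trans key_le _.
  have nA : 0 < unorm (A w) by have := lt_le_trans nw wA; rewrite pmulr_rgt0.
  apply: le_lt_trans (ler_wpM2l (ltW a10) wA) _.
  by rewrite mulrA gtr_pMl.
Qed.

End invariant_graph.

(** * Bounded inverse theorem and equivalent norms *)

Section bounded_inverse_theorem.
Context {R : realType} {K : ultraFieldType R} {E F : ultraBanachType K}.
Local Notation uE := (@unorm_ultrametric _ _ _).
Variable L : E -> F.
Hypotheses (bL : bounded_linear L) (surjL : forall y, exists x, L x = y).

Let lL : linear L. Proof. by have [] := bL. Qed.

(* Baire's theorem for the closures of the images of the balls of radius k. *)
Lemma image_ball_dense : exists (k : nat) (e : R), 0 < e /\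
  forall u, unorm u < e -> forall d : R, 0 < d ->
    exists2 x, unorm x <= k%:R & unorm (u - L x) < d.
Proof.
apply: contrapT => H.
have step (k : nat) (ce : F * R) : exists ce' : F * R, 0 < ce.2 ->
    [/\ unorm (ce'.1 - ce.1) < ce.2, 0 < ce'.2, ce'.2 <= ce.2 / 2
      & forall x, unorm x <= k%:R -> ce'.2 <= unorm (ce'.1 - L x)].
  have [e0|] := ltP 0 ce.2; last by move=> _; exists ce.
  have e2 : 0 < ce.2 / 2 by rewrite divr_gt0.
  have [u ue [d d0 hd]] : exists2 u, unorm u < ce.2 & exists2 d : R, 0 < d &
      forall x, unorm x <= k%:R -> d <= unorm (u - L x).
    apply: contrapT => H1; apply: H; exists k, ce.2; split => // u ue d d0.
    apply: contrapT => H2; apply: H1; exists u => //; exists d => // x xk.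
    by rewrite leNgt; apply/negP => xd; apply: H2; exists x.
  have m0 : 0 < Num.min d (ce.2 / 2) by rewrite lt_min d0.
  (* If the image of the ball of radius [k] meets the [d]-ball around the centre, at [L x0], then
     translating by [x0] transfers the gap around [u] to centre plus [u]; otherwise the centre
     itself is avoided. *)
  have [[x0 x0k x0d]|nx] :=
      pselect (exists2 x, unorm x <= k%:R & unorm (ce.1 - L x) < d).
    exists (ce.1 + u, Num.min d (ce.2 / 2)) => _; split => //=.
    - by rewrite addrAC subrr add0r.
    - by rewrite ge_min lexx orbT.
    move=> x xk; rewrite ge_min; apply/orP; left; rewrite leNgt; apply/negP => h.
    have : d <= unorm (u - L (x - x0)) by apply: hd; apply: (unB_le uE).
    rewrite leNgt => /negP; apply.
    have -> : u - L (x - x0) = (ce.1 + u - L x) - (ce.1 - L x0).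
      by rewrite (linear_funB lL); abel.
    exact: (unB_lt uE).
  exists (ce.1, Num.min d (ce.2 / 2)) => _; split => //=.
  - by rewrite subrr (un0 uE).
  - by rewrite ge_min lexx orbT.
  move=> x xk; rewrite ge_min; apply/orP; left.
  by rewrite leNgt; apply/negP => h; apply: nx; exists x.
have /boolp.choice[T0 hT0] := fun kc : nat * (F * R) => step kc.1 kc.2.
have hT k ce := hT0 (k, ce).
(* Nested balls, the one after stage k staying away from the image of the ball of radius k. The
   limit [l] of the centres is some [L x], which contradicts any stage with k at least [unorm x]. *)
pose c := fix c n : F * R := if n is m.+1 then T0 (m, c m) else (0, 1).
have cpos n : 0 < (c n).2.
  by elim: n => [|n IH] /=; [exact: ltr01|have [] := hT n (c n) IH].
have chalf n : (c n).2 <= 2^-1 ^+ n.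
  elim: n => [|n IH] /=; first by rewrite expr0.
  have [_ _ h _] := hT n (c n) (cpos n); apply: le_trans h _.
  by rewrite exprSr ler_pM2r.
have cdec n m : (n <= m)%N -> (c m).2 <= (c n).2.
  elim: m => [|m IH]; first by rewrite leqn0 => /eqP ->.
  rewrite leq_eqVlt => /predU1P[->//|]; rewrite ltnS => /IH; apply: le_trans.
  have [_ _ h _] := hT m (c m) (cpos m); apply: le_trans h _.
  by rewrite ler_pdivrMr// ler_peMr ?(ltW (cpos m))// ler1n.
have ccau n m : (n <= m)%N -> unorm ((c m).1 - (c n).1) < (c n).2.
  elim: m => [|m IH]; first by rewrite leqn0 => /eqP ->; rewrite subrr (un0 uE).
  rewrite leq_eqVlt => /predU1P[->|]; first by rewrite subrr (un0 uE).
  rewrite ltnS => nm; rewrite -(subrK (c m).1 (c m.+1).1) -addrA.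
  apply: (unD_lt uE); last exact: IH.
  have [h _ _ _] := hT m (c m) (cpos m).
  exact: lt_le_trans h (cdec _ _ nm).
have small (e : R) : 0 < e -> exists N, (c N).2 < e.
  have h : 0 <= (2^-1 : R) < 1 by apply/andP; split; lra.
  move=> /(null_geometric 1 h)[N hN]; exists N.
  by have := hN N (leqnn N); rewrite mul1r; apply: le_lt_trans.
have [l hl] : exists l : F, forall e : R, 0 < e -> exists N, forall i, (N <= i)%N ->
    unorm ((c i).1 - l) < e.
  apply: (@unorm_complete R K F) => e /small[N hN]; exists N => i j Ni Nj.
  rewrite -(subrK (c N).1 (c i).1) -addrA; apply: (unD_lt uE).
    exact: lt_trans (ccau _ _ Ni) hN.
  by rewrite (unBC uE); exact: lt_trans (ccau _ _ Nj) hN.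
have [x xl] := surjL l.
have [k hk] : exists k : nat, unorm x <= k%:R.
  exists (Num.truncn (unorm x)).+1; apply: ltW; exact: truncnS_gt.
have [_ _ _ /(_ x hk)] := hT k (c k) (cpos k).
rewrite leNgt => /negP; apply; rewrite xl.
have [N hN] := hl _ (cpos k.+1); pose m := maxn N k.+1.
rewrite -(subrK (c m).1 (T0 (k, c k)).1) -addrA; apply: (unD_lt uE).
  by rewrite (unBC uE); exact: (ccau k.+1 m (leq_maxr _ _)).
by apply: hN; apply: leq_maxl.
Qed.

(** Scaling turns density in one ball into approximation of every [u], up to half its norm, by a
    controlled image. Summing the successive corrections gives an exact preimage, with the same [M]
    since norms of sums are maxima. *)
Lemma bounded_preimage : exists2 M : R, 0 <= M &
  forall u, exists2 x, unorm x <= M * unorm u & L x = u.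
Proof.
have [k [e [e0 he]]] := image_ball_dense.
have [rho rho0 hs] := @unorm_scale R K F.
have er0 : 0 < e * rho by rewrite mulr_gt0.
pose M := k%:R / (e * rho); have M0 : 0 <= M by rewrite divr_ge0// ltW.
have approx u : exists x, unorm x <= M * unorm u /\ unorm (u - L x) <= 2^-1 * unorm u.
  have [->|u0] := eqVneq u 0.
    by exists 0; rewrite (linear_fun0 lL) subrr !(un0 uE) !mulr0.
  have [c [c0 c1 c2]] := hs e u e0 u0.
  have ac0 := absv_gt0 c0; have nu := un_gt0 uE u0.
  have d0 : 0 < 2^-1 * (absv c * unorm u) by rewrite !mulr_gt0// invr_gt0.
  have [x xk xd] := he _ c2 _ d0.
  exists (c^-1 *: x); rewrite (unZ uE) absvV//; split.
    rewrite mulrC ler_pdivrMr//; apply: le_trans xk _.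
    have -> : k%:R = M * (e * rho) by rewrite /M divfK// lt0r_neq0.
    rewrite -(mulrA M) ler_wpM2l//.
    by rewrite [unorm u * _]mulrC.
  have -> : u - L (c^-1 *: x) = c^-1 *: (c *: u - L x).
    by rewrite scalerBr scalerA mulVf// scale1r (linear_funZ lL).
  rewrite (unZ uE) absvV// mulrC ler_pdivrMr//; apply: ltW.
  by rewrite -mulrA [X in _ * X]mulrC.
have /boolp.choice[xi hxi] := approx.
exists M => // u.
pose v := fix v n := if n is m.+1 then v m - L (xi (v m)) else u.
have vn n : unorm (v n) <= unorm u * 2^-1 ^+ n.
  elim: n => [|n IH] /=; first by rewrite expr0 mulr1.
  have [_ h] := hxi (v n); apply: le_trans h _.
  by rewrite exprS mulrCA ler_wpM2l// invr_ge0.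
have h2 : 0 <= (2^-1 : R) < 1 by apply/andP; split; lra.
have h21 n : 2^-1 ^+ n <= 1 :> R by have [? /ltW ?] := andP h2; apply: exprn_ile1.
have nv := null_geometric (unorm u) h2.
have xin n : unorm (xi (v n)) <= M * (unorm u * 2^-1 ^+ n).
  by have [h _] := hxi (v n); apply: le_trans h _; rewrite ler_wpM2l.
have [x hx] : exists x, usum (fun n => xi (v n)) x.
  apply: usum_ex; apply: null_le (null_geometric (M * unorm u) h2) => n.
  by rewrite -mulrA.
exists x.
  apply: usum_le hx; first exact: mulr_ge0.
  move=> n; apply: le_trans (xin n) _; rewrite ler_wpM2l//.
  by rewrite ler_piMr.
apply: usum_unique (usum_linear bL hx) _ => d d0.
have [N hN] := nv d d0; exists N => n /hN; apply: le_lt_trans.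
rewrite (_ : \sum_(j < n) _ = u - v n).
  by rewrite addrAC subrr add0r (unN uE); exact: vn.
elim: n => [|n IH]; first by rewrite big_ord0 subrr.
by rewrite big_ord_recr/= IH; abel.
Qed.

Lemma bounded_inverse : injective L ->
  exists B : F -> E, [/\ bounded_linear B, cancel L B & cancel B L].
Proof.
move=> injL; have [M M0 hM] := bounded_preimage.
have /boolp.choice[B hB] : forall u, exists x, unorm x <= M * unorm u /\ L x = u.
  by move=> u; have [x] := hM u; exists x.
have LB u : L (B u) = u by have [] := hB u.
exists B; split => //; last by move=> x; apply: injL.
split; last by exists M => // u; have [] := hB u.
by move=> a u v; apply: injL; rewrite lL !LB.
Qed.

End bounded_inverse_theorem.

Section equivalent_norms.
Context {R : realType} {K : ultraFieldType R} {V : lmodType K}.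
Variable t : topology_on V.

(** The unit ball of [n1] contains a ball of [n2]; scaling vectors into an annulus turns this
    inclusion into a linear estimate. *)
Lemma norm_equiv (n1 n2 : V -> R) :
  ultrametric_norm n1 -> ultrametric_norm n2 ->
  norm_defines_topology t n1 -> norm_defines_topology t n2 ->
  exists2 C : R, 0 < C & forall x, n1 x <= C * n2 x.
Proof.
move=> h1 h2 t1 t2.
have [e e0 he] : exists2 e : R, 0 < e & forall y, n2 y < e -> n1 y < 1.
  have /t2/(_ 0) : opens t [set x | n1 x < 1].
    apply/t1 => x /= x1; exists 1 => // y /= yx.
    by rewrite -[y](subrK x); apply: (unD_lt h1).
  by rewrite /= (un0 h1) ltr01 => /(_ isT)[e e0 he]; exists e => // y ye;
    apply: he; rewrite /= subr0.
have [rho /andP[rho0 _] hs] := @absv_scale R K.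
have er0 : 0 < e * rho by rewrite mulr_gt0.
exists (e * rho)^-1; first by rewrite invr_gt0.
move=> x; have [->|x0] := eqVneq x 0; first by rewrite (un0 h1) (un0 h2) mulr0.
have [c [c0 c1 c2]] := hs _ _ e0 (un_gt0 h2 x0).
have ac0 := absv_gt0 c0.
have := he (c *: x); rewrite (unZ h2) (unZ h1) => /(_ c2) => c3.
rewrite mulrC ler_pdivlMr// -(ler_pM2l ac0) mulrA; apply: le_trans c1.
by rewrite ler_piMl ?ltW.
Qed.

Lemma metric_complete_equiv (n1 n2 : V -> R) C C' :
  0 < C -> 0 < C' -> (forall x, n1 x <= C * n2 x) -> (forall x, n2 x <= C' * n1 x) ->
  metric_complete n2 -> metric_complete n1.
Proof.
move=> C0 C'0 h12 h21 c2 u cu.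
have [e e0|l hl] := c2 u.
  have [N hN] := cu _ (divr_gt0 e0 C'0); exists N => i j Ni Nj.
  apply: le_lt_trans (h21 _) _; rewrite mulrC -ltr_pdivlMr//; exact: hN.
exists l => e e0; have [N hN] := hl _ (divr_gt0 e0 C0); exists N => i Ni.
by apply: le_lt_trans (h12 _) _; rewrite mulrC -ltr_pdivlMr//; exact: hN.
Qed.

End equivalent_norms.

(** A synonym of [V] on which another norm becomes the canonical one; it will carry the adapted norm
    of the hyperbolic splitting on T_p(M). *)
Definition renormed (R : realType) (K : ultraFieldType R) (V : lmodType K)
    (n : V -> R) (hn : ultrametric_norm n) (hc : metric_complete n) : Type := V.

Section renormed_space.
Context {R : realType} {K : ultraFieldType R} {V : lmodType K} {n : V -> R}.
Variables (hn : ultrametric_norm n) (hc : metric_complete n).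

HB.instance Definition _ := GRing.Lmodule.copy (renormed hn hc) V.

Let hn' : ultrametric_norm (n : renormed hn hc -> R).
Proof. by case: hn; split. Qed.

Let hc' : metric_complete (n : renormed hn hc -> R).
Proof. exact: hc. Qed.

HB.instance Definition _ := isUltraBanach.Build R K (renormed hn hc) hn' hc'.

End renormed_space.

Section closed_subspaces.
Context {R : realType} {K : ultraFieldType R} {E : ultraBanachType K} {S : set E}.
Hypothesis hS : linear_subspace S.
Hypothesis cS : forall x : E,
  (forall e : R, 0 < e -> exists2 y, S y & unorm (y - x) < e) -> S x.

Definition subspace_pred of linear_subspace S
    & (forall x : E, (forall e : R, 0 < e -> exists2 y, S y & unorm (y - x) < e) -> S x)
  : {pred E} := fun x => `[< S x >].

Lemma subspace_submod_closed : GRing.submod_closed (subspace_pred hS cS).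
Proof.
have [S0 SD] := hS; split=> [|c v w]; rewrite !unfold_in; first exact/asboolP.
by move=> /asboolP Sv /asboolP Sw; apply/asboolP/SD.
Qed.

HB.instance Definition _ := GRing.isSubmodClosed.Build K E (subspace_pred hS cS)
  subspace_submod_closed.

Record closed_subspace : Type := ClosedSubspace {
  subspace_val : E ;
  subspace_valP : subspace_val \in subspace_pred hS cS
}.

HB.instance Definition _ := [isSub for subspace_val].
HB.instance Definition _ := [Choice of closed_subspace by <:].
HB.instance Definition _ := [SubChoice_isSubLmodule of closed_subspace by <:].

Let snorm (x : closed_subspace) : R := unorm (\val x).

Let snorm_ultrametric : ultrametric_norm snorm.
Proof.
have u := @unorm_ultrametric R K E.
split=> [x|x|c x|x y]; rewrite /snorm.
- exact: (un_ge0 u).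
- split=> [/(un_eq0 u) x0|->]; first exact/val_inj.
  exact: (un0 u).
- exact: (unZ u).
- exact: (unD u).
Qed.

Let snorm_complete : metric_complete snorm.
Proof.
move=> u cu.
have [l hl] := @unorm_complete R K E (fun i => \val (u i)) cu.
have Sl : l \in subspace_pred hS cS.
  rewrite unfold_in; apply/asboolP/cS => e /hl[N hN].
  exists (\val (u N)); last exact: hN.
  by have := valP (u N); rewrite unfold_in => /asboolP.
by exists (ClosedSubspace Sl).
Qed.

HB.instance Definition _ :=
  isUltraBanach.Build R K closed_subspace snorm_ultrametric snorm_complete.

Lemma closed_subspaceP (x : closed_subspace) : S (\val x).
Proof. by have := valP x; rewrite unfold_in => /asboolP. Qed.

Lemma closed_subspace_exists x : S x -> exists u : closed_subspace, \val u = x.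
Proof.
move=> Sx; have Sx' : x \in subspace_pred hS cS by rewrite unfold_in; apply/asboolP.
by exists (ClosedSubspace Sx').
Qed.

End closed_subspaces.

(** * Charts, analytic maps of manifolds and tangent spaces *)

Lemma nbhs_open (T : topologicalType) (x : T) (A : set T) :
  nbhs x A -> exists2 U, open_nbhs x U & U `<=` A.
Proof. by rewrite nbhsE. Qed.

Lemma cod_fwd (X E : Type) (c : chart X E) x : dom c x -> cod c (fwd c x).
Proof. by move=> cx; exists x. Qed.

Section homeomorphic_charts.
Variables (T E : topologicalType) (c : chart T E).
Hypothesis hc : is_homeo_chart c.

Lemma chart_fwdK x : dom c x -> bwd c (fwd c x) = x.
Proof. by have [_ _ h _ _] := hc; apply: h. Qed.

Lemma dom_bwd y : cod c y -> dom c (bwd c y).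
Proof. by move=> [x cx <-]; rewrite chart_fwdK. Qed.

Lemma chart_bwdK y : cod c y -> fwd c (bwd c y) = y.
Proof. by move=> [x cx <-]; rewrite chart_fwdK. Qed.

Lemma chart_fwd_continuous x : dom c x -> {for x, continuous (fwd c)}.
Proof.
have [oc _ _ h _] := hc; rewrite continuous_open_subspace// in h.
by move=> cx; apply: h; rewrite inE.
Qed.

Lemma chart_bwd_continuous y : cod c y -> {for y, continuous (bwd c)}.
Proof.
have [_ oc _ _ h] := hc; rewrite continuous_open_subspace// in h.
by move=> cx; apply: h; rewrite inE.
Qed.

Lemma dom_nbhs x : dom c x -> nbhs x (dom c).
Proof. by have [oc _ _ _ _] := hc => cx; apply: open_nbhs_nbhs. Qed.

Lemma cod_nbhs y : cod c y -> nbhs y (cod c).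
Proof. by have [_ oc _ _ _] := hc => cx; apply: open_nbhs_nbhs. Qed.

Lemma near_bwd x (A : set T) : dom c x -> nbhs x A ->
  \forall y \near fwd c x, [/\ cod c y, dom c (bwd c y) & A (bwd c y)].
Proof.
move=> cx Ax; have h := cod_nbhs (cod_fwd cx).
have h0 : bwd c y @[y --> fwd c x] --> bwd c (fwd c x) := chart_bwd_continuous (cod_fwd cx).
rewrite (chart_fwdK cx) in h0; have h2 := h0 A Ax.
near=> y; have cy : cod c y by near: y.
by split => //; [exact: dom_bwd|near: y].
Unshelve. all: by end_near. Qed.

Lemma chart_image_open (A : set T) : open A -> open (fwd c @` (dom c `&` A)).
Proof.
move=> oA; rewrite openE => _ [x [cx Ax] <-]; have xA : nbhs x A by apply: open_nbhs_nbhs.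
apply: filterS (near_bwd cx xA) => y [cy dy Ay].
by exists (bwd c y); [split|exact: chart_bwdK].
Qed.

End homeomorphic_charts.

Section analytic_transitions.
Context {R : realType} {K : ultraFieldType R} {E : ultraBanachType K}.
Context {T : topologicalType}.
Implicit Types c d e : chart T E.

Lemma transition_analyticP c d : is_homeo_chart c -> is_homeo_chart d ->
  transition_analytic c d <->
    forall x, dom c x -> dom d x -> analytic_at (fwd c x) (fwd d \o bwd c).
Proof.
move=> hc hd; rewrite /transition_analytic; split.
  by move=> /analytic_onP[_ h] x cx dx; apply: h; exists x.
move=> h; apply/analytic_onP; split.
  by apply: chart_image_open => //; have [] := hd.
by move=> _ [x [cx dx] <-]; apply: h.
Qed.

Lemma analytic_at_transition_trans c d e x : is_homeo_chart c -> is_homeo_chart d ->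
  dom c x -> dom d x -> analytic_at (fwd c x) (fwd d \o bwd c) ->
  analytic_at (fwd d x) (fwd e \o bwd d) -> analytic_at (fwd c x) (fwd e \o bwd c).
Proof.
move=> hc hd cx dx acd ade.
apply: (@analytic_at_near _ _ _ _ _ ((fwd e \o bwd d) \o (fwd d \o bwd c))).
  apply: filterS (near_bwd hc cx (dom_nbhs hd dx)) => y [_ _ dy] /=.
  by rewrite (chart_fwdK hd).
by apply: analytic_at_comp => //=; rewrite (chart_fwdK hc).
Qed.

End analytic_transitions.

Section manifolds.
Context {R : realType} {K : ultraFieldType R}.

Lemma atlas_an (E : ultraBanachType K) (X : Type) (M : manifold E X)
    (c d : chart X E) (x : X) :
  atlas M c -> atlas M d -> dom c x -> dom d x ->
  analytic_at (fwd c x) (fwd d \o bwd c).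
Proof.
move=> Mc Md; have [+ _] := atlas_compatible Mc Md.
by move=> /(@transition_analyticP _ _ _ M c d (atlas_homeo Mc) (atlas_homeo Md)); apply.
Qed.

(** Maximality asks for compatibility with all charts; since transitions compose, one known chart
    around each point suffices. *)
Lemma atlas_add (E : ultraBanachType K) (X : Type) (M : manifold E X)
    (c : chart X E) :
  is_homeo_chart (c : chart M E) ->
  (forall x, dom c x -> exists d, [/\ atlas M d, dom d x,
    analytic_at (fwd c x) (fwd d \o bwd c) & analytic_at (fwd d x) (fwd c \o bwd d)]) ->
  atlas M c.
Proof.
move=> hc h; apply: atlas_maximal => // d Md; have hd := atlas_homeo Md.
split; apply/(@transition_analyticP _ _ _ M) => // x cx dx.
  have [e [Me ex e1 e2]] := h x cx.
  exact: (@analytic_at_transition_trans _ _ _ M c e d x hc (atlas_homeo Me) cx ex e1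
    (atlas_an Me Md ex dx)).
have [e [Me ex e1 e2]] := h x dx.
exact: (@analytic_at_transition_trans _ _ _ M d e c x hd (atlas_homeo Me) cx ex
  (atlas_an Md Me cx ex) e2).
Qed.

(** Any pair of charts will do, by [man_at_charts]. Continuity is demanded separately because the
    expression in charts is meaningful only where [f] stays in the domain of [d]. *)
Definition man_at (E F : ultraBanachType K) (X Y : Type) (M : manifold E X)
    (N : manifold F Y) (f : M -> N) (x : M) : Prop :=
  {for x, continuous f} /\ exists (c : chart X E) (d : chart Y F),
    [/\ atlas M c, atlas N d, dom c x, dom d (f x)
      & analytic_at (fwd c x) (fwd d \o f \o bwd c)].

Section maps.
Context {E F : ultraBanachType K} {X Y : Type} {M : manifold E X}.
Context {N : manifold F Y}.
Implicit Types (f g : M -> N) (x : M).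

Lemma man_at_charts f x (c : chart X E) (d : chart Y F) : man_at f x ->
  atlas M c -> atlas N d -> dom c x -> dom d (f x) ->
  analytic_at (fwd c x) (fwd d \o f \o bwd c).
Proof.
move=> [fx [c0 [d0 [Mc0 Nd0 c0x d0x a0]]]] Mc Nd cx dx.
have hc := atlas_homeo Mc; have hc0 := atlas_homeo Mc0.
have hd := atlas_homeo Nd; have hd0 := atlas_homeo Nd0.
apply: (@analytic_at_near _ _ _ _ _ ((fwd d \o bwd d0) \o ((fwd d0 \o f \o bwd c0) \o
    (fwd c0 \o bwd c)))).
  have n1 : nbhs x (dom (c0 : chart M E)) := dom_nbhs hc0 c0x.
  have n2 : nbhs x (f @^-1` dom (d0 : chart N F)) := fx _ (dom_nbhs hd0 d0x).
  apply: filterS (near_bwd hc cx (filterI n1 n2)) => y [_ _ [/= y1 y2]].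
  by rewrite /= (chart_fwdK hc0)// (chart_fwdK hd0).
apply: analytic_at_comp; last first.
  by rewrite /= (chart_fwdK hc cx) (chart_fwdK hc0 c0x); apply: (atlas_an Nd0 Nd).
apply: analytic_at_comp; first exact: (atlas_an Mc Mc0).
by rewrite /= (chart_fwdK hc cx).
Qed.

Lemma analytic_mapP f : analytic_map f <-> forall x, man_at f x.
Proof.
split=> [[cf af] x|h].
  have [c Mc cx] := atlas_cover M x; have [d Nd dx] := atlas_cover N (f x).
  split; first exact: cf.
  exists c, d; split => //; have /analytic_onP[_ ] := af c d Mc Nd; apply.
  by exists x.
have cf : continuous f by move=> x; have [] := h x.
split => // c d Mc Nd; apply/analytic_onP; split.
  apply: (@chart_image_open M E c (atlas_homeo Mc)).
  apply: (open_comp (f := f)); first by move=> x _; apply: cf.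
  by have [] := atlas_homeo Nd.
by move=> _ [x [cx dx] <-]; apply: man_at_charts.
Qed.

Lemma man_at_continuous f x : man_at f x -> {for x, continuous f}.
Proof. by case. Qed.

Lemma man_at_ext f g x : (\forall y \near x, f y = g y) -> man_at f x -> man_at g x.
Proof.
move=> fg [fx [c [d [Mc Nd cx dx a]]]]; have gx := nbhs_singleton fg.
split.
  move=> A; rewrite -gx => /fx fA; rewrite /nbhs/=.
  by apply: filterS2 fg fA => y /= <-.
exists c, d; rewrite -gx; split => //; apply: analytic_at_near a.
apply: filterS (near_bwd (atlas_homeo Mc) cx fg) => y [_ _ /=].
by move=> ->.
Qed.

Lemma man_at_near f x : man_at f x -> \forall y \near x, man_at f y.
Proof.
move=> [fx [c [d [Mc Nd cx dx a]]]].
have hc := atlas_homeo Mc; have hd := atlas_homeo Nd.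
have n1 := dom_nbhs hc cx.
have n2 : nbhs x (f @^-1` dom (d : chart N F)) := fx _ (dom_nbhs hd dx).
have n3 := chart_fwd_continuous hc cx (analytic_at_near_an a).
have [U [oU Ux] Uh] : exists2 U, open_nbhs x U &
    forall y, U y -> [/\ dom c y, dom d (f y) & analytic_at (fwd c y) (fwd d \o f \o bwd c)].
  have [U oU Uh] := nbhs_open (filterI n1 (filterI n2 n3)).
  by exists U => // y /Uh [? [? ?]].
apply: filterS (open_nbhs_nbhs (conj oU Ux)) => y Uy.
have [cy dy ay] := Uh y Uy; split; last first.
  by exists c, d.
(* Continuity is given at [x] only; at a nearby [y] it is recovered from the expression of [f] in
   charts. *)
have e : \forall z \near y, f z = (bwd d \o (fwd d \o f \o bwd c) \o fwd c) z.
  apply: filterS (open_nbhs_nbhs (conj oU Uy)) => z /Uh[cz dz _] /=.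
  by rewrite (chart_fwdK hc cz) (chart_fwdK hd dz).
have cont : {for y, continuous ((bwd d \o (fwd d \o f \o bwd c) \o fwd c : X -> Y) : M -> N)}.
  apply: continuous_comp; first exact: (chart_fwd_continuous hc cy).
  apply: continuous_comp; first exact: (analytic_at_continuous ay).
  rewrite /= (chart_fwdK hc cy).
  exact: (chart_bwd_continuous hd (cod_fwd dy)).
move=> A Ay; have := cont A; rewrite /= (chart_fwdK hc cy) (chart_fwdK hd dy) => /(_ Ay).
by apply: filterS2 e => z /= ->.
Qed.

End maps.

Lemma man_at_comp (E F G : ultraBanachType K) (X Y Z : Type) (M : manifold E X)
    (N : manifold F Y) (Q : manifold G Z) (f : M -> N) (g : N -> Q) (x : M) :
  man_at f x -> man_at g (f x) -> man_at (g \o f) x.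
Proof.
move=> hf hg; have [fx _] := hf; have [gx _] := hg.
have [c Mc cx] := atlas_cover M x; have [d Nd dx] := atlas_cover N (f x).
have [e Qe ex] := atlas_cover Q (g (f x)).
split; first exact: continuous_comp.
exists c, e; split => //.
have hc := atlas_homeo Mc; have hd := atlas_homeo Nd.
apply: (@analytic_at_near _ _ _ _ _ ((fwd e \o g \o bwd d) \o (fwd d \o f \o bwd c))).
  have n2 : nbhs x (f @^-1` dom (d : chart N F)) := fx _ (dom_nbhs hd dx).
  apply: filterS (near_bwd hc cx n2) => y [_ _ /= dy].
  by rewrite (chart_fwdK hd dy).
apply: analytic_at_comp; first exact: man_at_charts.
by rewrite /= (chart_fwdK hc cx); apply: man_at_charts.
Qed.

Lemma man_at_id (E : ultraBanachType K) (X : Type) (M : manifold E X) (x : M) :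
  man_at (id : M -> M) x.
Proof.
split; first exact: cvg_id.
have [c Mc cx] := atlas_cover M x; exists c, c; split => //.
exact: (atlas_an Mc Mc).
Qed.

Lemma man_at_iter (E : ultraBanachType K) (X : Type) (M : manifold E X)
    (f : M -> M) n (x : M) : (forall y, man_at f y) -> man_at (iter n f) x.
Proof.
move=> hf; elim: n => [|n IH]; first exact: man_at_id.
exact: (man_at_comp IH (hf _)).
Qed.

(** Applied to f^n, this yields charts of M in which the n-th piece of the stable set is flat. *)
Lemma atlas_comp_diffeo (E : ultraBanachType K) (X : Type) (M : manifold E X)
    (f g : M -> M) (c : chart X E) :
  (forall x, man_at f x) -> (forall x, man_at g x) -> cancel f g -> cancel g f ->
  atlas M c -> atlas M (Chart (f @^-1` dom c) (fwd c \o f) (g \o bwd c)).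
Proof.
move=> hf hg fg gf Mc; have hc := atlas_homeo Mc.
have cf : continuous f by move=> x; have [] := hf x.
have cg : continuous g by move=> x; have [] := hg x.
set c' := Chart _ _ _.
have cod_c' : cod c' = cod c.
  apply/seteqP; split=> [_ [x cx <-]|_ [x cx <-]]; first by exists (f x).
  by exists (g x); rewrite /= gf.
have odc' : open (dom c' : set M).
  by apply: (open_comp (f := f)); [move=> x _; apply: cf|have [] := hc].
have hc' : is_homeo_chart (c' : chart M E).
  split => //.
  - by rewrite cod_c'; have [] := hc.
  - by move=> x /= cx; rewrite (chart_fwdK hc cx) fg.
  - rewrite continuous_open_subspace// => x; rewrite inE => cx.
    by apply: continuous_comp; [exact: cf|exact: (chart_fwd_continuous hc)].
  - rewrite cod_c' continuous_open_subspace; last by have [] := hc.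
    move=> y; rewrite inE => cy.
    by apply: continuous_comp; [exact: (chart_bwd_continuous hc)|exact: cg].
apply: atlas_add => // x cx; have [d Md dx] := atlas_cover M x.
exists d; split => //.
  have := man_at_charts (hg (f x)) Mc Md cx; rewrite /= fg; exact.
exact: man_at_charts.
Qed.

Lemma atlas_comp_local (E : ultraBanachType K) (X : Type) (M : manifold E X)
    (c : chart X E) (U V : set E) (s t : E -> E) :
  atlas M c -> open U -> open V -> U `<=` cod c ->
  (forall y, U y -> [/\ V (s y), t (s y) = y & analytic_at y s]) ->
  (forall z, V z -> [/\ U (t z), s (t z) = z & analytic_at z t]) ->
  let c' := Chart (dom c `&` fwd c @^-1` U) (s \o fwd c) (bwd c \o t) in
  atlas M c' /\ cod c' = V.
Proof.
move=> Mc oU oV Uc hs ht c'; have hc := atlas_homeo Mc.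
have cod_c' : cod c' = V.
  apply/seteqP; split=> [_ [x [cx Ux] <-]|z Vz]; first by have [] := hs _ Ux.
  have [Uz stz _] := ht z Vz; have ctz := Uc _ Uz.
  exists (bwd c (t z)); last by rewrite /= (chart_bwdK hc ctz).
  by split; [exact: (dom_bwd hc ctz)|rewrite /= (chart_bwdK hc ctz)].
split => //.
have hc' : is_homeo_chart (c' : chart M E).
  have oc' : open (dom c' : set M).
    rewrite openE => x [cx Ux]; apply: filterI; first exact: (dom_nbhs hc cx).
    by apply: (chart_fwd_continuous hc cx); apply: open_nbhs_nbhs.
  split => //.
  - by rewrite cod_c'.
  - by move=> x [cx Ux] /=; have [_ -> _] := hs _ Ux; exact: (chart_fwdK hc).
  - rewrite continuous_open_subspace// => x; rewrite inE => -[cx Ux].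
    apply: continuous_comp; first exact: (chart_fwd_continuous hc cx).
    by apply: analytic_at_continuous; have [] := hs _ Ux.
  - rewrite cod_c' continuous_open_subspace// => z; rewrite inE => Vz.
    have [Uz _ az] := ht z Vz; apply: continuous_comp; first exact: analytic_at_continuous.
    exact: (chart_bwd_continuous hc (Uc _ Uz)).
apply: atlas_add => // x [cx Ux]; exists c; split => //.
  have [Vsx tsx _] := hs _ Ux; have [_ _ at_] := ht _ Vsx.
  apply: analytic_at_near at_.
  apply: filterS (open_nbhs_nbhs (conj oV Vsx)) => z Vz /=; have [Uz _ _] := ht z Vz.
  by rewrite (chart_bwdK hc (Uc _ Uz)).
have [_ _ as_] := hs _ Ux; apply: analytic_at_near as_.
by apply: filterS (cod_nbhs hc (cod_fwd cx)) => z cz /=; rewrite (chart_bwdK hc cz).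
Qed.

End manifolds.

Section tangent_spaces.
Context {R : realType} {K : ultraFieldType R} {E : ultraBanachType K}.
Context {X : Type} {M : manifold E X} {p : M}.
Implicit Types c d : chart_at p.

Definition dtrans c d : E -> E :=
  differential (fwd (sval d) \o bwd (sval c)) (fwd (sval c) p).

Lemma dtransP c d :
  is_differential (fwd (sval d) \o bwd (sval c)) (fwd (sval c) p) (dtrans c d).
Proof.
have [Mc cp] := svalP c; have [Md dp] := svalP d.
exact/analytic_at_differential/(atlas_an Mc Md).
Qed.

Lemma dtrans_comp c d e x : dtrans d e (dtrans c d x) = dtrans c e x.
Proof.
have [Mc cp] := svalP c; have [Md dp] := svalP d.
have hc := atlas_homeo Mc; have hd := atlas_homeo Md.
suff -> : dtrans c e = dtrans d e \o dtrans c d by [].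
apply: differentialE.
apply: (@is_differential_near _ _ _ _ ((fwd (sval e) \o bwd (sval d)) \o
    (fwd (sval d) \o bwd (sval c)))).
  apply: filterS (near_bwd hc cp (dom_nbhs hd dp)) => y [_ _ dy] /=.
  by rewrite (chart_fwdK hd dy).
apply: is_differential_comp (dtransP c d) _.
rewrite /= (chart_fwdK hc cp); exact: dtransP.
Qed.

Lemma dtrans_id c x : dtrans c c x = x.
Proof.
have [Mc cp] := svalP c; have hc := atlas_homeo Mc.
suff -> : dtrans c c = id by [].
apply: differentialE; apply: (@is_differential_near _ _ _ _ id); last first.
  exact/is_differential_linear/bounded_linear_id.
by apply: filterS (cod_nbhs hc (cod_fwd cp)) => y cy /=; rewrite (chart_bwdK hc cy).
Qed.

Lemma tangent_dtrans (v : tangent p) c d : tangent_val v d = dtrans c d (tangent_val v c).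
Proof. by have := tangent_valP v; rewrite unfold_in => /asboolP; apply. Qed.

Lemma tangent_inj (v w : tangent p) c : tangent_val v c = tangent_val w c -> v = w.
Proof.
move=> vw; apply/val_inj/funext => d.
by rewrite /= (tangent_dtrans v c d) vw -tangent_dtrans.
Qed.

Lemma tangent_of_subproof c (x : E) : (fun d => dtrans c d x) \in @coherent _ _ _ _ M p.
Proof. by rewrite unfold_in; apply/asboolP => d e; rewrite -(dtrans_comp c d). Qed.

Definition tangent_of c (x : E) : tangent p := Tangent (tangent_of_subproof c x).

Lemma tangent_ofK c x : tangent_val (tangent_of c x) c = x.
Proof. exact: dtrans_id. Qed.

Lemma tangent_valK c v : tangent_of c (tangent_val v c) = v.
Proof. by apply: (@tangent_inj _ _ c); rewrite tangent_ofK. Qed.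

Lemma tangent_val_continuous c : continuous (fun v : tangent p => tangent_val v c).
Proof.
move=> v A Av.
have hA : nbhs (tangent_val v : {ptws chart_at p -> E}) [set g | A (g c)].
  exact: (ptws_proj (i := c) Av).
exact: (@initial_continuous _ _ (@tangent_val R K E X M p : tangent p -> {ptws chart_at p -> E}) v _ hA).
Qed.

Lemma tangent_of_continuous c : continuous (tangent_of c).
Proof.
apply: (@continuous_comp_initial _ E _ (@tangent_val R K E X M p : tangent p -> {ptws chart_at p -> E})
  (tangent_of c)).
move=> x; apply: (@ptws_cvg _ _ _ _ (fmap_filter _ (nbhs_filter x))) => d.
have /is_differentialP[bL _] := dtransP c d.
by move=> A hA; exact: (bounded_linear_cont bL hA).
Qed.

Lemma tangent_norm_topology c :
  norm_defines_topology (topology_of (tangent p)) (fun v => unorm (tangent_val v c)).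
Proof.
move=> A; split => [oA v Av|h].
  have := tangent_of_continuous (c := c) (x := tangent_val v c).
  rewrite /continuous_at tangent_valK => /(_ A).
  move=> /(_ (open_nbhs_nbhs (conj oA Av)))/nbhs_unorm[e e0 he].
  by exists e => // w /= wv; rewrite -(tangent_valK c w); apply: he.
change (open A); rewrite openE => v /h[e e0 eA].
apply: (@filterS _ (nbhs v) _ _ A eA).
exact: (tangent_val_continuous (c := c) (near_unorm _ e0)).
Qed.

Lemma tangent_norm_ultrametric c :
  ultrametric_norm (fun v : tangent p => unorm (tangent_val v c)).
Proof.
have u := @unorm_ultrametric R K E.
split=> [v|v|a v|v w].
- exact: (un_ge0 u).
- split=> [/(un_eq0 u) v0|->]; last exact: (un0 u).
  by apply: (@tangent_inj _ _ c).
- exact: (unZ u).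
- exact: (unD u).
Qed.

Lemma tangent_norm_complete c :
  metric_complete (fun v : tangent p => unorm (tangent_val v c)).
Proof.
move=> u cu; have [l hl] := @unorm_complete R K E (fun i => tangent_val (u i) c) cu.
exists (tangent_of c l) => e /hl[N hN]; exists N => i /hN.
by rewrite -{1}(tangent_ofK c l).
Qed.

End tangent_spaces.

Section tangent_maps.
Context {R : realType} {K : ultraFieldType R} {E F : ultraBanachType K}.
Context {X Y : Type} {M : manifold E X} {N : manifold F Y}.

(** [tangent_map] picks a vector by choice, so existence is at stake: a candidate is defined in one
    pair of charts, and the chain rule shows that it has the required value in every pair. *)
Lemma tangent_mapE (f : M -> N) (p : M) (q : N) (v : tangent p)
    (c : chart_at p) (d : chart_at q) : man_at f p -> f p = q ->
  tangent_val (tangent_map f p q v) d =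
    differential (fwd (sval d) \o f \o bwd (sval c)) (fwd (sval c) p)
      (tangent_val v c).
Proof.
move=> hf fpq; pose D (c : chart_at p) (d : chart_at q) :=
  differential (fwd (sval d) \o f \o bwd (sval c)) (fwd (sval c) p).
have DP (c' : chart_at p) (d' : chart_at q) : is_differential
    (fwd (sval d') \o f \o bwd (sval c')) (fwd (sval c') p) (D c' d').
  have [Mc cp] := svalP c'; have [Nd dq] := svalP d'.
  by apply/analytic_at_differential/man_at_charts => //; rewrite fpq.
pose w := tangent_of d (D c d (tangent_val v c)).
have hw (c' : chart_at p) (d' : chart_at q) :
    tangent_val w d' = D c' d' (tangent_val v c').
  rewrite (tangent_dtrans v c c') (tangent_dtrans w d d') tangent_ofK.
  suff e : D c' d' \o dtrans c c' = dtrans d d' \o D c d.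
    by have := congr1 (@^~ (tangent_val v c)) e => /= ->.
  have [Mc cp] := svalP c; have [Nd dq] := svalP d.
  have [Mc' cp'] := svalP c'; have [Nd' dq'] := svalP d'.
  have hc := atlas_homeo Mc; have hc' := atlas_homeo Mc'; have hd := atlas_homeo Nd.
  have df : dom (sval d) (f p) by rewrite fpq.
  apply: is_differential_unique (is_differential_comp (dtransP c c') _) _.
    by rewrite /= (chart_fwdK hc cp); exact: DP.
  apply: (@is_differential_near _ _ _ _ ((fwd (sval d') \o bwd (sval d)) \o
      (fwd (sval d) \o f \o bwd (sval c)))); last first.
    apply: is_differential_comp (DP c d) _.
    by rewrite /= (chart_fwdK hc cp) fpq; exact: dtransP.
  have [fx _] := hf.
  have n1 := dom_nbhs hc' cp'.
  have n2 : nbhs p (f @^-1` dom (sval d : chart N F)) := fx _ (dom_nbhs hd df).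
  apply: filterS (near_bwd hc cp (filterI n1 n2)) => y [_ _ [/= y1 y2]].
  by rewrite (chart_fwdK hc' y1) (chart_fwdK hd y2).
have : forall (c' : chart_at p) (d' : chart_at q),
    tangent_val (tangent_map f p q v) d' = D c' d' (tangent_val v c').
  rewrite /tangent_map.
  exact: (@xgetI _ 0 [set w : tangent q | forall (c : chart_at p) (d : chart_at q),
    tangent_val w d = D c d (tangent_val v c)] w hw).
by apply.
Qed.

End tangent_maps.

(** * Straightened charts and gluing *)

Lemma open_an_ball (R : realType) (K : ultraFieldType R) (E F : ultraBanachType K)
    (q : E -> F) (s : R) : 0 < s -> (forall y, analytic_at y q) ->
  open [set y | unorm (q y) <= s].
Proof.
move=> s0 aq; rewrite openE => y qy.
have h : nbhs (q y) [set z | unorm z <= s].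
  by apply: open_nbhs_nbhs; split => //; apply: open_closed_ball.
exact: (analytic_at_continuous (aq y) h).
Qed.

Section straightening.
Context {R : realType} {K : ultraFieldType R} {E V F : ultraBanachType K}.
Context {X : Type} {M : manifold E X}.
Local Notation uE := (@unorm_ultrametric _ _ _).
Variables (f : M -> M) (p : M) (c : chart X E).
Variables (Th : E -> V) (Th' : V -> E).
Variables (J : F -> V) (P : V -> F) (A G : V -> V) (A1 : F -> F).
Variables (a1 b : R).
Hypotheses (fp : f p = p) (mf : man_at f p) (Mc : atlas M c) (cp : dom c p).
Hypotheses (bTh : bounded_linear Th) (bTh' : bounded_linear Th').
Hypotheses (ThK : cancel Th Th') (Th'K : cancel Th' Th).
Hypotheses (lJ : linear J) (lP : linear P) (lA : linear A) (lG : linear G).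
Hypothesis lA1 : linear A1.
Hypotheses (PJ : forall u, P (J u) = u) (nJ : forall u, unorm (J u) = unorm u).
Hypothesis nP : forall x, unorm (P x) <= unorm x.
Hypotheses (AJ : forall u, A (J u) = J (A1 u)) (PA : forall x, P (A x) = A1 (P x)).
Hypotheses (a10 : 0 < a1) (a11 : a1 <= 1) (b0 : 0 < b) (ab : a1 * b < 1).
Hypothesis nA1 : forall u, unorm (A1 u) <= a1 * unorm u.
Hypothesis nG : forall x, unorm (G x) <= b * unorm x.
Hypotheses (PG : forall x, P (G x) = 0) (AG : forall x, A (G x) = x - J (P x)).
Hypothesis expA : forall w, P w = 0 -> unorm w <= b * unorm (A w).
Hypothesis dfA : A = Th \o differential (fwd c \o f \o bwd c) (fwd c p) \o Th'.

Let hc : is_homeo_chart (c : chart M E) := atlas_homeo Mc.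

(* In the chart [kappa] the local stable manifold is the subspace J F. *)
Lemma straightened_chart : exists (s : R) (kappa : chart X E),
  let loc x := Th (fwd kappa x) in
  [/\ 0 < s, atlas M kappa, dom kappa p, fwd kappa p = 0
    & cod kappa = [set y | unorm (Th y) <= s]] /\
  [/\ is_differential (fwd kappa \o bwd c) (fwd c p) id,
      forall x, dom kappa x -> loc x = J (P (loc x)) ->
        dom kappa (f x) /\ loc (f x) = J (P (loc (f x))),
      forall x, dom kappa x -> dom kappa (f x) ->
        unorm (P (loc (f x))) <= a1 * unorm (loc x)
    & forall x, dom kappa x -> dom kappa (f x) ->
        unorm (loc x - J (P (loc x))) <=
        b * unorm (loc (f x) - J (P (loc (f x))))].
Proof.
have [lTh _] := bTh; have [lTh' _] := bTh'.
pose fc := fwd c \o f \o bwd c.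
(* [f] in the chart [c], centred at [p] and transported to [V], whose norm is the adapted one. *)
pose ft z := Th (fc (fwd c p + Th' z) - fwd c p).
have fcp : fc (fwd c p) = fwd c p by rewrite /fc /= (chart_fwdK hc cp) fp.
have ft0 : ft 0 = 0.
  by rewrite /ft (linear_fun0 lTh') addr0 fcp subrr (linear_fun0 lTh).
have anfc : analytic_at (fwd c p) fc by apply: (man_at_charts mf) => //; rewrite fp.
have analytic_at_shift_in z : analytic_at z (fun z => fwd c p + Th' z).
  by apply: analytic_at_add; [exact: analytic_at_cst|exact: analytic_at_linear].
have anft : analytic_at 0 ft.
  apply: (analytic_at_comp (f := fun z => fc (fwd c p + Th' z) - fwd c p) _ (analytic_at_linear _ bTh)).
  apply: analytic_at_sub; last exact: analytic_at_cst.
  apply: (analytic_at_comp (f := fun z => fwd c p + Th' z)) => //.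
  by rewrite (linear_fun0 lTh') addr0.
have dft : is_differential ft 0 A.
  rewrite dfA; have h := analytic_at_differential anfc.
  have d1 : is_differential (fun z => fwd c p + Th' z) 0 Th'.
    apply/is_differentialP; split => // e e0; exists 1 => // y _.
    rewrite add0r (linear_fun0 lTh') addr0 (_ : _ - _ - _ = 0); last by abel.
    by rewrite (un0 uE) mulr_ge0// ltW.
  have d2 : is_differential (fun y => Th (y - fwd c p)) (fwd c p) Th.
    apply/is_differentialP; split => // e e0; exists 1 => // y _.
    rewrite -(linear_funB lTh) -(linear_funB lTh) (_ : _ - _ - _ = 0); last by abel.
    by rewrite (linear_fun0 lTh) (un0 uE) mulr_ge0// ltW.
  have d3 : is_differential (fc \o (fun z => fwd c p + Th' z)) 0
      (differential fc (fwd c p) \o Th').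
    by apply: is_differential_comp d1 _; rewrite /= (linear_fun0 lTh') addr0.
  apply: (is_differential_comp (g := fun y => Th (y - fwd c p)) d3).
  by rewrite /= (linear_fun0 lTh') addr0 fcp.
have [r1 [C [r10 pft]]] := anft.
have [e e0 he] : exists2 e : R, 0 < e & forall z : V, unorm z < e ->
    cod c (fwd c p + Th' z) /\ dom c (f (bwd c (fwd c p + Th' z))).
  have n2 : nbhs p (f @^-1` dom (c : chart M E)).
    apply: (man_at_continuous mf); rewrite fp; exact: (dom_nbhs hc cp).
  have h1 B : nbhs (fwd c p) B -> nbhs (0 : V) [set z | B (fwd c p + Th' z)].
    move=> Bc; apply: (analytic_at_continuous (analytic_at_shift_in 0)).
    by rewrite (linear_fun0 lTh') addr0.
  have /h1/nbhs_unorm[e e0 h] := near_bwd hc cp n2.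
  by exists e => // z ze; have [|? _ ?] := h z; rewrite ?subr0.
pose r := Num.min r1 (e / 2); have r0 : 0 < r by rewrite /r lt_min r10 divr_gt0.
have rr1 : r <= r1 by rewrite /r ge_min lexx.
have pft' : ps r C ft.
  by apply: (ps_shrink (ltW r0) rr1); apply: ps_ext pft => y _; rewrite add0r.
have re : r < e.
  by rewrite /r gt_min; apply/orP; right; rewrite ltr_pdivrMr// ltr_pMr// ltr1n.
have [s [phi /= [[s0 pphi phi0 dphi] [sr Hphi Hinv Hcon Hexp]]]] :=
  @invariant_graph _ _ _ _ J P A G A1 ft r C a1 b lJ lP lA lG lA1 PJ nJ nP AJ PA
    a10 a11 b0 ab nA1 nG PG AG expA r0 pft' ft0 dft.
have Pus z : unorm z <= s -> unorm (P z) <= s by apply: le_trans.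
(* The shear subtracting [phi] leaves [P] unchanged, as [phi] takes values in the kernel of [P]; so
   adding [phi] is its inverse, and both preserve the ball of radius [s] because [phi] does not
   increase norms. *)
pose S z := z - phi (P z); pose S' z := z + phi (P z).
have PS z : unorm z <= s -> P (S z) = P z.
  by move=> /Pus/Hphi[h _]; rewrite /S (linear_funB lP) h subr0.
have PS' z : unorm z <= s -> P (S' z) = P z.
  by move=> /Pus/Hphi[h _]; rewrite /S' (linear_funD lP) h addr0.
have nS z : unorm z <= s -> unorm (S z) <= unorm z.
  by move=> /Pus/Hphi[_ h]; apply: (unB_le uE) => //; apply: le_trans (nP _).
have nS' z : unorm z <= s -> unorm (S' z) <= unorm z.
  by move=> /Pus/Hphi[_ h]; apply: (unD_le uE) => //; apply: le_trans (nP _).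
have S'S z : unorm z <= s -> S' (S z) = z.
  by move=> zs; rewrite {1}/S' PS// subrK.
have SS' z : unorm z <= s -> S (S' z) = z.
  by move=> zs; rewrite {1}/S PS'// addrK.
have bP : bounded_linear P by split => //; exists 1 => // z; rewrite mul1r.
have anphi z : unorm z <= s -> analytic_at z (fun z => phi (P z)).
  move=> zs; apply: (analytic_at_comp (f := P) (analytic_at_linear _ bP)).
  by apply: (ps_an s0 pphi); apply: Pus.
have anS z : unorm z <= s -> analytic_at z S.
  by move=> zs; apply: analytic_at_sub; [exact: analytic_at_id|exact: anphi].
have anS' z : unorm z <= s -> analytic_at z S'.
  by move=> zs; apply: analytic_at_add; [exact: analytic_at_id|exact: anphi].
pose U := [set y | unorm (Th (y - fwd c p)) <= s].
pose W := [set y | unorm (Th y) <= s].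
pose h y := Th' (S (Th (y - fwd c p))); pose h' y := fwd c p + Th' (S' (Th y)).
have analytic_at_d y : analytic_at y (fun y => Th (y - fwd c p)).
  apply: (analytic_at_comp (f := fun y => y - fwd c p) _ (analytic_at_linear _ bTh)).
  by apply: analytic_at_sub; [exact: analytic_at_id|exact: analytic_at_cst].
have oU : open U := open_an_ball s0 analytic_at_d.
have oW : open W := open_an_ball s0 (fun y => analytic_at_linear y bTh).
have Uc : U `<=` cod c.
  move=> y Uy; have [] := he (Th (y - fwd c p)).
    by apply: le_lt_trans Uy _; apply: le_lt_trans re.
  by rewrite ThK addrC subrK.
have hs y : U y -> [/\ W (h y), h' (h y) = y & analytic_at y h].
  move=> Uy; split.
  - by rewrite /W/= /h Th'K; apply: le_trans (nS _ Uy) Uy.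
  - by rewrite /h' /h Th'K S'S// ThK addrC subrK.
  - apply: (analytic_at_comp (f := S \o fun y => Th (y - fwd c p)) _ (analytic_at_linear _ bTh')).
    by apply: analytic_at_comp (analytic_at_d y) _; apply: anS.
have ht z : W z -> [/\ U (h' z), h (h' z) = z & analytic_at z h'].
  move=> Wz; have e' : Th (h' z - fwd c p) = S' (Th z).
    by rewrite /h' addrAC subrr add0r Th'K.
  split.
  - by rewrite /U/= e'; apply: le_trans (nS' _ Wz) Wz.
  - by rewrite /h e' SS'// ThK.
  - apply: analytic_at_add; first exact: analytic_at_cst.
    apply: (analytic_at_comp (f := S' \o Th) _ (analytic_at_linear _ bTh')).
    by apply: analytic_at_comp (analytic_at_linear _ bTh) _; apply: anS'.
have /= := atlas_comp_local Mc oU oW Uc hs ht.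
set kappa := Chart _ _ _ => -[Mk codk].
pose Z x := Th (fwd c x - fwd c p).
have locE x : Th (fwd kappa x) = S (Z x) by rewrite /= /h Th'K.
have Zf x : dom c x -> Z (f x) = ft (Z x).
  move=> cx; rewrite /ft /Z ThK [fwd c p + _]addrC subrK /fc /=.
  by rewrite (chart_fwdK hc cx).
have QS z : unorm z <= s -> S z - J (P (S z)) = z - J (P z) - phi (P z).
  by move=> zs; rewrite PS// /S; abel.
have S0 : S 0 = 0 by rewrite /S (linear_fun0 lP) phi0 subr0.
have Z0 : Z p = 0 by rewrite /Z subrr (linear_fun0 lTh).
have con x : dom kappa x -> dom kappa (f x) ->
    unorm (P (Th (fwd kappa (f x)))) <= a1 * unorm (Th (fwd kappa x)).
  move=> [cx Ux] [cfx Ufx]; rewrite !locE PS// Zf//.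
  apply: le_trans (Hcon _ Ux) _; rewrite ler_wpM2l ?(ltW a10)//.
  rewrite -[in leLHS](S'S _ Ux); apply: nS'.
  exact: le_trans (nS _ Ux) Ux.
exists s, kappa; split; split => //.
- by split => //; rewrite /U/= subrr (linear_fun0 lTh) (un0 uE) ltW.
- by rewrite /= /h -/(Z p) Z0 S0 (linear_fun0 lTh').
(* Since [phi] has zero differential at 0, the shear is tangent to the identity: the new chart gives
   tangent vectors at [p] the same coordinates as [c]. *)
- have dS : is_differential S 0 id.
    apply/is_differentialP; split; first exact: bounded_linear_id.
    move=> e1 e10; have dphiP : is_differential (phi \o P) 0 ((fun=> 0) \o P).
      apply: (is_differential_comp (is_differential_linear 0 bP)).
      by rewrite (linear_fun0 lP).
    have /is_differentialP[_ /(_ e1 e10)[d d0 hd]] := dphiP.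
    exists d => // y yd; have := hd y yd; rewrite /= add0r S0 (linear_fun0 lP) phi0 !subr0.
    by rewrite /S addrAC subrr add0r (unN uE).
  have dh : is_differential h (fwd c p) id.
    have d2 : is_differential (fun y => Th (y - fwd c p)) (fwd c p) Th.
      apply/is_differentialP; split => // e1 e10; exists 1 => // y _.
      rewrite -(linear_funB lTh) -(linear_funB lTh) (_ : _ - _ - _ = 0); last by abel.
      by rewrite (linear_fun0 lTh) (un0 uE) mulr_ge0// ltW.
    have d3 : is_differential (S \o fun y => Th (y - fwd c p)) (fwd c p) (id \o Th).
      by apply: (is_differential_comp d2); rewrite subrr (linear_fun0 lTh).
    have d4 := is_differential_comp d3 (is_differential_linear _ bTh').
    rewrite (_ : id = Th' \o (id \o Th)) //; apply/funext => y /=.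
    by rewrite ThK.
  apply: is_differential_near dh.
  by apply: filterS (cod_nbhs hc (cod_fwd cp)) => y cy /=; rewrite (chart_bwdK hc cy).
- move=> x kx; have [cx Ux] := kx; rewrite !locE => h0.
  set u := P (Z x).
  have sig0 : Z x = J u + phi u.
    apply/subr0_eq; have := QS _ Ux; rewrite -h0 subrr => /esym.
    by rewrite opprD addrA.
  have us : unorm u <= s := Pus _ Ux.
  have fZ : Z (f x) - J (P (Z (f x))) - phi (P (Z (f x))) = 0.
    by rewrite Zf// sig0; apply: Hinv.
  have PZ : unorm (P (Z (f x))) <= s.
    rewrite Zf//; apply: le_trans (Hcon _ Ux) _; apply: le_trans Ux.
    by rewrite ler_piMl.
  have cfx : dom c (f x).
    have [] := he (Z x); first by apply: le_lt_trans Ux _; apply: le_lt_trans re.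
    by rewrite /Z ThK [fwd c p + _]addrC subrK (chart_fwdK hc cx).
  have Ufx : U (fwd c (f x)).
    rewrite /U/= -/(Z (f x)) (_ : Z (f x) = J (P (Z (f x))) + phi (P (Z (f x)))).
      apply: (unD_le uE); first by rewrite nJ.
      by have [_ h2] := Hphi _ PZ; apply: le_trans h2 PZ.
    by apply/subr0_eq; rewrite opprD addrA.
  split; first by split.
  by apply/subr0_eq; rewrite QS.
- move=> x [cx Ux] [cfx Ufx]; rewrite !locE !QS// Zf//; apply: Hexp.
  exact: Ux.
Qed.

End straightening.

Section gluing.
Context {R : realType} {K : ultraFieldType R} {F : ultraBanachType K}.
Context {Y I : Type} (e : I -> chart Y F).
Hypothesis eK : forall i x, dom (e i) x -> bwd (e i) (fwd (e i) x) = x.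
Hypothesis ecov : forall x, exists i, dom (e i) x.
Hypothesis enear : forall i j x, dom (e i) x -> dom (e j) x ->
  \forall u \near fwd (e i) x, cod (e i) u /\ dom (e j) (bwd (e i) u).
Hypothesis ean : forall i j x, dom (e i) x -> dom (e j) x ->
  analytic_at (fwd (e i) x) (fwd (e j) \o bwd (e i)).

Let eKV i u : cod (e i) u -> fwd (e i) (bwd (e i) u) = u.
Proof. by move=> [x xi <-]; rewrite eK. Qed.

Let ebwd i u : cod (e i) u -> dom (e i) (bwd (e i) u).
Proof. by move=> [x xi <-]; rewrite eK. Qed.

(** [enear] says that overlaps of domains are open in each chart, before any topology on [Y] exists;
    with it, this family makes all domains open. *)
Definition glue_opens : set (set Y) :=
  [set A | forall i, open (fwd (e i) @` (dom (e i) `&` A))].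

Let glueP A : glue_opens A <-> forall i x, dom (e i) x -> A x ->
  \forall u \near fwd (e i) x, A (bwd (e i) u).
Proof.
split=> [h i x ix Ax|h i].
  have := open_nbhs_nbhs (conj (h i) (ex_intro2 _ _ x (conj ix Ax) erefl)).
  by apply: filterS => u [y [iy Ay] <-]; rewrite eK.
rewrite openE => _ [x [ix Ax] <-].
apply: filterS2 (enear ix ix) (h i x ix Ax) => u [iu du] Au.
by exists (bwd (e i) u); [|exact: eKV].
Qed.

Let glue_opensT : glue_opens setT.
Proof. by apply/glueP => i x ix _; apply: filterS (enear ix ix). Qed.

Let glue_opensI : setI_closed glue_opens.
Proof.
move=> A B /glueP hA /glueP hB; apply/glueP => i x ix [Ax Bx].
exact: filterI (hA i x ix Ax) (hB i x ix Bx).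
Qed.

Let glue_opens_bigcup (C : set (set Y)) : C `<=` glue_opens ->
  glue_opens (\bigcup_(A in C) A).
Proof.
move=> CO; apply/glueP => i x ix [A CA Ax].
have /glueP/(_ i x ix Ax) := CO A CA.
by apply: filterS => u Au; exists A.
Qed.

Definition glue_topology : topology_on Y :=
  TopologyOn glue_opensT glue_opensI glue_opens_bigcup.

Lemma glue_homeo i : is_homeo_chart (e i : chart (tspace glue_topology) F).
Proof.
have odom j : open (dom (e j) : set (tspace glue_topology)).
  apply/glueP => k x kx jx; apply: filterS (enear kx jx).
  by move=> u [].
have ocod : open (cod (e i)).
  by rewrite openE => _ [x ix <-]; apply: filterS (enear ix ix) => u [].
split => //.
- exact: eK.
- rewrite continuous_open_subspace// => x; rewrite inE => ix A.
  move=> /nbhs_open[U [oU Ux] UA].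
  have oB : open ([set y | dom (e i) y /\ U (fwd (e i) y)] : set (tspace glue_topology)).
    apply/glueP => j y jy [iy Uy].
    have h := analytic_at_continuous (ean jy iy).
    have : nbhs ((fwd (e i) \o bwd (e j)) (fwd (e j) y)) U.
      by rewrite /= eK//; apply: open_nbhs_nbhs.
    by move=> /h; apply: filterS2 (enear jy iy) => u [].
  have := open_nbhs_nbhs (conj oB (conj ix Ux)); apply: filterS => y [_ /UA].
  by [].
- rewrite continuous_open_subspace// => u; rewrite inE => iu A.
  move=> /nbhs_open[B [oB Bu] BA].
  have /glueP/(_ i _ (ebwd iu) Bu) := oB.
  by rewrite eKV//; apply: filterS => v /BA.
Qed.

(** Glued spaces may fail to be Hausdorff; here the property is pulled back along the injection
    [iota], continuous because it is so in every chart. *)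
Lemma glue_manifold (T : topologicalType) (iota : Y -> T) :
  hausdorff_space T -> injective iota ->
  (forall i x, dom (e i) x -> {for fwd (e i) x, continuous (iota \o bwd (e i))}) ->
  exists N : manifold F Y, forall i, atlas N (e i).
Proof.
move=> hT injI cI.
have ci : continuous (iota : tspace glue_topology -> T).
  apply/continuousP => B oB; apply/glueP => i x ix Bx.
  have : nbhs ((iota \o bwd (e i)) (fwd (e i) x)) B.
    by rewrite /= eK//; apply: open_nbhs_nbhs.
  exact: (cI i x ix).
have hY : hausdorff_space (tspace glue_topology).
  move=> x y xy; apply: injI; apply: hT => A B Ax By.
  have [z [Az Bz]] := xy _ _ (ci x A Ax) (ci y B By).
  by exists (iota z).
(* The maximal atlas consists of all charts compatible with the given ones; any two of its members
   are compatible through a given chart around each point. *)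
pose at_ : set (chart Y F) := [set c |
  is_homeo_chart (c : chart (tspace glue_topology) F) /\
  forall i x, dom c x -> dom (e i) x ->
    analytic_at (fwd c x) (fwd (e i) \o bwd c) /\ analytic_at (fwd (e i) x) (fwd c \o bwd (e i))].
have at_e i : at_ (e i).
  split; first exact: glue_homeo.
  by move=> j x ix jx; split; apply: ean.
have comp c d : at_ c -> at_ d -> transition_analytic c d.
  move=> [hc ac] [hd ad].
  apply/(@transition_analyticP _ _ _ (tspace glue_topology)) => // x cx dx.
  have [i ix] := ecov x.
  apply: (@analytic_at_transition_trans _ _ _ (tspace glue_topology) c (e i) d x hc (glue_homeo i)) => //.
    by have [] := ac i x cx ix.
  by have [] := ad i x dx ix.
have cov x : exists2 c, at_ c & dom c x by have [i ix] := ecov x; exists (e i).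
have comp2 c d : at_ c -> at_ d -> compatible c d by move=> hc hd; split; apply: comp.
have hom c : at_ c -> is_homeo_chart (c : chart (tspace glue_topology) F) by case.
have mx c : is_homeo_chart (c : chart (tspace glue_topology) F) ->
    (forall d, at_ d -> compatible c d) -> at_ c.
  move=> hc cd; split => // i x cx ix; have [h1 h2] := cd _ (at_e i).
  split.
    by move/(@transition_analyticP _ _ _ (tspace glue_topology) _ _ hc (glue_homeo i)) : h1; apply.
  by move/(@transition_analyticP _ _ _ (tspace glue_topology) _ _ (glue_homeo i) hc) : h2; apply.
by exists (Manifold hY hom cov comp2 mx).
Qed.

End gluing.

(** * The stable manifold *)

Lemma null_from (R : realType) (c d : nat -> R) n :
  (forall k, (n <= k)%N -> d k <= c k) -> null c -> null d.
Proof.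
move=> dc nc e /nc[N hN]; exists (maxn n N) => k; rewrite geq_max => /andP[nk Nk].
exact: le_lt_trans (dc k nk) (hN k Nk).
Qed.

Lemma unorm_defines_topology (R : realType) (K : ultraFieldType R) (E : ultraBanachType K) :
  norm_defines_topology (topology_of E) (@unorm R K E).
Proof. by move=> A; exact: (open_unorm A). Qed.

Lemma cvg_eventually (T : topologicalType) (u : nat -> T) (x : T) :
  u @ \oo --> x <-> forall A, nbhs x A -> exists N, forall k, (N <= k)%N -> A (u k).
Proof.
split=> [h A /h[N _ hN]|h A /h[N hN]]; first by exists N => k /hN.
by exists N => // k /= /hN.
Qed.

Lemma man_at_chart (R : realType) (K : ultraFieldType R) (E F : ultraBanachType K)
    (X Y : Type) (M : manifold E X) (N : manifold F Y) (f : M -> N) (x : M)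
    (c : chart X E) (d : chart Y F) :
  atlas M c -> atlas N d -> dom c x -> (\forall y \near x, dom d (f y)) ->
  analytic_at (fwd c x) (fwd d \o f \o bwd c) -> man_at f x.
Proof.
move=> Mc Nd cx ndx ax; have dx := nbhs_singleton ndx.
have hc := atlas_homeo Mc; have hd := atlas_homeo Nd.
split; last by exists c, d.
have e : \forall y \near x, f y = (bwd d \o (fwd d \o f \o bwd c) \o fwd c) y.
  apply: filterS2 (dom_nbhs hc cx) ndx => y cy dy /=.
  by rewrite (chart_fwdK hc cy) (chart_fwdK hd dy).
have cont : {for x, continuous ((bwd d \o (fwd d \o f \o bwd c) \o fwd c : X -> Y) : M -> N)}.
  apply: continuous_comp; first exact: (chart_fwd_continuous hc cx).
  apply: continuous_comp; first exact: (analytic_at_continuous ax).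
  by rewrite /= (chart_fwdK hc cx); exact: (chart_bwd_continuous hd (cod_fwd dx)).
move=> A Ax; have := cont A; rewrite /= (chart_fwdK hc cx) (chart_fwdK hd dx) => /(_ Ax).
by apply: filterS2 e => z /= ->.
Qed.

Lemma tspace_continuous (T : topologicalType) (h : T -> T) : continuous h ->
  continuous (h : tspace (topology_of T) -> tspace (topology_of T)).
Proof.
by move=> /continuousP ch; apply/continuousP => A oA; apply: (ch A oA).
Qed.

Section stable_manifold.
Context {R : realType} {K : ultraFieldType R} {E V F : ultraBanachType K}.
Context {X : Type} {M : manifold E X}.
Local Notation uE := (@unorm_ultrametric _ _ _).
Variables (f g : M -> M) (p : M) (kappa : chart X E).
Variables (Th : E -> V) (Th' : V -> E) (J : F -> V) (P : V -> F).
Variables (s a1 a b : R).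
Hypotheses (mf : forall x, man_at f x) (mg : forall x, man_at g x).
Hypotheses (fg : cancel f g) (gf : cancel g f).
Hypotheses (Mk : atlas M kappa) (kp : dom kappa p) (k0 : fwd kappa p = 0).
Hypothesis codk : cod kappa = [set y | unorm (Th y) <= s].
Hypotheses (bTh : bounded_linear Th) (bTh' : bounded_linear Th').
Hypotheses (ThK : cancel Th Th') (Th'K : cancel Th' Th).
Hypotheses (lJ : linear J) (lP : linear P).
Hypotheses (PJ : forall u, P (J u) = u) (nJ : forall u, unorm (J u) = unorm u).
Hypothesis nP : forall x, unorm (P x) <= unorm x.
Hypotheses (s0 : 0 < s) (a10 : 0 < a1) (a1a : a1 < a) (a1' : a <= 1).
Hypotheses (b0 : 0 < b) (ab : a * b < 1).

Definition loc x := Th (fwd kappa x).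

Hypothesis H2 : forall x, dom kappa x -> loc x = J (P (loc x)) ->
  dom kappa (f x) /\ loc (f x) = J (P (loc (f x))).
Hypothesis H3 : forall x, dom kappa x -> dom kappa (f x) ->
  unorm (P (loc (f x))) <= a1 * unorm (loc x).
Hypothesis H4 : forall x, dom kappa x -> dom kappa (f x) ->
  unorm (loc x - J (P (loc x))) <= b * unorm (loc (f x) - J (P (loc (f x)))).

Let hk : is_homeo_chart (kappa : chart M E) := atlas_homeo Mk.
Let lTh : linear Th. Proof. by have [] := bTh. Qed.
Let lTh' : linear Th'. Proof. by have [] := bTh'. Qed.
Let a0 : 0 < a. Proof. exact: lt_trans a1a. Qed.
Let a11 : a1 < 1. Proof. exact: lt_le_trans a1a a1'. Qed.
Let a11' : 0 <= a1 < 1. Proof. by rewrite a11 ltW. Qed.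

Definition loc_inv z : X := bwd kappa (Th' z).

Definition local_stable : set X := [set x | dom kappa x /\ loc x = J (P (loc x))].

Lemma locK x : dom kappa x -> loc_inv (loc x) = x.
Proof. by move=> kx; rewrite /loc_inv /loc ThK (chart_fwdK hk kx). Qed.

Lemma loc_le x : dom kappa x -> unorm (loc x) <= s.
Proof. by move=> kx; have := cod_fwd kx; rewrite codk. Qed.

Lemma loc_invP z : unorm z <= s -> dom kappa (loc_inv z) /\ loc (loc_inv z) = z.
Proof.
move=> zs; have cz : cod kappa (Th' z) by rewrite codk /= Th'K.
by split; [exact: (dom_bwd hk cz)|rewrite /loc (chart_bwdK hk cz) Th'K].
Qed.

Lemma locp : loc p = 0.
Proof. by rewrite /loc k0 (linear_fun0 lTh). Qed.

Lemma local_stable_p : local_stable p.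
Proof. by split => //; rewrite locp (linear_fun0 lP) (linear_fun0 lJ). Qed.

Lemma local_stable_inv u : unorm u <= s -> local_stable (loc_inv (J u)) /\ loc (loc_inv (J u)) = J u.
Proof.
move=> us; have [d l] := loc_invP (eq_ind_r (fun t => t <= s) us (nJ u)).
by split => //; split => //; rewrite l PJ.
Qed.

Lemma local_stable_norm x : local_stable x -> unorm (loc x) = unorm (P (loc x)).
Proof. by move=> [_ h]; rewrite {1}h nJ. Qed.

Lemma local_stable_f x : local_stable x -> local_stable (f x) /\ unorm (loc (f x)) <= a1 * unorm (loc x).
Proof.
move=> [kx hx]; have G : local_stable (f x) by apply: H2.
by split => //; rewrite local_stable_norm//; apply: H3 => //; case: G.
Qed.

Lemma local_stable_fixed : f p = p.
Proof.
have [[kfp _]] := local_stable_f local_stable_p; rewrite locp (un0 uE) mulr0 => l0.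
have {l0} : loc (f p) = 0 by apply/(un_eq0 uE)/le_anti; rewrite l0 unorm_ge0.
by rewrite -locp => e; rewrite -(locK kfp) e locK.
Qed.

Lemma local_stable_iter x n : local_stable x ->
  local_stable (iter n f x) /\ unorm (loc (iter n f x)) <= a1 ^+ n * unorm (loc x).
Proof.
move=> Gx; elim: n => [|n [IH1 IH2]] /=; first by rewrite mul1r.
have [h1 h2] := local_stable_f IH1; split => //; apply: le_trans h2 _.
by rewrite exprS -mulrA ler_wpM2l// ltW.
Qed.

Lemma local_stable_back x : dom kappa x -> local_stable (f x) -> local_stable x.
Proof.
move=> kx [kfx hfx]; split => //; have := H4 kx kfx.
rewrite -hfx subrr (un0 uE) mulr0 => h.
by apply/subr0_eq/(un_eq0 uE)/le_anti; rewrite h unorm_ge0.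
Qed.

(** The unstable component [q] grows at least by 1/b per step, so q(x) <= b^n q(f^n x); as [q] is
    dominated by the norm of [loc], the right side tends to 0. *)
Lemma local_stable_of_orbit x : (forall n, dom kappa (iter n f x)) ->
  null (fun n => b ^+ n * unorm (loc (iter n f x))) -> local_stable x.
Proof.
move=> kx nx; split; first exact: (kx 0%N).
pose q y := unorm (loc y - J (P (loc y))).
have qn n : q x <= b ^+ n * q (iter n f x).
  elim: n => [|n IH]; first by rewrite mul1r.
  apply: le_trans IH _; rewrite exprSr -mulrA ler_wpM2l ?exprn_ge0 ?(ltW b0)//.
  exact: (H4 (kx n) (kx n.+1)).
apply/subr0_eq/(un_small0 uE) => e /nx[N /(_ N (leqnn N)) hN].
apply: le_trans (qn N) _; apply: le_trans (ltW hN); rewrite ler_wpM2l ?exprn_ge0 ?(ltW b0)//.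
by apply: (unB_le uE) => //; rewrite nJ.
Qed.

Lemma orbit_cvg x n : local_stable (iter n f x) ->
  forall A, nbhs p A -> exists N, forall k, (N <= k)%N -> A (iter k f x).
Proof.
move=> Gx A pA.
have [_ [C C0 hC]] := bTh'.
have [e e0 he] : exists2 e : R, 0 < e & forall y, unorm y < e -> A (bwd kappa y).
  have := near_bwd hk kp pA; rewrite k0 => /nbhs_unorm[e e0 he].
  by exists e => // y ye; have [|_ _] := he y; rewrite ?subr0.
have [N hN] := null_geometric (C * s) a11' e0.
exists (n + N)%N => k nNk.
have nk : (n <= k)%N by apply: leq_trans nNk; apply: leq_addr.
have [Gk lk] := local_stable_iter (k - n) Gx.
rewrite -iterD subnK// in Gk lk; have [kk _] := Gk.
rewrite -(chart_fwdK hk kk); apply: he; rewrite -[fwd kappa _]ThK.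
apply: le_lt_trans (hC _) _.
apply: (@le_lt_trans _ _ (C * s * a1 ^+ (k - n))); last first.
  by apply: hN; rewrite leq_subRL.
rewrite -mulrA ler_wpM2l//; apply: le_trans lk _; rewrite mulrC ler_wpM2r//.
  by rewrite exprn_ge0// ltW.
by apply: loc_le; case: Gx.
Qed.

Lemma stable_of_local_stable x n : local_stable (iter n f x) -> stable_set a f p x.
Proof.
move=> Gx; split; first by apply/cvg_eventually; exact: (orbit_cvg Gx).
exists kappa, unorm; split => //; first exact: unorm_ultrametric.
  exact: unorm_defines_topology.
have [_ [C C0 hC]] := bTh'.
have ak k : 0 <= a ^- k by rewrite invr_ge0 exprn_ge0// ltW.
apply/null_cvg => [k|]; first by rewrite mulr_ge0.
have ra : 0 <= a1 / a < 1 by rewrite divr_ge0 ?(ltW a10) ?(ltW a0)//= ltr_pdivrMr// mul1r.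
apply: (null_from (n := n) _ (null_geometric (C * s * a1 ^- n) ra)) => k nk.
have [Gk lk] := local_stable_iter (k - n) Gx.
rewrite -iterD subnK// in Gk lk.
rewrite -[fwd kappa _]ThK; apply: le_trans (ler_wpM2l (ak k) (hC _)) _.
have lk' : unorm (loc (iter k f x)) <= a1 ^+ (k - n) * s.
  apply: le_trans lk _; rewrite ler_wpM2l ?exprn_ge0 ?(ltW a10)//.
  by apply: loc_le; case: Gx.
apply: le_trans (ler_wpM2l (ak k) (ler_wpM2l C0 lk')) _.
have -> : a1 ^+ (k - n) = a1 ^- n * a1 ^+ k.
  by rewrite -{2}(subnKC nk) exprD mulKf// expf_neq0// gt_eqF.
rewrite expr_div_n le_eqVlt; apply/orP; left; apply/eqP.
set u := a ^- k; set v := a1 ^- n; set w := a1 ^+ k; ring.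
Qed.

Lemma local_stable_of_stable x : stable_set a f p x -> exists n, local_stable (iter n f x).
Proof.
move=> [/cvg_eventually xp [c [n [Mc [cp c0] hn nt /null_cvg nl]]]].
have hc := atlas_homeo Mc.
have ak k : 0 < a ^- k by rewrite invr_gt0 exprn_gt0.
have {}nl := nl (fun k => mulr_ge0 (ltW (ak k)) (un_ge0 hn _)).
(* The chart [c] and the norm [n] come from the definition of the stable set; equivalence of norms
   and a Lipschitz bound for the transition [q] translate the decay to [kappa] and [V]. *)
have [D D0 hD] := norm_equiv (uE) hn (@unorm_defines_topology _ _ E) nt.
pose q := Th \o (fwd kappa \o bwd c).
have aq : analytic_at 0 q.
  apply: analytic_at_comp; last exact: analytic_at_linear.
  by rewrite -c0; apply: (atlas_an Mc Mk).
have [r [C [r0 pq]]] := aq.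
have q0 : q 0 = 0 by rewrite /q/= -c0 (chart_fwdK hc cp) -/(loc p) locp.
have qL y : unorm y <= r -> unorm (q y) <= C / r * unorm y.
  move=> yr; have := ps_lip r0 pq yr (y := 0); rewrite (un0 uE) => /(_ (ltW r0)).
  by rewrite !add0r q0 !subr0.
have : nbhs p [set y | [/\ dom c y, dom kappa y & unorm (fwd c y) <= r]].
  have n3 : nbhs p (fwd c @^-1` [set y | unorm y <= r]).
    apply: (chart_fwd_continuous hc cp); rewrite c0.
    by apply: open_nbhs_nbhs; split; [exact: open_closed_ball|rewrite /= (un0 uE) ltW].
  by apply: filterS3 (dom_nbhs hc cp) (dom_nbhs hk kp) n3.
move=> /xp[N hN]; exists N.
(* The weights [b ^+ k] required by [local_stable_of_orbit] are thus dominated by the weights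
   [a ^- k] of the stable set. *)
have cb : b <= a^-1 by rewrite -[a^-1]mul1r ler_pdivlMr// mulrC ltW.
apply: local_stable_of_orbit => [k|].
  by rewrite -iterD; have [] := hN (k + N)%N (leq_addl _ _).
have Cr : 0 <= C / r by rewrite divr_ge0 ?(ps_ge0 pq)// ltW.
have nc : null (fun k => a ^- (k + N) * n (fwd c (iter (k + N) f x))).
  move=> e /nl[N' hN']; exists N' => k Nk; apply: hN'.
  by apply: leq_trans Nk _; apply: leq_addr.
have := nullM (C / r * D * a ^+ N) (fun k => mulr_ge0 (ltW (ak _)) (un_ge0 hn _)) nc.
apply: null_le => k; rewrite -iterD.
have [cx kx xr] := hN (k + N)%N (leq_addl _ _).
have lq : loc (iter (k + N) f x) = q (fwd c (iter (k + N) f x)).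
  by rewrite /q/= (chart_fwdK hc cx).
have l1 : unorm (loc (iter (k + N) f x)) <= C / r * (D * n (fwd c (iter (k + N) f x))).
  by rewrite lq; apply: le_trans (qL _ xr) _; rewrite ler_wpM2l.
have bk : b ^+ k <= a ^- k.
  by rewrite -exprVn lerXn2r// nnegrE ?invr_ge0 ltW.
apply: (@le_trans _ _ (a ^- k * (C / r * (D * n (fwd c (iter (k + N) f x)))))).
  by apply: ler_pM => //; rewrite exprn_ge0// ltW.
rewrite le_eqVlt; apply/orP; left; apply/eqP.
have -> : a ^- k = a ^+ N * a ^- (k + N).
  by rewrite exprD invfM mulrCA mulfV ?mulr1// expf_neq0// gt_eqF.
by ring.
Qed.

Lemma stableP x : stable_set a f p x <-> exists n, local_stable (iter n f x).
Proof. by split=> [|[n]]; [exact: local_stable_of_stable|exact: stable_of_local_stable]. Qed.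

Local Notation W := (stable_set a f p).

Lemma stable_p : W p. Proof. exact: (@stable_of_local_stable p 0%N local_stable_p). Qed.

Lemma iterK n : cancel (iter n f) (iter n g).
Proof. by move=> x; elim: n => //= n IH; rewrite -iterS iterSr fg. Qed.

Lemma iterKV n : cancel (iter n g) (iter n f).
Proof. by move=> x; elim: n => //= n IH; rewrite -iterS iterSr gf. Qed.

Lemma stable_f x : W x <-> W (f x).
Proof.
rewrite !stableP; split=> [[n h]|[n h]]; last by exists n.+1; rewrite iterSr.
by exists n; rewrite -iterSr iterS; have [] := local_stable_f h.
Qed.

Lemma stable_g x : W x -> W (g x).
Proof. by move=> Wx; apply/stable_f; rewrite gf. Qed.

(** Makes the inverse charts total; the value [p] off the stable set is a placeholder. *)
Definition stable_pt (x : X) : W :=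
  if pselect (W x) is left h then exist _ x (mem_set h)
  else exist _ (p : X) (mem_set stable_p).

Lemma stable_ptK x : W x -> val (stable_pt x) = x.
Proof. by rewrite /stable_pt; case: pselect. Qed.

Lemma stable_val (x : W) : W (val x).
Proof. exact: set_valP. Qed.

(** The domains increase with n and exhaust the stable set, while all images are the same closed
    ball of [F]. *)
Definition schart (n : nat) : chart W F := Chart
  [set x : W | local_stable (iter n f (val x))]
  (fun x => P (loc (iter n f (val x))))
  (fun u => stable_pt (iter n g (loc_inv (J u)))).

Lemma schart_bwd n u : unorm u <= s ->
  val (bwd (schart n) u) = iter n g (loc_inv (J u)).
Proof.
move=> us /=; apply: stable_ptK; apply/stableP; exists n; rewrite iterKV.
by have [] := local_stable_inv us.
Qed.

Lemma schartK n x : dom (schart n) x -> bwd (schart n) (fwd (schart n) x) = x.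
Proof.
move=> [kx hx]; apply/val_inj; rewrite schart_bwd /= -?hx.
  by rewrite locK// iterK.
by apply: le_trans (nP _) _; apply: loc_le.
Qed.

Lemma schart_cod n : cod (schart n) = [set u | unorm u <= s].
Proof.
apply/seteqP; split=> [_ [x [kx hx] <-] /=|u us].
  by apply: le_trans (nP _) _; apply: loc_le.
have [Gu lu] := local_stable_inv us; exists (bwd (schart n) u).
  by rewrite /= -/(bwd (schart n) u) schart_bwd// iterKV.
by rewrite /fwd/= -/(bwd (schart n) u) schart_bwd// iterKV lu PJ.
Qed.

Lemma schart_le n x : dom (schart n) x -> unorm (fwd (schart n) x) <= s.
Proof. by move=> nx; have := cod_fwd nx; rewrite schart_cod. Qed.

Lemma schart_mono n m x : (n <= m)%N -> dom (schart n) x -> dom (schart m) x.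
Proof.
by move=> nm h; rewrite /= -(subnK nm) iterD; have [] := local_stable_iter (m - n) h.
Qed.

Lemma analytic_at_loc_inv (h : M -> M) (u : F) : (forall y, man_at h y) -> unorm u <= s ->
  dom kappa (h (loc_inv (J u))) ->
  analytic_at u (fun v => loc (h (loc_inv (J v)))).
Proof.
move=> mh us kh; have bJ : bounded_linear J by split => //; exists 1 => // v; rewrite nJ mul1r.
have [[ku _] lu] := local_stable_inv us.
have bTJ := bounded_linear_comp bJ bTh'.
apply: (@analytic_at_comp _ _ _ _ _ u (fun v => fwd kappa (h (bwd kappa (Th' (J v))))) Th);
  last exact: analytic_at_linear.
apply: (@analytic_at_comp _ _ _ _ _ u (Th' \o J) (fwd kappa \o h \o bwd kappa)).
  exact: analytic_at_linear.
have -> : (Th' \o J) u = fwd kappa (loc_inv (J u)).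
  by rewrite -[fwd kappa _]ThK -/(loc _) lu.
exact: man_at_charts.
Qed.

Lemma near_loc_inv (h : M -> M) (u : F) (A : set M) : (forall y, man_at h y) ->
  unorm u <= s -> nbhs (h (loc_inv (J u))) A ->
  \forall v \near u, A (h (loc_inv (J v))).
Proof.
move=> mh us hA; have bJ : bounded_linear J by split => //; exists 1 => // v; rewrite nJ mul1r.
have [[ku _] lu] := local_stable_inv us.
have h1 := man_at_continuous (mh (loc_inv (J u))) hA.
have h2 := near_bwd hk ku h1.
have e : fwd kappa (loc_inv (J u)) = Th' (J u).
  by rewrite -[fwd kappa _]ThK -/(loc _) lu.
rewrite e in h2.
have h3 : nbhs (u : F) [set v | [/\ cod kappa (Th' (J v)),
    dom kappa (bwd kappa (Th' (J v))) & A (h (bwd kappa (Th' (J v))))]].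
  exact: (bounded_linear_cont (bounded_linear_comp bJ bTh') h2).
by apply: filterS h3 => v [].
Qed.

Lemma near_ball u : unorm u <= s -> \forall v \near (u : F), unorm v <= s.
Proof.
by move=> us; apply: open_nbhs_nbhs; split => //; apply: open_closed_ball.
Qed.

Lemma man_at_iterfg i j (y : M) : man_at (iter j f \o iter i g) y.
Proof. by apply: man_at_comp; apply: man_at_iter. Qed.

(** For i <= j this is forward invariance of the local stable manifold. For i > j one goes back i -
    j steps: by continuity of the iterates of [g] nearby points stay in the domain of [kappa], and
    [local_stable_back] puts them on the local stable manifold, one step at a time. *)
Lemma schart_near i j x : dom (schart i) x -> dom (schart j) x ->
  \forall u \near fwd (schart i) x,
    cod (schart i) u /\ dom (schart j) (bwd (schart i) u).
Proof.
move=> ix jx; have us := schart_le ix; set u0 := fwd (schart i) x in us *.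
have xE : val x = iter i g (loc_inv (J u0)) by rewrite -schart_bwd// schartK.
suff : \forall u \near u0, unorm u <= s /\ local_stable (iter j f (iter i g (loc_inv (J u)))).
  apply: filterS => u [us' Gu]; rewrite schart_cod; split => //.
  by rewrite /dom/= -/(bwd (schart i) u) schart_bwd.
have [ij|/ltnW ji] := leqP i j.
  apply: filterS (near_ball us) => u us'; split => //.
  rewrite -(subnK ij) iterD iterKV; have [Gu _] := local_stable_inv us'.
  by have [] := local_stable_iter (j - i) Gu.
have e y : iter j f (iter i g y) = iter (i - j) g y.
  by rewrite -{1}(subnKC ji) iterD iterKV.
have G0 : local_stable (iter (i - j) g (loc_inv (J u0))) by rewrite -e -xE.
suff {ix jx xE e} : \forall u \near u0, unorm u <= s /\ local_stable (iter (i - j) g (loc_inv (J u))).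
  by apply: filterS => u; rewrite e.
clearbody u0; move: {i j ji x} (i - j)%N G0 => l; elim: l => [|l IH] G0.
  by apply: filterS (near_ball us) => u us'; split => //; have [] := local_stable_inv us'.
have Gl : local_stable (iter l g (loc_inv (J u0))).
  by have [] := local_stable_f G0; rewrite iterS gf.
have kl : nbhs (iter l.+1 g (loc_inv (J u0))) (dom (kappa : chart M E)).
  by apply: (dom_nbhs hk); case: G0.
apply: filterS2 (IH Gl) (near_loc_inv (fun y => man_at_iter l.+1 y mg) us kl).
move=> u [us' Gu] ku; split => //.
by apply: local_stable_back => //; rewrite iterS gf.
Qed.

(** The transition is computed in [M], as f^j after g^i read in [kappa], preceded by [J] and
    followed by [P]. *)
Lemma schart_an i j x : dom (schart i) x -> dom (schart j) x ->
  analytic_at (fwd (schart i) x) (fwd (schart j) \o bwd (schart i)).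
Proof.
move=> ix jx; have us := schart_le ix; set u0 := fwd (schart i) x in us *.
have xE : val x = iter i g (loc_inv (J u0)) by rewrite -schart_bwd// schartK.
apply: (@analytic_at_near _ _ _ _ _ (P \o (fun u => loc ((iter j f \o iter i g) (loc_inv (J u)))))).
  apply: filterS (near_ball us) => u us' /=.
  by rewrite -/(bwd (schart i) u) schart_bwd.
apply: analytic_at_comp; last by apply: analytic_at_linear; split => //; exists 1 => // z; rewrite mul1r.
apply: analytic_at_loc_inv => //; first exact: man_at_iterfg.
by rewrite /= -xE; case: jx.
Qed.

Lemma schart_cover (x : W) : exists n, dom (schart n) x.
Proof. by have /stableP[n h] := stable_val x; exists n. Qed.

Lemma stable_manifold_exists : exists N : manifold F W, forall n, atlas N (schart n).
Proof.
apply: (@glue_manifold _ _ F W nat schart schartK schart_cover schart_near schart_an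
  M (fun x : W => val x : M)).
- exact: manifold_hausdorff.
- by move=> x y /val_inj.
move=> i x ix; have us := schart_le ix; set u0 := fwd (schart i) x in us *.
move=> A; rewrite /= -/(bwd (schart i) u0) schart_bwd// => hA.
have := near_loc_inv (fun y => man_at_iter i y mg) us hA.
apply: filterS2 (near_ball us) => u us' /=.
by rewrite -/(bwd (schart i) u) schart_bwd.
Qed.

(** * Immersion, tangent space, restriction of f and small neighbourhoods *)

Section stable_manifold_properties.
Variable N : manifold F W.
Hypothesis hN : forall n, atlas N (schart n).

(** Between [schart n] and this chart of [M] the inclusion is the bounded linear map [Th' \o J];
    immersion and tangent space are read off from it. *)
Definition kchart n : chart X E :=
  Chart (iter n f @^-1` dom kappa) (fwd kappa \o iter n f) (iter n g \o bwd kappa).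

Lemma atlas_kchart n : atlas M (kchart n).
Proof.
by apply: (@atlas_comp_diffeo _ _ _ _ M (iter n f) (iter n g)) => //;
  [move=> x; exact: man_at_iter|move=> x; exact: man_at_iter|exact: iterK|exact: iterKV].
Qed.

Lemma fwd_loc_inv u : unorm u <= s -> fwd kappa (loc_inv (J u)) = Th' (J u).
Proof. by move=> us; rewrite -[fwd kappa _]ThK -/(loc _); have [_ ->] := local_stable_inv us. Qed.

Lemma inclusion_repr n u : unorm u <= s ->
  (fwd (kchart n) \o (inclusion : N -> M) \o bwd (schart n)) u = Th' (J u).
Proof.
move=> us; rewrite /= /inclusion -/(bwd (schart n) u) schart_bwd// iterKV.
exact: fwd_loc_inv.
Qed.

Lemma bounded_linear_TJ : bounded_linear (Th' \o J).
Proof.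
apply: bounded_linear_comp bTh'; split => //; exists 1 => // v.
by rewrite nJ mul1r.
Qed.

Lemma inclusion_differential n (x : N) : dom (schart n) x ->
  is_differential (fwd (kchart n) \o (inclusion : N -> M) \o bwd (schart n))
    (fwd (schart n) x) (Th' \o J).
Proof.
move=> nx; apply: (@is_differential_near _ _ _ _ (Th' \o J)).
  apply: filterS (near_ball (schart_le nx)) => u us.
  by rewrite inclusion_repr.
exact/is_differential_linear/bounded_linear_TJ.
Qed.

Lemma man_at_inclusion (x : N) : man_at (inclusion : N -> M) x.
Proof.
have [n nx] := schart_cover x.
apply: (man_at_chart (hN n) (atlas_kchart n) nx).
  by apply: filterS (dom_nbhs (atlas_homeo (hN n)) nx) => y [].
apply: analytic_at_near (analytic_at_linear _ bounded_linear_TJ).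
apply: filterS (near_ball (schart_le nx)) => u us.
by rewrite inclusion_repr.
Qed.

Lemma stable_immersed : immersed_submanifold M N.
Proof.
split; first by apply/analytic_mapP => x; apply: man_at_inclusion.
move=> x; have [n nx] := schart_cover x.
pose c : chart_at x := exist _ (schart n) (conj (hN n) nx).
have kx : dom (kchart n) (inclusion x : M) := proj1 nx.
pose d : chart_at (inclusion x : M) := exist _ (kchart n) (conj (atlas_kchart n) kx).
set T := tangent_map _ _ _.
have TE v : tangent_val (T v) d = Th' (J (tangent_val v c)).
  rewrite /T (tangent_mapE v c d (man_at_inclusion x) erefl).
  by rewrite (differentialE (inclusion_differential nx)).
pose A := [set w : tangent (inclusion x : M) | exists u, tangent_val w d = Th' (J u)].
have rT : range T = A.
  apply/seteqP; split=> [_ [v _ <-]|w [u hu]]; first by exists (tangent_val v c).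
  exists (tangent_of c u) => //; apply: (@tangent_inj _ _ _ _ _ _ _ _ d).
  by rewrite TE tangent_ofK.
split.
  move=> v w vw; apply: (@tangent_inj _ _ _ _ _ _ _ _ c).
  have := congr1 (fun z => P (Th (tangent_val z d))) vw.
  by rewrite /= !TE !Th'K !PJ.
rewrite rT.
(* [J \o P] transported to the tangent space: a continuous projection onto [A] whose kernel is the
   complement [B]. *)
pose Pr (w : tangent (inclusion x : M)) : tangent (inclusion x : M) :=
  tangent_of d (Th' (J (P (Th (tangent_val w d))))).
pose B := [set w : tangent (inclusion x : M) | P (Th (tangent_val w d)) = 0].
have APr w : A (Pr w) by exists (P (Th (tangent_val w d))); rewrite tangent_ofK.
have BPr w : B (w - Pr w).
  change (P (Th (tangent_val w d - tangent_val (Pr w) d)) = 0).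
  by rewrite /Pr tangent_ofK (linear_funB lTh) Th'K (linear_funB lP) PJ subrr.
exists B; split.
  split.
  - split; first by exists 0; rewrite (linear_fun0 lJ) (linear_fun0 lTh').
    move=> k v w [u hu] [u' hu']; exists (k *: u + u').
    have -> : tangent_val (k *: v + w) d = k *: tangent_val v d + tangent_val w d by [].
    by rewrite hu hu' lJ lTh'.
  - split; first by rewrite /B/= (linear_fun0 lTh) (linear_fun0 lP).
    move=> k v w Bv Bw.
    change (P (Th (tangent_val v d)) = 0) in Bv.
    change (P (Th (tangent_val w d)) = 0) in Bw.
    change (P (Th (k *: tangent_val v d + tangent_val w d)) = 0).
    by rewrite lTh lP Bv Bw scaler0 addr0.
  - apply/seteqP; split=> [v [[u hu]]|_ ->].
      rewrite /B/= hu Th'K PJ => u0; apply: (@tangent_inj _ _ _ _ _ _ _ _ d).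
      by rewrite hu u0 (linear_fun0 lJ) (linear_fun0 lTh').
    split; first by exists 0; rewrite (linear_fun0 lJ) (linear_fun0 lTh').
    by rewrite /B/= (linear_fun0 lTh) (linear_fun0 lP).
  - by move=> w; exists (Pr w).
exists Pr => //; apply: tspace_continuous => w.
have bP : bounded_linear P by split => //; exists 1 => // z; rewrite mul1r.
apply: (continuous_comp (f := fun w => tangent_val w d)
  (g := fun y => tangent_of d (Th' (J (P (Th y)))))).
  exact: tangent_val_continuous.
apply: (continuous_comp (f := (Th' \o J) \o (P \o Th)) (g := tangent_of d)).
  exact/(bounded_linear_cont (bounded_linear_comp (bounded_linear_comp bTh bP) bounded_linear_TJ)).
exact: tangent_of_continuous.
Qed.

Lemma schart0_p (x : W) : val x = p -> dom (schart 0) x.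
Proof. by move=> xp; change (local_stable (val x)); rewrite xp; exact: local_stable_p. Qed.

Lemma stable_tangent : tangent_subspace N p =
  [set v | exists u, tangent_val v (exist _ kappa (conj Mk kp) : chart_at p) = Th' (J u)].
Proof.
set d : chart_at p := exist _ _ _.
have px (x : N) : inclusion x = p -> dom (schart 0) x.
  exact: schart0_p.
have TE (x : N) (xp : inclusion x = p) (v : tangent x) :
    tangent_val (tangent_map (inclusion : N -> M) x p v) d =
    Th' (J (tangent_val v (exist _ (schart 0) (conj (hN 0) (px x xp)) : chart_at x))).
  rewrite (tangent_mapE v (exist _ (schart 0) (conj (hN 0) (px x xp))) d (man_at_inclusion x) xp).
  rewrite (differentialE (L := Th' \o J))//.
  exact: (inclusion_differential (px x xp)).
apply/seteqP; split=> [v [x xp [w <-]]|v [u hu]].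
  by rewrite /= TE; eexists.
have xp : inclusion (stable_pt p : N) = p :> M by rewrite /inclusion stable_ptK//; exact: stable_p.
exists (stable_pt p) => //.
pose c : chart_at (stable_pt p : N) := exist _ (schart 0) (conj (hN 0) (px _ xp)).
exists (tangent_of c u); apply: (@tangent_inj _ _ _ _ _ _ _ _ d).
by rewrite TE tangent_ofK hu.
Qed.

Definition stable_f_map (x : N) : N := stable_pt (f (val x)).
Definition stable_g_map (x : N) : N := stable_pt (g (val x)).

Lemma stable_f_mapE (x : N) : val (stable_f_map x) = f (val x).
Proof. exact: (stable_ptK (proj1 (stable_f _) (stable_val x))). Qed.

Lemma stable_g_mapE (x : N) : val (stable_g_map x) = g (val x).
Proof. by apply: stable_ptK; apply: stable_g; exact: stable_val. Qed.

(** From the chart n + 1 to the chart n the map is the identity in coordinates, because both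
    coordinates are read at the same point f^(n+1)(x). *)
Lemma man_at_stable_f x : man_at stable_f_map x.
Proof.
have [n nx] := schart_cover x; have nx1 := schart_mono (leqnSn n) nx.
apply: (man_at_chart (hN n.+1) (hN n) nx1).
  apply: filterS (dom_nbhs (atlas_homeo (hN n.+1)) nx1) => y ny.
  by rewrite /= stable_f_mapE -iterSr.
apply: analytic_at_near (analytic_at_id _); apply: filterS (near_ball (schart_le nx1)) => u us.
have -> : (fwd (schart n) \o stable_f_map \o bwd (schart n.+1)) u =
  P (loc (iter n f (val (stable_f_map (bwd (schart n.+1) u))))) by [].
rewrite stable_f_mapE schart_bwd// -iterSr iterKV.
by have [_ ->] := local_stable_inv us; rewrite PJ.
Qed.

Lemma man_at_stable_g x : man_at stable_g_map x.
Proof.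
have [n nx] := schart_cover x; have nx1 := schart_mono (leqnSn n) nx.
apply: (man_at_chart (hN n) (hN n.+1) nx).
  apply: filterS (dom_nbhs (atlas_homeo (hN n)) nx) => y ny.
  by rewrite /dom/= stable_g_mapE -iterS iterSr gf.
apply: analytic_at_near (analytic_at_id _); apply: filterS (near_ball (schart_le nx)) => u us.
have -> : (fwd (schart n.+1) \o stable_g_map \o bwd (schart n)) u =
  P (loc (iter n.+1 f (val (stable_g_map (bwd (schart n) u))))) by [].
rewrite stable_g_mapE schart_bwd// iterSr gf iterKV.
by have [_ ->] := local_stable_inv us; rewrite PJ.
Qed.

Lemma stable_f_mapK : cancel stable_f_map stable_g_map.
Proof. by move=> x; apply/val_inj; rewrite stable_g_mapE stable_f_mapE fg. Qed.

Lemma stable_g_mapK : cancel stable_g_map stable_f_map.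
Proof. by move=> x; apply/val_inj; rewrite stable_f_mapE stable_g_mapE gf. Qed.

Lemma stable_diffeo : restricts_to_diffeo N f.
Proof.
exists stable_f_map; last by move=> x; exact: stable_f_mapE.
split; first by apply/analytic_mapP; exact: man_at_stable_f.
exists stable_g_map; split; last 2 first.
- exact: stable_f_mapK.
- exact: stable_g_mapK.
by apply/analytic_mapP; exact: man_at_stable_g.
Qed.

Lemma submanifold_local_stable d : 0 < d -> d <= s ->
  is_submanifold ([set x | local_stable x /\ unorm (loc x) <= d] : set M).
Proof.
move=> d0 ds.
have bP : bounded_linear P by split => //; exists 1 => // z; rewrite mul1r.
pose Pr := (Th' \o J) \o (P \o Th).
have bPr : bounded_linear Pr.
  exact: (bounded_linear_comp (bounded_linear_comp bTh bP) bounded_linear_TJ).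
pose A := [set y | exists u, y = Th' (J u)].
pose B := [set y | P (Th y) = 0].
exists A.
  exists B; split; last first.
    exists Pr; first exact/tspace_continuous/bounded_linear_cont.
    move=> y; split; first by exists (P (Th y)).
    by rewrite /B/= /Pr/= (linear_funB lTh) Th'K (linear_funB lP) PJ subrr.
  split.
  - split; first by exists 0; rewrite (linear_fun0 lJ) (linear_fun0 lTh').
    by move=> k _ _ [u ->] [v ->]; exists (k *: u + v); rewrite lJ lTh'.
  - split; first by rewrite /B/= (linear_fun0 lTh) (linear_fun0 lP).
    by move=> k v w Bv Bw; rewrite /B/= lTh lP Bv Bw scaler0 addr0.
  - apply/seteqP; split=> [_ [[u ->]]|_ ->].
      by rewrite /B/= Th'K PJ => ->; rewrite (linear_fun0 lJ) (linear_fun0 lTh').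
    split; first by exists 0; rewrite (linear_fun0 lJ) (linear_fun0 lTh').
    by rewrite /B/= (linear_fun0 lTh) (linear_fun0 lP).
  - move=> y; exists (Pr y); first by exists (P (Th y)).
    by rewrite /B/= /Pr/= (linear_funB lTh) Th'K (linear_funB lP) PJ subrr.
move=> x [[kx hx] lx].
(* [kappa] must be restricted to this ball: in [kappa] itself the set is only a smaller ball of the
   subspace, not its whole trace on the codomain. *)
pose U := [set y | unorm (Th y) <= d].
have oU : open U := open_an_ball d0 (fun y => analytic_at_linear y bTh).
have Uk : U `<=` cod kappa by rewrite codk => y; move=> /le_trans; apply.
have hid y : U y -> [/\ U (id y), id (id y) = y & analytic_at y id].
  by move=> Uy; split => //; exact: analytic_at_id.
have /= := atlas_comp_local Mk oU oU Uk hid hid.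
set c := Chart _ _ _ => -[Mc codc].
exists c; split => //.
rewrite codc; apply/seteqP; split=> [_ [y [[[ky hy] ly] cy] <-]|y [[u yu] Uy]].
  split; last exact: ly.
  by exists (P (loc y)); rewrite -hy /loc ThK.
have us : unorm u <= s by rewrite -nJ -[J u]Th'K -yu; exact: le_trans ds.
have [Gu lu] := local_stable_inv us.
have yd : unorm (loc (loc_inv (J u))) <= d by rewrite lu -[J u]Th'K -yu.
exists (loc_inv (J u)); last by rewrite /= fwd_loc_inv.
by split => //; split; [case: Gu|exact: yd].
Qed.

(** Omega is a closed ball of the local stable manifold, open because the norm is ultrametric. It is
    invariant since a1 < 1, and every orbit enters it once a1^m s drops below its radius [d]. *)
Lemma stable_neighborhood (x : N) (A : set N) : inclusion x = p -> nbhs x A ->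
  exists Omega : set N,
    [/\ open Omega /\ Omega x, Omega `<=` A,
        is_submanifold (inclusion @` Omega : set M),
        f @` (inclusion @` Omega) `<=` inclusion @` Omega
      & W = \bigcup_n (iter n f @^-1` (inclusion @` Omega))].
Proof.
move=> xp xA.
have x0 : dom (schart 0) x := schart0_p xp.
have xp' : val x = p := xp.
have fx0 : fwd (schart 0) x = 0.
  by change (P (loc (val x)) = 0); rewrite xp' locp (linear_fun0 lP).
have [e e0 he] : exists2 e : R, 0 < e &
    forall u, unorm u < e -> A (bwd (schart 0) u).
  have := near_bwd (atlas_homeo (hN 0)) x0 xA; rewrite fx0 => /nbhs_unorm[e e0 h].
  by exists e => // u ue; have [|_ _] := h u; rewrite ?subr0.
pose d := Num.min s (e / 2).
have d0 : 0 < d by rewrite /d lt_min s0 divr_gt0.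
have ds : d <= s by rewrite /d ge_min lexx.
have de : d < e.
  by rewrite /d gt_min; apply/orP; right; rewrite ltr_pdivrMr// ltr_pMr// ltr1n.
pose Om0 := [set y | local_stable y /\ unorm (loc y) <= d].
pose Om : set N := [set y | Om0 (val y)].
have iOm : (inclusion : N -> M) @` Om = Om0.
  apply/seteqP; split=> [_ [y Oy <-]//|y Oy].
  have Wy : W y by apply: (@stable_of_local_stable y 0%N); case: Oy.
  by exists (stable_pt y); rewrite /Om/= /inclusion stable_ptK.
exists Om; split.
- split; last by rewrite /Om/= /Om0/= xp'; split; [exact: local_stable_p|rewrite locp (un0 uE) ltW].
  rewrite openE => y [Gy ly].
  have y0 : dom (schart 0) y by [].
  have h : nbhs y (fwd (schart 0) @^-1` [set u | unorm u <= d]).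
    apply: (chart_fwd_continuous (atlas_homeo (hN 0)) y0).
    apply: open_nbhs_nbhs; split; first exact: open_closed_ball.
    exact: le_trans (nP _) ly.
  apply: filterS2 (dom_nbhs (atlas_homeo (hN 0)) y0) h => z Gz lz.
  by split => //; rewrite (local_stable_norm Gz).
- move=> y [Gy ly]; have y0 : dom (schart 0) y by [].
  rewrite -(schartK y0); apply: he; apply: le_lt_trans (nP _) _.
  exact: le_lt_trans ly de.
- by rewrite iOm; exact: submanifold_local_stable.
- rewrite iOm => _ [y [Gy ly] <-]; have [Gfy lfy] := local_stable_f Gy.
  split => //; apply: le_trans lfy _; apply: le_trans ly.
  by rewrite ler_piMl// ltW.
- rewrite iOm; apply/seteqP; split=> [y /stableP[n Gn]|y [n _ [Gn _]]]; last first.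
    by apply/stableP; exists n.
  have [m hm] := null_geometric s a11' d0.
  exists (m + n)%N => //=; rewrite /= iterD; have [Gm lm] := local_stable_iter m Gn.
  split => //; apply: le_trans lm _; apply: ltW; apply: le_lt_trans (hm m (leqnn m)).
  by rewrite mulrC ler_wpM2r ?exprn_ge0 ?(ltW a10)//; apply: loc_le; case: Gn.
Qed.

Lemma stable_f_map_iter n (x : W) : val (iter n (stable_f_map : W -> W) x) = iter n f (val x).
Proof.
elim: n => //= n <-; exact: stable_f_mapE.
Qed.

(** Needed in the topology of [N] itself, not of [M]: it lets [stable_unique] carry analyticity near
    [p] to all of the stable set. *)
Lemma stable_orbit_near (x : N) (A : set N) : nbhs (stable_pt p : N) A ->
  exists n, A (iter n (stable_f_map : N -> N) x).
Proof.
move=> hA; have xp : val (stable_pt p) = p by apply: stable_ptK; exact: stable_p.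
have p0 : dom (schart 0) (stable_pt p) := schart0_p xp.
have fx0 : fwd (schart 0) (stable_pt p) = 0.
  by change (P (loc (val (stable_pt p))) = 0); rewrite xp locp (linear_fun0 lP).
have := near_bwd (atlas_homeo (hN 0)) p0 hA; rewrite fx0 => /nbhs_unorm[e e0 he].
have [m Gm] := schart_cover x.
have [k hk'] := null_geometric s a11' e0.
have [Gk lk] := local_stable_iter k Gm; exists (k + m)%N.
have kx : dom (schart 0) (iter (k + m) (stable_f_map : W -> W) x).
  by change (local_stable (val (iter (k + m) (stable_f_map : W -> W) x))); rewrite stable_f_map_iter iterD.
have [|_ _] := he (fwd (schart 0) (iter (k + m) (stable_f_map : W -> W) x)).
  rewrite subr0.
  change (unorm (P (loc (val (iter (k + m) (stable_f_map : W -> W) x)))) < e).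
  rewrite stable_f_map_iter iterD; apply: le_lt_trans (nP _) _; apply: le_lt_trans lk _.
  apply: le_lt_trans (hk' k (leqnn k)); rewrite mulrC ler_wpM2r ?exprn_ge0 ?(ltW a10)//.
  by apply: loc_le; case: Gm.
by rewrite schartK.
Qed.

(** * Uniqueness of the manifold structure *)

Section uniqueness.
Variables (F' : ultraBanachType K) (N' : manifold F' W).
Hypotheses (imm : immersed_submanifold M N') (dif : restricts_to_diffeo N' f).
Hypothesis tan : tangent_subspace N' p =
  [set v | exists u, tangent_val v (exist _ kappa (conj Mk kp) : chart_at p) = Th' (J u)].

Let x0 : W := stable_pt p.

Let x0p : val x0 = p. Proof. exact/stable_ptK/stable_p. Qed.

Let x00 : dom (schart 0) x0. Proof. exact: schart0_p. Qed.

Let fx00 : fwd (schart 0) x0 = 0.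
Proof. by change (P (loc (val x0)) = 0); rewrite x0p locp (linear_fun0 lP). Qed.

Let mi (x : N') : man_at (inclusion : N' -> M) x.
Proof. by have [/analytic_mapP] := imm. Qed.

Let kx0 : dom kappa (inclusion (x0 : N') : M).
Proof. by rewrite /inclusion x0p. Qed.

Let reprk (c : chart W F') : F' -> E := fwd kappa \o (inclusion : N' -> M) \o bwd c.

Lemma analytic_at_reprk c : atlas N' c -> dom c x0 -> analytic_at (fwd c x0) (reprk c).
Proof. by move=> Mc cx; apply: man_at_charts. Qed.

(** Immersion makes the differential of the inclusion injective and [tan] identifies its image with
    the stable subspace, so it factors through a bounded bijection [T] onto [F], to which
    [bounded_inverse] applies. *)
Lemma unique_differential c : atlas N' c -> dom c x0 ->
  exists (T : F' -> F) (B : F -> F'),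
    [/\ bounded_linear B, cancel T B, cancel B T
      & is_differential (Th \o reprk c) (fwd c x0) (J \o T)].
Proof.
move=> Mc cx; have aq := analytic_at_reprk Mc cx.
have dq := analytic_at_differential aq; set D := differential _ _ in dq.
have [bD _] := (is_differentialP _ _ _).1 dq.
pose cc : chart_at (x0 : N') := exist _ c (conj Mc cx).
pose dk : chart_at p := exist _ kappa (conj Mk kp).
(* The same chart as [dk], at a point only provably equal to [p]: [tan] speaks of [p], the immersion
   of [inclusion x0]. *)
pose di : chart_at (inclusion (x0 : N') : M) := exist _ kappa (conj Mk kx0).
have DE w : tangent_val (tangent_map (inclusion : N' -> M) (x0 : N') p w) dk = D (tangent_val w cc).
  exact: (tangent_mapE w cc dk (mi x0) x0p).
have DJ w : exists u, D w = Th' (J u).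
  have : tangent_subspace N' p (tangent_map (inclusion : N' -> M) (x0 : N') p (tangent_of cc w)).
    by exists (x0 : N') => //; exists (tangent_of cc w).
  by rewrite tan /= DE tangent_ofK.
pose T w := P (Th (D w)).
have ThD w : Th (D w) = J (T w).
  by have [u hu] := DJ w; rewrite /T hu !Th'K PJ.
have bP : bounded_linear P by split => //; exists 1 => // z; rewrite mul1r.
have bT : bounded_linear T by exact: (bounded_linear_comp (bounded_linear_comp bD bTh) bP).
have injT : injective T.
  move=> w w' ww; have [inj _] := proj2 imm (x0 : N').
  have := inj (tangent_of cc w) (tangent_of cc w') _.
  move=> /(_ _)/(congr1 (fun v => tangent_val v cc)); rewrite !tangent_ofK; apply.
  apply: (@tangent_inj _ _ _ _ _ _ _ _ di).
  rewrite !(tangent_mapE _ cc di (mi x0) erefl) !tangent_ofK.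
  by apply: (can_inj ThK); rewrite !ThD ww.
have surT u : exists w, T w = u.
  have : tangent_subspace N' p (tangent_of dk (Th' (J u))).
    by rewrite tan; exists u; rewrite tangent_ofK.
  move=> [x xp [w hw]].
  have xx0 : x = x0 by apply: val_inj; rewrite x0p.
  subst x; exists (tangent_val w cc); rewrite /T -DE.
  have -> : tangent_map (inclusion : N' -> M) (x0 : N') p w = tangent_of dk (Th' (J u)) := hw.
  by rewrite tangent_ofK Th'K PJ.
have [B [bB TB BT]] := bounded_inverse bT surT injT.
exists T, B; split => //.
have -> : J \o T = Th \o D by apply/funext => w; rewrite /= ThD.
by apply: is_differential_comp => //; exact: is_differential_linear.
Qed.

Lemma unique_near_local_stable : \forall x \near (x0 : N'), local_stable (val x).
Proof.
have [c Mc cx] := atlas_cover N' x0; have hc := atlas_homeo Mc.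
have [T [B [[lB [CB CB0 hB]] TB BT dT]]] := unique_differential Mc cx.
set c0 := fwd c x0 in dT.
have q0 : (Th \o reprk c) c0 = 0.
  by rewrite /reprk /c0 /= (chart_fwdK hc cx) /inclusion x0p k0 (linear_fun0 lTh).
have kq (x : W) : dom c x -> (Th \o reprk c) (fwd c x) = loc (val x).
  by move=> cx'; rewrite /reprk /= (chart_fwdK hc cx').
have [_ hT] := (is_differentialP _ _ _).1 dT.
have CB1 : 0 < CB + 1 by rewrite ltr_wpDl.
have half0 : (0 : R) < 2^-1 by rewrite invr_gt0.
(* As [unorm y] is at most [CB] times the norm of [T y], this tolerance makes the linearisation
   error at most half of [unorm (T y)], so the stable component has the full norm. *)
have [d d0 hd] := hT (2^-1 / (CB + 1)) (divr_gt0 half0 CB1).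
pose good (x : W) := [/\ dom c x, dom kappa (val x),
  unorm (loc (val x)) <= unorm (P (loc (val x)))
  & unorm (fwd c x - c0) <= CB * unorm (P (loc (val x)))].
have good_near : \forall x \near (x0 : N'), good x.
  have n1 := dom_nbhs hc cx.
  have n2 : \forall x \near (x0 : N'), dom kappa (val x).
    exact: (man_at_continuous (mi x0) (dom_nbhs hk kx0)).
  have n3 : \forall x \near (x0 : N'), unorm (fwd c x - c0) < d.
    exact: (chart_fwd_continuous hc cx (near_unorm _ d0)).
  apply: filterS3 n1 n2 n3 => x cx' kx xd.
  have := hd _ xd; rewrite q0 subr0 [c0 + _]addrC subrK kq//.
  set y := fwd c x - c0; set l := loc (val x) => h.
  have By : unorm y <= CB * unorm (T y) by rewrite -{1}(TB y).
  have h' : unorm (l - J (T y)) <= 2^-1 * unorm (T y).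
    apply: le_trans h _; rewrite -mulrA ler_wpM2l// mulrC ler_pdivrMr//.
    by apply: le_trans By _; rewrite mulrC ler_wpM2l// lerDl.
  have hh : 2^-1 * unorm (T y) <= unorm (T y) by rewrite ler_piMl// invf_le1// ler1n.
  have l1 : unorm l <= unorm (T y).
    by rewrite -[l](subrK (J (T y))); apply: (unD_le uE); rewrite ?nJ//; exact: le_trans hh.
  have l2 : unorm (T y) <= unorm (P l).
    have h2 : unorm (P l - T y) <= 2^-1 * unorm (T y).
      by rewrite -[X in P l - X]PJ -(linear_funB lP); apply: le_trans (nP _) h'.
    rewrite leNgt; apply/negP => lt.
    have Ty1 : 0 < unorm (T y) by apply: le_lt_trans lt; exact: unorm_ge0.
    have : unorm (T y) < unorm (T y).
      rewrite -{1}[T y](subKr (P l)); apply: (unB_lt uE) => //.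
      by apply: le_lt_trans h2 _; rewrite gtr_pMl// invf_lt1// ltr1n.
    by rewrite ltxx.
  split => //; first exact: le_trans l2.
  by apply: le_trans By _; rewrite ler_wpM2l.
have [g' [mg' _] g'E] := dif; have {}mg' := (analytic_mapP _).1 mg'.
have g'x0 : g' x0 = x0.
  apply: val_inj; rewrite (_ : val (g' x0) = f (val x0)); last exact: (g'E x0).
  by rewrite x0p local_stable_fixed.
have n2 : \forall x \near (x0 : N'), good (g' x).
  by apply: (man_at_continuous (mg' x0)); rewrite g'x0.
have := near_bwd hc cx n2; rewrite -/c0 => /nbhs_unorm[rho rho0 hrho].
(* Stable components up to [del] keep the coordinates within [rho] of [c0], so [g' x] is good again;
   as [f] contracts there, [S] is invariant. *)
pose del := rho / (CB + 1); have del0 : 0 < del by rewrite divr_gt0.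
pose S (x : W) := good x /\ unorm (P (loc (val x))) <= del.
have S_g x : S x -> S (g' x) /\ unorm (loc (f (val x))) <= a1 * unorm (loc (val x)).
  move=> [[cx' kx lx xc] xd].
  have gg : good (g' x).
    have [|_ _] := hrho (fwd c x); last by rewrite (chart_fwdK hc cx').
    apply: le_lt_trans xc _; apply: le_lt_trans (ler_wpM2l CB0 xd) _.
    rewrite /del mulrCA -{2}[rho]mulr1 ltr_pM2l// ltr_pdivrMr// mul1r.
    by rewrite ltrDl.
  have [_ kgx lgx _] := gg.
  have gE : val (g' x) = f (val x) := g'E x.
  rewrite gE in kgx lgx; have h3 := H3 kx kgx.
  split; last exact: le_trans lgx h3.
  split => //; rewrite gE; apply: le_trans h3 _.
  apply: (@le_trans _ _ (unorm (loc (val x)))); first by rewrite ler_piMl// ?unorm_ge0 ?ltW.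
  exact: le_trans xd.
have S_orbit x n : S x -> dom kappa (iter n f (val x)) /\
    unorm (loc (iter n f (val x))) <= a1 ^+ n * unorm (loc (val x)).
  move=> Sx.
  suff : S (iter n g' x) /\ unorm (loc (val (iter n g' x))) <= a1 ^+ n * unorm (loc (val x)).
    have <- : val (iter n g' x) = iter n f (val x).
      by elim: n => //= n <-; exact: (g'E _).
    by move=> [[[_ h1 _ _] _] h2]; split.
  elim: n => [|n [IH1 IH2]]; first by rewrite mul1r.
  have [h1 h2] := S_g _ IH1; split => //.
  have -> : val (iter n.+1 g' x) = f (val (iter n g' x)) := g'E _.
  by apply: le_trans h2 _; rewrite exprS -mulrA ler_wpM2l// ltW.
have n3 : \forall x \near (x0 : N'), unorm (P (loc (val x))) <= del.
  have h : nbhs (inclusion (x0 : N') : M) [set z | unorm (P (loc z)) <= del].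
    apply: (@filterS _ _ _ (fwd kappa @^-1` [set e | unorm (Th e) <= del])).
      by move=> z /= ze; apply: le_trans (nP _) ze.
    apply: (chart_fwd_continuous hk kx0).
    apply: open_nbhs_nbhs; split; first exact: (open_an_ball del0 (fun y => analytic_at_linear y bTh)).
    by rewrite /= /inclusion x0p k0 (linear_fun0 lTh) (un0 uE) ltW.
  exact: (man_at_continuous (mi x0) h).
apply: filterS2 good_near n3 => x gx xd; have Sx : S x by [].
apply: local_stable_of_orbit => [n|]; first by have [] := S_orbit x n Sx.
have ba : 0 <= b * a1 < 1.
  rewrite mulr_ge0 ?(ltW a10) ?(ltW b0)//=; apply: lt_trans ab.
  by rewrite mulrC ltr_pM2r.
apply: null_le (null_geometric (unorm (loc (val x))) ba) => n.
have [_ h] := S_orbit x n Sx.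
apply: le_trans (ler_wpM2l (exprn_ge0 n (ltW b0)) h) _.
by rewrite mulrA -exprMn mulrC.
Qed.

(** In the charts [c] and [schart 0] the identity from [N'] to [N] is the stable component of the
    inclusion, legitimate near [p] by [unique_near_local_stable]. Its differential is the
    isomorphism [T], so [inverse_ps] yields the other direction. *)
Lemma unique_at :
  man_at (id : N' -> N) (x0 : N') /\ man_at (id : N -> N') (x0 : N).
Proof.
have [c Mc cx] := atlas_cover N' x0; have hc := atlas_homeo Mc.
have [T [B [bB TB BT dT]]] := unique_differential Mc cx.
have nG := unique_near_local_stable.
have bP : bounded_linear P by split => //; exists 1 => // z; rewrite mul1r.
set c0 := fwd c x0 in dT.
have aq : analytic_at c0 (P \o (Th \o reprk c)).
  apply: analytic_at_comp (analytic_at_linear _ bP).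
  exact: analytic_at_comp (analytic_at_reprk Mc cx) (analytic_at_linear _ bTh).
have qE (x : W) : dom c x -> (P \o (Th \o reprk c)) (fwd c x) = fwd (schart 0) x.
  by move=> cx'; rewrite /reprk /= (chart_fwdK hc cx').
split; first exact: (man_at_chart Mc (hN 0) cx nG).
have dT' : is_differential (P \o (Th \o reprk c)) c0 T.
  have -> : T = P \o (J \o T) by apply/funext => w /=; rewrite PJ.
  by apply: is_differential_comp => //; exact: is_differential_linear.
pose q y := (P \o (Th \o reprk c)) (c0 + y).
have q0 : q 0 = 0 by rewrite /q addr0 qE.
have [r [C [r0 pq]]] := aq.
have dq : is_differential q 0 T.
  have [bT hT] := (is_differentialP _ _ _).1 dT'.
  apply/is_differentialP; split => // e /hT[d d0 hd]; exists d => // y yd.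
  by rewrite add0r /q addr0; exact: hd.
have [s' [t [h [[s'0 t0 _ ph] [h0 qh _]]]]] := inverse_ps r0 pq q0 dq bB TB BT.
have ah : analytic_at 0 h by apply: (ps_an t0 ph); rewrite (un0 uE) ltW.
(* The local inverse [h] is meaningful only where the point over [c0 + h v] is in the local stable
   manifold, so that [schart 0] recovers it from [v]. *)
have key : \forall v \near (0 : F), dom c (bwd (schart 0) v) /\ fwd c (bwd (schart 0) v) = c0 + h v.
  have n1 : \forall u \near c0, [/\ cod c u, dom c (bwd c u) & local_stable (val (bwd c u))].
    exact: (near_bwd hc cx nG).
  pose Q : set F' := [set u | [/\ cod c u, dom c (bwd c u) & local_stable (val (bwd c u))]].
  have n2 : \forall v \near (0 : F), Q (c0 + h v).
    have ac : analytic_at 0 (fun v : F => c0 + h v).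
      by apply: (analytic_at_add (f := fun=> c0)) => //; exact: analytic_at_cst.
    have nQ : nbhs (c0 + h 0) Q by rewrite h0 addr0.
    exact: (analytic_at_continuous ac nQ).
  have n3 : \forall v \near (0 : F), unorm v <= t.
    apply: open_nbhs_nbhs; split; first exact: open_closed_ball.
    by rewrite /= (un0 uE) ltW.
  apply: filterS2 n2 n3 => v [cv dv Gv] vt.
  have dv0 : dom (schart 0) (bwd c (c0 + h v)) := Gv.
  have e : bwd (schart 0) v = bwd c (c0 + h v).
    have e1 : fwd (schart 0) (bwd c (c0 + h v)) = v.
      by rewrite -qE// (chart_bwdK hc cv) -[RHS](qh _ vt).
    by have := schartK dv0; rewrite e1.
  by rewrite e (chart_bwdK hc cv).
apply: (man_at_chart (hN 0) Mc x00).
  have n1 : nbhs (x0 : N) (fwd (schart 0) @^-1` [set v | dom c (bwd (schart 0) v)]).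
    apply: (chart_fwd_continuous (atlas_homeo (hN 0)) x00); rewrite fx00.
    by apply: filterS key => v [].
  apply: filterS2 (dom_nbhs (atlas_homeo (hN 0)) x00) n1 => y y0 cy.
  have : dom c (bwd (schart 0) (fwd (schart 0) y)) := cy.
  by rewrite (schartK y0).
rewrite fx00; apply: (@analytic_at_near _ _ _ _ _ (fun v : F => c0 + h v)).
  by apply: filterS key => v [_ /= ->].
by apply: (analytic_at_add (f := fun=> c0)) => //; exact: analytic_at_cst.
Qed.

(** Each identity is conjugate to itself by iterates of [f], diffeomorphisms for both structures;
    some iterate brings a given point into the neighbourhood where [unique_at] has settled the
    matter. *)
Lemma stable_unique : same_structure N' N.
Proof.
have [m1 m2] := unique_at.
have [g' [mg' [h' [mh' g'K h'K]]] g'E] := dif.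
have {}mg' := (analytic_mapP _).1 mg'; have {}mh' := (analytic_mapP _).1 mh'.
have gE : g' = stable_f_map.
  by apply/funext => x; apply: val_inj; rewrite stable_f_mapE; exact: g'E.
pose G12 : set N := fun y => man_at (id : N' -> N) (y : N') /\ man_at (id : N -> N') y.
have near12 : nbhs (x0 : N) G12.
  apply: filterS2 (man_at_near m2) (man_at_continuous m2 (man_at_near m1)) => y h1 h2.
  by split.
have all x : man_at (id : N' -> N) (x : N') /\ man_at (id : N -> N') (x : N).
  have [n [i1 i2]] := stable_orbit_near x near12.
  split.
    apply: (man_at_ext (f := (iter n (stable_g_map : N -> N)) \o (id : N' -> N) \o iter n g')).
      apply: (@filterE _ (nbhs (x : N'))) => y /=; rewrite gE; elim: n {i1 i2} => //= n IH.
      by rewrite -iterS iterSr stable_f_mapK.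
    have i1' : man_at (id : N' -> N) (iter n g' x) by rewrite gE.
    exact: (man_at_comp (man_at_comp (man_at_iter n x mg') i1')
      (man_at_iter n _ man_at_stable_g)).
  apply: (man_at_ext (f := (iter n h') \o (id : N -> N') \o iter n (stable_f_map : N -> N))).
    apply: (@filterE _ (nbhs (x : N))) => y /=; rewrite -gE; elim: n {i1 i2} => //= n IH.
    by rewrite -iterS iterSr g'K.
  exact: (man_at_comp (man_at_comp (man_at_iter n (x : N) man_at_stable_f) i2)
    (man_at_iter n _ mh')).
split; first by apply/analytic_mapP => x; have [] := all x.
by exists id; split => //; apply/analytic_mapP => x; have [] := all x.
Qed.

End uniqueness.

End stable_manifold_properties.

End stable_manifold.

(** * From a hyperbolic splitting to the data of the graph transform *)

Lemma lte_inve (R : realType) (a : R) (x : \bar R) : 0 < a -> (0 <= x)%E ->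
  (a%:E < x^-1)%E -> (x < (a^-1)%:E)%E.
Proof.
move=> a0; case: x => [r| |//].
  rewrite lee_fin le_eqVlt => /predU1P[<-|r0]; first by rewrite lte_fin invr_gt0.
  rewrite inver gt_eqF// !lte_fin => ar.
  by rewrite -[r]invrK ltf_pV2 ?posrE ?invr_gt0.
by rewrite invey lte_fin => _ /(lt_trans a0); rewrite ltxx.
Qed.

Section hyperbolic_data.
Context {R : realType} {K : ultraFieldType R} {V : ultraBanachType K}.
Local Notation uV := (@unorm_ultrametric R K V).
Variables (a : R) (A : V -> V) (Es Eu : set V) (beta : V -> V).
Hypotheses (a0 : 0 < a) (lA : linear A) (ds : direct_sum Es Eu).
Hypotheses (As : forall x, Es x -> Es (A x)) (Au : forall x, Eu x -> Eu (A x)).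
Hypothesis nV : forall x y, Es x -> Eu y -> unorm (x + y) = Num.max (unorm x) (unorm y).
Hypothesis ns : (operator_norm unorm Es A < a%:E)%E.
Hypotheses (bu : forall x, Eu x -> Eu (beta x)).
Hypotheses (bA : forall x, Eu x -> beta (A x) = x) (Ab : forall x, Eu x -> A (beta x) = x).
Hypothesis nu : (a%:E < (operator_norm unorm Eu beta)^-1)%E.

(** [F] is the stable subspace, [P] the projection along the unstable one, [G] the inverse on the
    unstable part extended by 0. The constants are midpoints: positive even if the operator norms
    vanish, yet strictly below [a] and 1/a. *)
Lemma hyperbolic_data : exists (F : ultraBanachType K) (J : F -> V) (P : V -> F)
    (A1 : F -> F) (G : V -> V) (a1 b : R),
  [/\ linear J, linear P, linear G, linear A1 & Es = range J] /\
  [/\ forall u, P (J u) = u, forall u, unorm (J u) = unorm u,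
      forall x, unorm (P x) <= unorm x, forall u, A (J u) = J (A1 u)
    & forall x, P (A x) = A1 (P x)] /\
  [/\ 0 < a1, a1 < a, 0 < b & a * b < 1] /\
  [/\ forall u, unorm (A1 u) <= a1 * unorm u, forall x, unorm (G x) <= b * unorm x,
      forall x, P (G x) = 0, forall x, A (G x) = x - J (P x)
    & forall w, P w = 0 -> unorm w <= b * unorm (A w)].
Proof.
have [hEs hEu dis sp] := ds; have [Eu0 EuD] := hEu.
(* The distance from [x] to the stable subspace is at least the norm of its unstable component,
   because the norm of a sum is a maximum. *)
have cl x : (forall e : R, 0 < e -> exists2 y, Es y & unorm (y - x) < e) -> Es x.
  move=> hx; have [y Ey Ez] := sp x; suff -> : x = y by [].
  apply/subr0_eq/(un_small0 uV) => e /hx[w Ew wx].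
  have e1 : w - x = (w - y) + - (x - y) by rewrite opprB addrA subrK.
  have Ewy : Es (w - y) by rewrite addrC -scaleN1r; apply: (proj2 hEs).
  have EN : Eu (- (x - y)) by have := EuD (-1) _ _ Ez Eu0; rewrite scaleN1r addr0.
  move: wx; rewrite e1 nV// gt_max => /andP[_]; rewrite (unN uV); exact: ltW.
pose F := closed_subspace hEs cl.
pose J : F -> V := \val.
have /boolp.choice[P hP] : forall x, exists u : F, Eu (x - J u).
  move=> x; have [y Ey Ez] := sp x.
  by have [u hu] := @closed_subspace_exists _ _ _ _ hEs cl _ Ey; exists u; rewrite /J hu.
have JEs u : Es (J u) := closed_subspaceP u.
have lJ : linear J by [].
have Pu x u : Eu (x - J u) -> P x = u.
  move=> h; apply/val_inj/subr0_eq; change (J (P x) - J u = 0).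
  suff : (Es `&` Eu) (J (P x) - J u) by rewrite dis.
  split; first by rewrite addrC -scaleN1r; apply: (proj2 hEs).
  have -> : J (P x) - J u = (-1) *: (x - J (P x)) + (x - J u) by rewrite scaleN1r; abel.
  exact: EuD.
have lP : linear P.
  move=> c x y; apply: Pu; rewrite lJ.
  have -> : c *: x + y - (c *: J (P x) + J (P y)) = c *: (x - J (P x)) + (y - J (P y)).
    by rewrite scalerBr opprD addrACA.
  exact: EuD.
have PJ u : P (J u) = u by apply: Pu; rewrite subrr.
have PEu w : Eu w -> P w = 0 by move=> Ew; apply: Pu; rewrite (linear_fun0 lJ) subr0.
have nE x : unorm x = Num.max (unorm (P x)) (unorm (x - J (P x))).
  by rewrite -nV// addrC subrK.
have nP x : unorm (P x) <= unorm x by rewrite [leRHS]nE le_max lexx.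
have nQ x : unorm (x - J (P x)) <= unorm x by rewrite [leRHS]nE le_max lexx orbT.
have /boolp.choice[A1 hA1] : forall u, exists u' : F, J u' = A (J u).
  by move=> u; exact: (@closed_subspace_exists _ _ _ _ hEs cl _ (As (JEs u))).
have lA1 : linear A1.
  move=> c u w; apply/val_inj; change (J (A1 (c *: u + w)) = J (c *: A1 u + A1 w)).
  by rewrite hA1 lJ lA lJ !hA1.
have PA x : P (A x) = A1 (P x).
  by apply: Pu; rewrite hA1 -(linear_funB lA); apply: Au.
have [C1 [C10 hC1] C1a] : exists2 C : R,
    0 <= C /\ (forall x, Es x -> unorm (A x) <= C * unorm x) & C < a.
  have [_ [C hC <-]] := ereal_inf_lt ns; rewrite lte_fin => Ca.
  by exists C.
have [C2 [C20 hC2] C2a] : exists2 C : R,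
    0 <= C /\ (forall x, Eu x -> unorm (beta x) <= C * unorm x) & C < a^-1.
  have o0 : (0 <= operator_norm unorm Eu beta)%E.
    by apply: le_ereal_inf_tmp => _ [C [C0 _] <-]; rewrite lee_fin.
  have [_ [C hC <-]] := ereal_inf_lt (lte_inve a0 o0 nu); rewrite lte_fin => Ca.
  by exists C.
pose G x := beta (x - J (P x)).
have EuG x : Eu (G x) by apply: bu.
have AG x : A (G x) = x - J (P x) by apply: Ab.
(* [beta] is given as a bare function; on [Eu] it inherits linearity from [A], which it inverts. *)
have lG : linear G.
  move=> c x y; rewrite -(bA (EuG _)) AG.
  rewrite -[RHS]bA; last exact: EuD.
  by congr beta; rewrite lA !AG lP lJ scalerBr opprD addrACA.
exists F, J, P, A1, G, ((C1 + a) / 2), ((C2 + a^-1) / 2).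
have l1 : C1 <= (C1 + a) / 2 by lra.
have l2 : C2 <= (C2 + a^-1) / 2 by lra.
split.
  split => //; apply/seteqP; split=> [x Ex|_ [u _ <-]//].
  by have [u hu] := @closed_subspace_exists _ _ _ _ hEs cl _ Ex; exists u.
split; first by split.
split.
  split; [lra|lra|lra|].
  by rewrite -[ltRHS](mulfV (lt0r_neq0 a0)) ltr_pM2l//; lra.
split => //.
- move=> u; change (unorm (J (A1 u)) <= (C1 + a) / 2 * unorm (J u)); rewrite hA1.
  by apply: le_trans (hC1 _ (JEs u)) _; rewrite ler_wpM2r.
- move=> x; apply: le_trans (hC2 _ (hP x)) _; apply: ler_pM => //; lra.
- by move=> x; apply: PEu.
- move=> w Pw; have Ew : Eu w by have := hP w; rewrite Pw (linear_fun0 lJ) subr0.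
  rewrite -{1}(bA Ew); apply: le_trans (hC2 _ (Au Ew)) _.
  by rewrite ler_wpM2r.
Qed.

End hyperbolic_data.

Theorem theorem1p3 (R : realType) (K : ultraFieldType R) (E : ultraBanachType K)
    (X : Type) (M : manifold E X) (f : M -> M) (p : M) (a : R)
    (f_diffeo : analytic_diffeo f) (f_p : f p = p)
    (a_gt0 : 0 < a) (a_le1 : a <= 1)
    (f_hyperbolic :
      hyperbolic (topology_of (tangent p)) a (tangent_map f p p)) :
  let W := stable_set a f p in
  exists (F : ultraBanachType K) (N : manifold F W),
    [/\ is_stable_manifold a f p N,
        forall (F' : ultraBanachType K) (N' : manifold F' W),
          is_stable_manifold a f p N' -> same_structure N' N
      & forall (x : N) (A : set N), inclusion x = p -> nbhs x A ->
          exists Omega : set N,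
            [/\ open Omega /\ Omega x, Omega `<=` A,
                is_submanifold (inclusion @` Omega : set M),
                f @` (inclusion @` Omega) `<=` inclusion @` Omega
              & W = \bigcup_n (iter n f @^-1` (inclusion @` Omega))]].
Proof.
move=> W.
have [mf0 [g [mg0 fg gf]]] := f_diffeo.
have mf := (analytic_mapP _).1 mf0; have mg := (analytic_mapP _).1 mg0.
set alpha := tangent_map f p p in f_hyperbolic *.
have [lal _ [Es0 [Eu0 hs0]]] := f_hyperbolic.
set Es := stable_subspace (topology_of (tangent p)) a alpha.
(* [stable_subspace] is defined by choice; hyperbolicity supplies a candidate, so the chosen set
   does belong to a splitting. *)
have [Eu hs] : exists Eu, hyperbolic_splitting (topology_of (tangent p)) a alpha Es Eu.
  exact: (@xgetI _ set0 [set Es | exists Eu,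
    hyperbolic_splitting (topology_of (tangent p)) a alpha Es Eu] Es0 (ex_intro _ Eu0 hs0)).
have [ds As Au [n [hn tn nmax ns [beta [bu bA Ab nu]]]]] := hs.
have [c Mc cp] := atlas_cover M p.
pose cc : chart_at p := exist _ c (conj Mc cp).
have [C C0 hC] := norm_equiv hn (tangent_norm_ultrametric cc) tn (tangent_norm_topology cc).
have [C' C'0 hC'] := norm_equiv (tangent_norm_ultrametric cc) hn (tangent_norm_topology cc) tn.
(* The adapted norm is equivalent to the norm read in the chart [c], hence complete; this makes [V]
   an ultrametric Banach space. *)
have cn : metric_complete n.
  apply: (@metric_complete_equiv R K (tangent p : lmodType K) n _ C C' C0 C'0 hC hC').
  exact: (@tangent_norm_complete _ _ _ _ _ _ cc).
pose V : ultraBanachType K := renormed hn cn.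
have [F [J [P [A1 [G [a1 [b [[lJ lP lG lA1 EsJ] [[PJ nJ nP AJ PA] [[a10 a1a b0 ab]
  [nA1 nG PG AG expA]]]]]]]]]]] :=
  @hyperbolic_data R K V a alpha Es Eu beta a_gt0 lal ds As Au nmax ns bu bA Ab nu.
pose Th : E -> V := tangent_of cc.
pose Th' : V -> E := fun v : tangent p => tangent_val v cc.
have ThK : cancel Th Th' by move=> x; exact: tangent_ofK.
have Th'K : cancel Th' Th by move=> v; exact: tangent_valK.
have lTh' : linear Th' by [].
have bTh' : bounded_linear Th' by split => //; exists C'; [exact: ltW|exact: hC'].
have bTh : bounded_linear Th.
  split; first by move=> k x y; apply: (can_inj Th'K); rewrite lTh' !ThK.
  exists C; first exact: ltW.
  by move=> x; rewrite -[in leRHS](ThK x); exact: hC.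
have dfA : (alpha : V -> V) = Th \o differential (fwd c \o f \o bwd c) (fwd c p) \o Th'.
  apply/funext => v; apply: (can_inj Th'K).
  rewrite [RHS](ThK (differential (fwd c \o f \o bwd c) (fwd c p) (Th' v))).
  exact: (tangent_mapE v cc cc (mf p) f_p).
have a1le : a1 <= 1 by apply: le_trans a_le1; exact: ltW.
have a1b : a1 * b < 1 by apply: lt_trans ab; rewrite ltr_pM2r.
have [s [kappa [[s0 Mk kp k0 codk] [dk H2 H3 H4]]]] := straightened_chart
  f_p (mf p) Mc cp bTh bTh' ThK Th'K lJ lP lal lG lA1 PJ nJ nP AJ PA a10 a1le b0 a1b
  nA1 nG PG AG expA dfA.
have [N hN] := stable_manifold_exists mf mg fg gf Mk kp k0 codk bTh bTh' ThK Th'K lJ lP PJ nJ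
  nP s0 a10 a1a a_le1 b0 ab H2 H3 H4.
(* [kappa] and [c] induce the same coordinates on T_p(M), as the change of charts has the identity
   as its differential at [p]; so the stable subspace, known through [c], is described through
   [kappa]. *)
have EsE : Es = [set v | exists u,
    tangent_val v (exist _ kappa (conj Mk kp) : chart_at p) = Th' (J u)].
  have tE (v : tangent p) : tangent_val v (exist _ kappa (conj Mk kp) : chart_at p) = Th' v.
    rewrite (tangent_dtrans v cc) /dtrans /= (differentialE dk).
    by [].
  rewrite EsJ; apply/seteqP; split=> [_ [u _ <-]|v [u]]; first by exists u; rewrite tE.
  by rewrite tE => /(can_inj Th'K) ->; exists u.
exists F, N; split.
- split.
  + exact: (stable_immersed mf mg fg gf Th'K PJ nP s0 b0 ab H4 hN).
  + rewrite -/alpha -/Es EsE.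
    exact: (stable_tangent mf mg fg gf Th'K PJ nP s0 b0 ab H4 hN).
  + exact: (stable_diffeo fg gf Th'K PJ nP s0 b0 ab H4 hN).
- move=> F' N' [imm tan dif].
  apply: (stable_unique fg gf Th'K PJ nP s0 b0 ab H4 hN imm dif).
  by rewrite tan -EsE.
- exact: (stable_neighborhood fg gf Th'K PJ nP s0 b0 ab H4 hN).
Qed.
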